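(* Fix a Lipschitz function $\phi:[0,1]\to[0,\infty)$. Then, as $\epsilon\to0$ with $\epsilon>0$, $$a(\epsilon\phi)=2\epsilon\int_0^1\phi(y)(\sin\pi y)^2\,dy+O(\epsilon^2).$$
   Context: For a Lipschitz function $\phi:[0,1]\to[0,\infty)$ let $\Omega_\infty=\{(x,y)\in\mathbb{R}^2:0<y<1,\ x>-\phi(y)\}$. There is a unique function $U=U_\phi$ on $\Omega_\infty$ (in $H^1$ of every bounded piece $\Omega_\infty\cap\{x<R\}$) satisfying $(\Delta+\pi^2)U=0$ on $\Omega_\infty$, $U=0$ at $\partial\Omega_\infty$, and such that $U-x\sin\pi y$ is bounded. Here $\Delta=\partial_x^2+\partial_y^2$. The number $a(\phi)$ is defined by $a(\phi)=2\int_0^1U(0,y)\sin\pi y\,dy$; equivalently, $U(x,y)-(x+a(\phi))\sin\pi y\to0$ as $x\to\infty$. The number $a(\epsilon\phi)$ is obtained by applying this definition to the function $\epsilon\phi$ in place of $\phi$. *)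

(* Defs.v *)
From HB Require Import structures.
From mathcomp Require Export all_boot all_order all_algebra.
From mathcomp Require Export all_classical all_reals all_analysis.
Export Order.TTheory GRing.Theory Num.Theory.
Export numFieldNormedType.Exports.

Set Implicit Arguments.
Unset Strict Implicit.
Unset Printing Implicit Defensive.

Local Open Scope classical_set_scope.
Local Open Scope ring_scope.

Section HalfStrip.
Context {R : realType}.

Definition leb1 := @lebesgue_measure R.
Definition leb2 := (leb1 \x leb1)%E.

Implicit Types (phi : R -> R) (O : set (R * R)) (p : R * R).
Implicit Types (f U Ux Uy psi : R * R -> R).

Definition Omega_infty phi : set (R * R) :=
  [set p | 0 < p.2 < 1 /\ - phi p.2 < p.1].

Definition Omega_below phi (rho : R) : set (R * R) :=
  Omega_infty phi `&` [set p | p.1 < rho].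

Definition boundary O : set (R * R) := closure O `\` O°.

Definition dx f p : R := derive1 (fun x : R => f (x, p.2)) p.1.
Definition dy f p : R := derive1 (fun y : R => f (p.1, y)) p.2.

Definition fsupport f : set (R * R) := closure [set p | f p != 0].

(* The space C^1_c(O), used as test functions in the weak formulations. *)
Definition C1c O psi : Prop :=
  [/\ forall p, derivable (fun x : R => psi (x, p.2)) p.1 1 /\
                derivable (fun y : R => psi (p.1, y)) p.2 1,
      continuous (dx psi), continuous (dy psi),
      compact (fsupport psi) & fsupport psi `<=` O].

Definition weak_gradient O U Ux Uy : Prop := forall psi, C1c O psi ->
  (\int[leb2]_(p in O) (Ux p * psi p)
     = - (\int[leb2]_(p in O) (U p * dx psi p))) /\
  (\int[leb2]_(p in O) (Uy p * psi p)
     = - (\int[leb2]_(p in O) (U p * dy psi p))).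

Definition square_integrable O f : Prop :=
  measurable_fun O f /\ leb2.-integrable O (fun p => (f p ^+ 2)%:E).

Definition H1_dist2 O U Ux Uy psi : \bar R :=
  (\int[leb2]_(p in O) ((psi p - U p) ^+ 2 + (dx psi p - Ux p) ^+ 2
                        + (dy psi p - Uy p) ^+ 2)%:E)%E.

Definition weak_helmholtz O U Ux Uy : Prop := forall psi, C1c O psi ->
  (\int[leb2]_(p in O) (Ux p * dx psi p + Uy p * dy psi p)
     = pi ^+ 2 * (\int[leb2]_(p in O) (U p * psi p))).

(* [U] is the solution U_phi, in the H^1 sense.  It is its continuous
   representative inside the domain, which gives a meaning to its values on the
   segment x = 0, and its boundary values are 0 both in the trace sense (on each
   bounded piece, U is an H^1 limit of C^1_c functions of the whole domain) and
   pointwise; the latter fixes the value U (0, y) at the y with phi y = 0, for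
   which (0, y) is a boundary point.  Other values of U outside the domain are
   irrelevant. *)
Definition is_U phi U : Prop :=
  let O := Omega_infty phi in
  [/\ {in O, continuous U},
      {in boundary O, forall p, U p = 0},
      exists Ux Uy : R * R -> R,
        [/\ weak_gradient O U Ux Uy,
            forall rho, [/\ square_integrable (Omega_below phi rho) U,
                            square_integrable (Omega_below phi rho) Ux &
                            square_integrable (Omega_below phi rho) Uy],
            weak_helmholtz O U Ux Uy &
            forall rho e : R, 0 < e -> exists2 psi, C1c O psi &
              (H1_dist2 (Omega_below phi rho) U Ux Uy psi < e%:E)%E] &
      exists M : R, forall p, O p -> `|U p - p.1 * sin (pi * p.2)| <= M].

Definition is_a phi (a : R) : Prop := exists2 U, is_U phi U &
  a = 2 * \int[leb1]_(y in `[0, 1]) (U (0, y) * sin (pi * y)).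

End HalfStrip.

(* Main.v *)
Require Import Defs.
From mathcomp Require Import ring lra measurable_realfun.

(** Write [s y = sin (pi * y)], let [B (u, v)] be the integral over the domain of
    [grad u * grad v - pi ^ 2 * u * v], and let [l z] be the integral of
    [z (0, y) * s y] over the unit interval. The expansion rests on a variational
    principle for half of [a].

    Let [W = U - max (x, 0) * s]. It is bounded, vanishes on the boundary, and its
    trace on [x = 0] is that of [U], so that [l W] is half of [a]. The function
    subtracted solves the equation off [x = 0], with a jump [s] of its derivative
    there; hence [B (W, z) = l z] for all [z] vanishing on the boundary. The form
    [B] is nonnegative, because [pi ^ 2] is the lowest Dirichlet eigenvalue of
    vertical lines ([wirtinger_test]). Therefore half of [a] equals [B (W, W)] and
    is the maximum of [2 * l z - B (z, z)].

    Upper bound. As [z] vanishes on the left boundary, [l z] is the integral of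
    [s * z_x] over the part of the domain with [x < 0], while [B (z, z)] is at
    least the integral of the square of [z_x]. By completing the square, half of
    [a] is at most the integral of [s ^ 2] over that part, which for the profile
    [eps * phi] is [eps] times the integral of [phi * s ^ 2] ([half_a_le]): there
    is no error term on this side.

    Lower bound. The square is nearly zero for a trial function that rises with
    slope [s] from the left boundary to [x = 0] and then fades out over a unit
    length. Its value on [x = 0] is [eps * phi * s], so the fading and the
    [y]-derivative cost [O (eps ^ 2)]. To make it an admissible test function it is
    smoothed at scale [eps ^ 2], and the profile is replaced by its average at
    scale [eps] ([smooth_minorant]), which changes [eps * phi] by [O (eps ^ 2)]
    ([half_a_approx]).

    Both bounds are instances of [energy_inequality]. There [U] is a mean-square
    limit of test functions on bounded pieces of the domain only, and [W] does not
    have bounded support. So the computation is done with a cutoff of width [w]; as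
    [W] is bounded, the remainder is [O (1 / w)] and disappears. The equation
    enters through the [s] component of [U], whose derivative is constant in
    [x > 0] ([zero_flux]), and through [U] itself as a test function. Values on
    [x = 0] enter as limits of the traces of the approximating functions
    ([trace_left], [trace_right]); [flux_trace] identifies the limit with the
    integral that defines half of [a]. *)

Set Implicit Arguments.
Unset Strict Implicit.
Unset Printing Implicit Defensive.

Local Open Scope classical_set_scope.
Local Open Scope ring_scope.

(** * Mean-square convergence of integrals *)

Lemma cvg_seq_eq {R : realType} (u v : nat -> R) (l : R) :
  v =1 u -> u @ \oo --> l -> v @ \oo --> l.
Proof. by move=> /funext ->. Qed.

Lemma cvg_seqD {R : realType} (u v : nat -> R) (a b : R) :
  u @ \oo --> a -> v @ \oo --> b -> (fun n => u n + v n) @ \oo --> a + b.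
Proof. by move=> ua vb; apply: cvgD. Qed.

Lemma cvg_seqB {R : realType} (u v : nat -> R) (a b : R) :
  u @ \oo --> a -> v @ \oo --> b -> (fun n => u n - v n) @ \oo --> a - b.
Proof. by move=> ua vb; apply: cvgB. Qed.

Lemma cvg_seqZ {R : realType} (c : R) (u : nat -> R) (a : R) :
  u @ \oo --> a -> (fun n => c * u n) @ \oo --> c * a.
Proof. by move=> ua; apply: cvgMr. Qed.

Lemma cvg_seqM {R : realType} (u v : nat -> R) (a b : R) :
  u @ \oo --> a -> v @ \oo --> b -> (fun n => u n * v n) @ \oo --> a * b.
Proof. by move=> ua vb; apply: cvgM. Qed.

Lemma cvg_seq_unique {R : realType} (u : nat -> R) (a b : R) :
  u @ \oo --> a -> u @ \oo --> b -> a = b.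
Proof. by move=> ua ub; apply: (cvg_unique _ ua ub); exact: Rhausdorff. Qed.

Lemma cvg_seq_ge0 {R : realType} (u : nat -> R) (a : R) :
  u @ \oo --> a -> (forall n, 0 <= u n) -> 0 <= a.
Proof.
move=> ua u0; apply: (@ler_cvg_to _ _ _ _ (fun=> 0) u) ua _; first exact: cvg_cst.
exact: nearW.
Qed.

Lemma cvg_seq_cst {R : realType} (a : R) : (fun _ : nat => a) @ \oo --> a.
Proof. exact: cvg_cst. Qed.

Lemma normM_le_sqrD {R : realType} (a b : R) : `|a * b| <= a ^+ 2 + b ^+ 2.
Proof. by rewrite ler_norml; apply/andP; split; nra. Qed.

Section SquareIntegrable.
Context {d : measure_display} {T : measurableType d} {R : realType}.
Variable mu : {measure set T -> \bar R}.
Implicit Types f g k : T -> R.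

Definition summable f : Prop := mu.-integrable setT (EFin \o f).

Definition bounded_meas k : Prop :=
  measurable_fun setT k /\ exists M, forall t, `|k t| <= M.

Definition sq_summable f : Prop :=
  measurable_fun setT f /\ summable (fun t => f t ^+ 2).

Lemma summable_meas f : summable f -> measurable_fun setT f.
Proof. by move=> /measurable_int /measurable_EFinP. Qed.

Lemma summable_le g f : summable g -> measurable_fun setT f ->
  (forall t, `|f t| <= g t) -> summable f.
Proof.
move=> gi mf fg; apply: (le_integrable measurableT _ _ gi).
  exact/measurable_EFinP.
by move=> t _ /=; rewrite lee_fin (le_trans (fg t))// ler_norm.
Qed.

Lemma summableD f g : summable f -> summable g -> summable (fun t => f t + g t).
Proof.
by move=> fi gi; have := integrableD measurableT fi gi.
Qed.

Lemma summableB f g : summable f -> summable g -> summable (fun t => f t - g t).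
Proof.
by move=> fi gi; have := integrableB measurableT fi gi.
Qed.

Lemma summableZ c f : summable f -> summable (fun t => c * f t).
Proof.
by move=> fi; have := integrableZl measurableT c fi.
Qed.

Lemma summable_norm f : summable f -> summable (fun t => `|f t|).
Proof.
by move=> fi; have := integrable_abse fi.
Qed.

Lemma summableM_bounded k f : bounded_meas k -> summable f ->
  summable (fun t => k t * f t).
Proof.
move=> [mk [M kM]] fi; apply: (@summable_le (fun t => M * `|f t|)).
- exact/summableZ/summable_norm.
- by apply: measurable_funM => //; exact: summable_meas.
- by move=> t; rewrite normrM ler_wpM2r.
Qed.

Lemma RintD f g : summable f -> summable g ->
  \int[mu]_t (f t + g t) = \int[mu]_t f t + \int[mu]_t g t.
Proof. by move=> *; rewrite RintegralD. Qed.

Lemma RintB f g : summable f -> summable g ->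
  \int[mu]_t (f t - g t) = \int[mu]_t f t - \int[mu]_t g t.
Proof. by move=> *; rewrite RintegralB. Qed.

Lemma RintZ c f : summable f -> \int[mu]_t (c * f t) = c * \int[mu]_t f t.
Proof. by move=> *; rewrite RintegralZl. Qed.

Lemma Rint_le f g : summable f -> summable g -> (forall t, f t <= g t) ->
  \int[mu]_t f t <= \int[mu]_t g t.
Proof. by move=> *; apply: le_Rintegral. Qed.

Lemma Rint_norm_le f g : summable g -> measurable_fun setT f ->
  (forall t, `|f t| <= g t) -> `|\int[mu]_t f t| <= \int[mu]_t g t.
Proof.
move=> gi mf fg; have fi := summable_le gi mf fg.
rewrite (le_trans (le_normr_Rintegral measurableT fi))//.
by apply: Rint_le => //; exact: summable_norm.
Qed.

Lemma eq_Rint f g : f =1 g -> \int[mu]_t f t = \int[mu]_t g t.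
Proof. by move=> fg; apply: eq_Rintegral => t _. Qed.

(** Identities between integrals below have up to eleven terms; a list of
    coefficients and integrands lets them be integrated in one step. *)
Definition all_summable (l : seq (R * (T -> R))) : Prop :=
  foldr (fun cf P => summable cf.2 /\ P) True l.

Lemma Rint_lin (l : seq (R * (T -> R))) : all_summable l ->
  \int[mu]_t (\sum_(cf <- l) cf.1 * cf.2 t) = \sum_(cf <- l) cf.1 * \int[mu]_t cf.2 t.
Proof.
move=> lsum; suff [] : summable (fun t => \sum_(cf <- l) cf.1 * cf.2 t) /\
  \int[mu]_t (\sum_(cf <- l) cf.1 * cf.2 t) = \sum_(cf <- l) cf.1 * \int[mu]_t cf.2 t by [].
elim: l lsum => [_|[c f] l IH /= [fi /IH[li lE]]].
  rewrite big_nil; under eq_Rint do rewrite big_nil.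
  rewrite Rintegral_cst// mul0r; split=> //.
  under eq_fun do rewrite big_nil.
  exact: integrable0.
have -> : (fun t => \sum_(cf <- (c, f) :: l) cf.1 * cf.2 t)
    = fun t => c * f t + \sum_(cf <- l) cf.1 * cf.2 t.
  by apply/funext => t; rewrite big_cons.
rewrite big_cons; split.
  by apply: summableD => //; exact: summableZ.
by rewrite RintD ?RintZ ?lE//; exact: summableZ.
Qed.

Lemma bounded_measM k k' : bounded_meas k -> bounded_meas k' ->
  bounded_meas (fun t => k t * k' t).
Proof.
move=> [mk [M kM]] [mk' [M' kM']]; split; first exact: measurable_funM.
by exists (M * M') => t; rewrite normrM ler_pM.
Qed.

Lemma bounded_measD k k' : bounded_meas k -> bounded_meas k' ->
  bounded_meas (fun t => k t + k' t).
Proof.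
move=> [mk [M kM]] [mk' [M' kM']]; split; first exact: measurable_funD.
by exists (M + M') => t; rewrite (le_trans (ler_normD _ _))// lerD.
Qed.

Lemma sq_summableM f g : sq_summable f -> sq_summable g ->
  summable (fun t => f t * g t).
Proof.
move=> [mf fi] [mg gi].
apply: (@summable_le (fun t => f t ^+ 2 + g t ^+ 2)).
- exact: summableD.
- exact: measurable_funM.
- by move=> t; exact: normM_le_sqrD.
Qed.

Lemma sq_summable_bounded k f : bounded_meas k -> sq_summable f ->
  sq_summable (fun t => k t * f t).
Proof.
move=> kb [mf fi]; split; first by apply: measurable_funM => //; case: kb.
have := summableM_bounded (bounded_measM kb kb) fi.
by congr (summable _); apply/funext => t; rewrite exprMn expr2.
Qed.

Lemma sq_summableD f g : sq_summable f -> sq_summable g ->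
  sq_summable (fun t => f t + g t).
Proof.
move=> fL gL; have := sq_summableM fL gL; case: fL => mf fi; case: gL => mg gi.
move=> fgi; split; first exact: measurable_funD.
have := summableD (summableD fi gi) (summableZ 2 fgi).
by congr (summable _); apply/funext => t; ring.
Qed.

Lemma sq_summableN f : sq_summable f -> sq_summable (fun t => - f t).
Proof.
move=> [mf fi]; split; first exact: measurable_funN.
by under eq_fun do rewrite sqrrN.
Qed.

Lemma sq_summableB f g : sq_summable f -> sq_summable g ->
  sq_summable (fun t => f t - g t).
Proof. by move=> fL gL; apply: sq_summableD => //; exact: sq_summableN. Qed.

Definition sq_cvg (f_ : nat -> T -> R) f : Prop :=
  [/\ forall n, sq_summable (f_ n), sq_summable f &
      (fun n => \int[mu]_t (f_ n t - f t) ^+ 2) @ \oo --> 0].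

Lemma sq_cvg_cst f : sq_summable f -> sq_cvg (fun=> f) f.
Proof.
move=> fL; split => //.
rewrite (_ : (fun=> _) = fun=> (0 : R)); first exact: cvg_cst.
apply/funext => _; rewrite (@eq_Rint _ (fun=> 0)) ?Rintegral_cst ?mul0r//.
by move=> t; rewrite subrr expr0n.
Qed.

Lemma sq_cvgM k (f_ : nat -> T -> R) f : bounded_meas k -> sq_cvg f_ f ->
  sq_cvg (fun n t => k t * f_ n t) (fun t => k t * f t).
Proof.
move=> kb [fL_ fL fc]; split; [by move=> n; exact: sq_summable_bounded| |].
  exact: sq_summable_bounded.
have [mk [M kM]] := kb.
have M0 t : k t ^+ 2 <= M ^+ 2.
  by have := kM t; rewrite ler_norml => /andP[]; nra.
apply: (@squeeze_cvgr _ _ _ _ (fun=> 0)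
    (fun n => M ^+ 2 * \int[mu]_t (f_ n t - f t) ^+ 2)).
- apply: nearW => n; rewrite Rintegral_ge0/=; last by move=> *; exact: sqr_ge0.
  have fnL := sq_summableB (fL_ n) fL.
  rewrite -RintZ; last by case: fnL.
  apply: Rint_le.
  + have [_] := sq_summable_bounded kb fnL.
    by congr (summable _); apply/funext => t /=; rewrite mulrBr.
  + by apply: summableZ; case: fnL.
  + by move=> t; rewrite -mulrBr exprMn ler_wpM2r ?sqr_ge0.
- exact: cvg_cst.
- by rewrite -(mulr0 (M ^+ 2)); apply: cvgMr.
Qed.

Lemma sq_cvgD (f_ g_ : nat -> T -> R) f g : sq_cvg f_ f -> sq_cvg g_ g ->
  sq_cvg (fun n t => f_ n t + g_ n t) (fun t => f t + g t).
Proof.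
move=> [fL_ fL fc] [gL_ gL gc]; split; [by move=> n; exact: sq_summableD| |].
  exact: sq_summableD.
apply: (@squeeze_cvgr _ _ _ _ (fun=> 0)
    (fun n => 2 * \int[mu]_t (f_ n t - f t) ^+ 2
              + 2 * \int[mu]_t (g_ n t - g t) ^+ 2)).
- apply: nearW => n; rewrite Rintegral_ge0/=; last by move=> *; exact: sqr_ge0.
  have [_ fi] := sq_summableB (fL_ n) fL.
  have [_ gi] := sq_summableB (gL_ n) gL.
  have [_ fgi] := sq_summableB (sq_summableD (fL_ n) (gL_ n)) (sq_summableD fL gL).
  rewrite -!RintZ// -RintD; [|exact: summableZ..].
  apply: Rint_le => //; first by apply: summableD; exact: summableZ.
  move=> t; set a := f_ n t; set b := g_ n t.
  by have := sqr_ge0 ((a - f t) - (b - g t)); nra.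
- exact: cvg_cst.
- rewrite -[X in _ --> X](_ : 2 * 0 + 2 * 0 = 0); last by ring.
  by apply: cvgD; apply: cvgMr.
Qed.

Lemma sq_cvgN (f_ : nat -> T -> R) f : sq_cvg f_ f -> sq_cvg (fun n t => - f_ n t) (fun t => - f t).
Proof.
move=> fc.
have : sq_cvg (fun n t => -1 * f_ n t) (fun t => -1 * f t).
  apply: (@sq_cvgM (fun=> -1)) => //.
  by split; [exact: measurable_cst | exists `|-1| => t].
by congr (sq_cvg _ _); [apply/funext => n|]; apply/funext => t; rewrite mulN1r.
Qed.

Lemma sq_cvgB (f_ g_ : nat -> T -> R) f g : sq_cvg f_ f -> sq_cvg g_ g ->
  sq_cvg (fun n t => f_ n t - g_ n t) (fun t => f t - g t).
Proof. by move=> fc gc; apply: sq_cvgD => //; exact: sq_cvgN. Qed.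

(** Young's inequality with the weight [w] adjusted to the tolerance [e] plays the
    role of the Cauchy-Schwarz inequality. *)
Lemma sq_cvg_dual (f_ : nat -> T -> R) g : sq_summable g -> sq_cvg f_ (fun=> 0) ->
  (fun n => \int[mu]_t (f_ n t * g t)) @ \oo --> 0.
Proof.
move=> gL [fL_ _]; under eq_fun => n do under eq_Rintegral do rewrite subr0.
move=> fc; apply/cvgrPdist_le => /= e e0.
set G := \int[mu]_t g t ^+ 2.
have G0 : 0 <= G by apply: Rintegral_ge0 => *; exact: sqr_ge0.
pose w := e / (G + 1).
have w0 : 0 < w by rewrite divr_gt0// ltr_wpDl.
have /cvgrPdist_le/(_ _ (mulr_gt0 w0 e0)) := fc.
apply: filterS => n /=; rewrite !sub0r !normrN => fe.
have {}fe := le_trans (ler_norm _) fe.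
have [_ fi] := fL_ n; have [_ gi] := gL.
apply: (@le_trans _ _ (\int[mu]_t (w / 2 * g t ^+ 2 + (2 * w)^-1 * f_ n t ^+ 2))).
  apply: Rint_norm_le.
  - by apply: summableD; exact: summableZ.
  - by apply: measurable_funM; [case: (fL_ n) | case: gL].
  - move=> t; set a := f_ n t; set b := g t.
    have h : 0 <= (w * b - a) ^+ 2 /\ 0 <= (w * b + a) ^+ 2 by rewrite !sqr_ge0.
    suff : `|a * b| <= (w ^+ 2 * b ^+ 2 + a ^+ 2) / (2 * w).
      move=> /le_trans; apply; rewrite le_eqVlt; apply/orP; left; apply/eqP.
      by field; rewrite gt_eqF.
    have w2 : 0 < 2 * w by rewrite mulr_gt0.
    rewrite ler_norml -mulNr ler_pdivrMr// ler_pdivlMr//.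
    by apply/andP; split; nra.
rewrite RintD; [|exact: summableZ..]; rewrite !RintZ// -/G.
have -> : e = w / 2 * (G + 1) + (2 * w)^-1 * (w * e).
  have -> : w = e / (G + 1) by [].
  by field; rewrite !gt_eqF// ltr_wpDl.
apply: lerD.
  by rewrite ler_wpM2l ?lerDl// divr_ge0// ltW.
by rewrite ler_wpM2l// invr_ge0 mulr_ge0// ltW.
Qed.

Lemma sq_cvg_sub0 (f_ : nat -> T -> R) f : sq_cvg f_ f ->
  sq_cvg (fun n t => f_ n t - f t) (fun=> 0).
Proof.
move=> [fL_ fL fc]; split; [by move=> n; exact: sq_summableB| |].
- split; first exact: measurable_cst.
  have := summableZ 0 fL.2.
  by congr (summable _); apply/funext => t; rewrite mul0r expr0n.
- by apply: cvg_seq_eq fc => n; apply: eq_Rint => t; rewrite subr0.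
Qed.

(** The difference of the two products splits into three terms, each with a
    factor that tends to 0 in mean square. *)
Lemma sq_cvg_int (f_ g_ : nat -> T -> R) f g : sq_cvg f_ f -> sq_cvg g_ g ->
  (fun n => \int[mu]_t (f_ n t * g_ n t)) @ \oo --> \int[mu]_t (f t * g t).
Proof.
move=> fc gc; have [fL_ fL _] := fc; have [gL_ gL _] := gc.
have fc0 := sq_cvg_sub0 fc; have gc0 := sq_cvg_sub0 gc.
have [fB_ _ fc0'] := fc0; have [gB_ _ gc0'] := gc0.
have c1 := sq_cvg_dual gL fc0; have c2 := sq_cvg_dual fL gc0.
have c3 : (fun n => \int[mu]_t ((f_ n t - f t) * (g_ n t - g t))) @ \oo --> 0.
  apply/norm_cvg0P.
  apply: (@squeeze_cvgr _ _ _ _ (fun=> 0)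
      (fun n => \int[mu]_t (f_ n t - f t - 0) ^+ 2
                + \int[mu]_t (g_ n t - g t - 0) ^+ 2)).
  - apply: nearW => n; rewrite normr_ge0/=.
    have [mf fi] := fB_ n; have [mg gi] := gB_ n.
    under [X in _ <= X + _]eq_Rint do rewrite subr0.
    under [X in _ <= _ + X]eq_Rint do rewrite subr0.
    rewrite -RintD//; apply: Rint_norm_le; first exact: summableD.
      exact: measurable_funM.
    by move=> t; exact: normM_le_sqrD.
  - exact: cvg_cst.
  - by have := cvg_seqD fc0' gc0'; rewrite addr0.
have := cvg_seqD (cvg_seqD (cvg_seqD c3 c1) c2)
  (@cvg_seq_cst R (\int[mu]_t (f t * g t))).
rewrite !add0r; apply: cvg_seq_eq => n.
have i1 := sq_summableM (fB_ n) (gB_ n).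
have i2 := sq_summableM (fB_ n) gL; have i3 := sq_summableM (gB_ n) fL.
have i4 := sq_summableM fL gL.
rewrite /= -RintD// -RintD//; last exact: summableD.
rewrite -RintD//; last by apply: summableD => //; exact: summableD.
by apply: eq_Rint => t; ring.
Qed.

Lemma cvg_int_bounded (k_ : nat -> T -> R) k f M : summable f ->
  (forall n, measurable_fun setT (k_ n)) -> measurable_fun setT k ->
  (forall n t, `|k_ n t| <= M) -> (forall t, (fun n => k_ n t) @ \oo --> k t) ->
  (fun n => \int[mu]_t (k_ n t * f t)) @ \oo --> \int[mu]_t (k t * f t).
Proof.
move=> fi mk_ mk kM kc; have mf := summable_meas fi.
have gi : summable (fun t => M * `|f t|) by exact/summableZ/summable_norm.
have := @dominated_convergence _ _ _ mu setT measurableT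
  (fun n => EFin \o (fun t => k_ n t * f t)) (EFin \o (fun t => k t * f t))
  (EFin \o (fun t => M * `|f t|)).
case.
- by move=> n; apply/measurable_EFinP; exact: measurable_funM.
- by apply/measurable_EFinP; exact: measurable_funM.
- apply: aeW => t _; apply/cvg_EFin; first by apply: nearW.
  by apply: cvgMl; exact: kc.
- exact: gi.
- by apply: aeW => t n _; rewrite /= lee_fin normrM ler_wpM2r.
by move=> kfi _; rewrite -(fineK (integrable_fin_num measurableT kfi)) => /fine_cvgP[].
Qed.

End SquareIntegrable.

(** * Integrals over the plane *)

(* [leb2] is a measure on pairs of elements of this copy of [R], the one whose
   measurable sets are generated by the half-open intervals. *)
Notation RM R := (measurableTypeR R).
Definition plane_measure {R : realType} :
  {measure set (RM R * RM R) -> \bar R} := leb2.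
Definition line_measure {R : realType} : {measure set RM R -> \bar R} := leb1.
Notation meas1 f := (@measurable_fun _ _ (RM _) (RM _) setT f).
Notation meas2 f := (@measurable_fun _ _ (RM _ * RM _)%type (RM _) setT f).
Notation int1 f := (Rintegral line_measure setT f).
Notation int2 f := (Rintegral plane_measure setT f).
Notation sum1 f := (summable line_measure f).
Notation sum2 f := (summable plane_measure f).
Notation bounded1 k := (@bounded_meas _ (RM _) _ k).
Notation bounded2 k := (@bounded_meas _ (RM _ * RM _)%type _ k).
Notation sqsum2 f := (sq_summable plane_measure f).
Notation sqcvg2 f_ f := (sq_cvg plane_measure f_ f).

(** Domains of integration enter as factors of this form, so that splitting and
    comparing them is a matter of ring identities and of cases on [b]. *)
Notation ind b := (GRing.natmul 1 (nat_of_bool b%R)).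

Section Plane.
Context {R : realType}.
Implicit Types (f g : R * R -> R) (h k : R -> R).

Lemma meas_indicator d (T : measurableType d) (b : T -> bool) :
  measurable_fun setT b -> measurable_fun setT (fun t => ind (b t) : R).
Proof.
move=> mb; rewrite (_ : (fun t => _) = fun t => if b t then 1 else 0 : R).
  exact: measurable_fun_ifT.
by apply/funext => t; case: (b t).
Qed.

Lemma meas1_continuous h : continuous h -> meas1 h.
Proof. by move=> /continuous_measurable_fun. Qed.

(** Every open rectangle neighbourhood shrinks to a square with rational data, so
    a superlevel set is a countable union of measurable rectangles. *)
Lemma meas2_continuous f : continuous f -> meas2 f.
Proof.
move=> cf; apply: (measurability _ (RGenOInfty.measurableE R)).
move=> _ [_ [a ->] <-]; rewrite setTI.
pose box (q r e : rat) : set (RM R * RM R) :=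
  `](ratr q - ratr e : R), ratr q + ratr e[ `*`
  `](ratr r - ratr e : R), ratr r + ratr e[.
pose F q r e := if `[< box q r e `<=` f @^-1` `]a, +oo[ >] then box q r e else set0.
rewrite (_ : f @^-1` _ = \bigcup_q \bigcup_r \bigcup_e F q r e); last first.
  apply/seteqP; split=> [[x y] axy|p [q _ [r _ [e _]]]]; last first.
    by rewrite /F; case: ifPn => // /asboolP sub /sub.
  have /cf : nbhs (f (x, y)) [set z | a < z].
    by apply: open_nbhs_nbhs; split; [exact: open_gt|move: axy; rewrite /= in_itv/= andbT].
  move=> /nbhs_ballP[d /= d0 dsub].
  have [e] : exists e : rat, ratr e \in `]0, d / 2[.
    by apply: rat_in_itvoo; rewrite divr_gt0.
  rewrite in_itv/= => /andP[e0 ed].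
  have [q] : exists q : rat, ratr q \in `]x - ratr e, x + ratr e[.
    by apply: rat_in_itvoo; rewrite ltrBlDr -addrA ltrDl addr_gt0.
  have [r] : exists r : rat, ratr r \in `]y - ratr e, y + ratr e[.
    by apply: rat_in_itvoo; rewrite ltrBlDr -addrA ltrDl addr_gt0.
  rewrite !in_itv/= => /andP[r1 r2] /andP[q1 q2].
  exists q => //; exists r => //; exists e => //.
  rewrite /F; case: ifPn => [_|/asboolP].
    by split; rewrite /= in_itv/=; apply/andP; split; lra.
  case=> -[x' y'] /= [] /=; rewrite !in_itv/= => /andP[x1 x2] /andP[y1 y2].
  rewrite andbT; apply: dsub; split => /=.
    by rewrite /ball/= ltr_norml; apply/andP; split; lra.
  by rewrite /ball/= ltr_norml; apply/andP; split; lra.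
apply: bigcupT_measurable_rat => q; apply: bigcupT_measurable_rat => r.
apply: bigcupT_measurable_rat => e; rewrite /F; case: ifPn => // _.
by apply: measurableX; exact: measurable_itv.
Qed.

Lemma meas2_fst h : meas1 h -> meas2 (fun p : R * R => h p.1).
Proof. by move=> mh; exact: (measurableT_comp mh (@measurable_fst _ _ (RM R) (RM R))). Qed.

Lemma meas2_snd h : meas1 h -> meas2 (fun p : R * R => h p.2).
Proof. by move=> mh; exact: (measurableT_comp mh (@measurable_snd _ _ (RM R) (RM R))). Qed.

Lemma bounded2_fst h : bounded1 h -> bounded2 (fun p : R * R => h p.1).
Proof. by move=> [mh [M hM]]; split; [exact: meas2_fst|exists M]. Qed.

Lemma bounded2_snd h : bounded1 h -> bounded2 (fun p : R * R => h p.2).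
Proof. by move=> [mh [M hM]]; split; [exact: meas2_snd|exists M]. Qed.

Definition strip_box (A : R) : set (RM R * RM R) := `[-A, A] `*` `[0, 1].

Lemma strip_boxE A (x y : R) :
  strip_box A (x, y) <-> [/\ - A <= x, x <= A, 0 <= y & y <= 1].
Proof.
rewrite /strip_box /= !in_itv/=; split => [[/andP[? ?] /andP[? ?]]//|].
by case=> -> -> -> ->.
Qed.

(** A class of integrands stable under sums and bounded factors, on which Fubini's
    theorem holds without further hypotheses. *)
Definition box_bounded f : Prop :=
  bounded2 f /\ exists A, forall p, f p != 0 -> strip_box A p.

Lemma summable_box_cst A (M : R) :
  sum2 (fun p => M * \1_(strip_box A) p).
Proof.
have mB : measurable (strip_box A) by apply: measurableX; exact: measurable_itv.
apply: summableZ; apply/integrableP; split.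
  by apply/measurable_EFinP; exact: measurable_indic.
rewrite (eq_integral (fun p => (\1_(strip_box A) p)%:E)); last first.
  by move=> p _ /=; rewrite ger0_norm.
rewrite integral_indic// setIT.
rewrite [X in (X < _)%E](product_measure1E leb1 leb1)//; [|exact: measurable_itv..].
rewrite [X in (X * _)%E](lebesgue_measure_itv (`[-A, A]%R : interval R)).
rewrite [X in (_ * X)%E](lebesgue_measure_itv (`[0, 1]%R : interval R)).
by do 2 case: ifP => _; rewrite -?EFinB -?EFinM ?mul0e ?mule0 ltry.
Qed.

Lemma box_bounded_le f : box_bounded f -> exists A M,
  forall p, `|f p| <= M * \1_(strip_box A) p.
Proof.
move=> [[_ [M fM]] [A fA]]; exists A, M => p; rewrite indicE.
have [pA|pA] := boolP (p \in _); first by rewrite mulr1.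
rewrite mulr0; have [->|/fA pA'] := eqVneq (f p) 0; first by rewrite normr0.
by move: pA; rewrite notin_setE.
Qed.

Lemma box_bounded_summable f : box_bounded f -> sum2 f.
Proof.
move=> fb; have [A [M fAM]] := box_bounded_le fb.
apply: (summable_le (summable_box_cst A M)) => //.
by case: fb => -[].
Qed.

Lemma box_boundedM f g : box_bounded f -> bounded2 g ->
  box_bounded (fun p => g p * f p).
Proof.
move=> [fb [A fA]] gb; split; first exact: bounded_measM.
by exists A => p fg; apply: fA; apply: contraNneq fg => ->; rewrite mulr0.
Qed.

Lemma strip_box_le A B p : A <= B -> strip_box A p -> strip_box B p.
Proof.
by case: p => x y AB /strip_boxE[? ? ? ?]; apply/strip_boxE; split=> //; lra.
Qed.

Lemma box_boundedD f g : box_bounded f -> box_bounded g ->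
  box_bounded (fun p => f p + g p).
Proof.
move=> [fb [A fA]] [gb [B gB]]; split; first exact: bounded_measD.
exists (Num.max A B) => p fg.
have [f0|/fA] := eqVneq (f p) 0; last by apply: strip_box_le; rewrite le_max lexx.
have [g0|/gB] := eqVneq (g p) 0; last by apply: strip_box_le; rewrite le_max lexx orbT.
by move: fg; rewrite f0 g0 addr0 eqxx.
Qed.

Lemma bounded_cst (M : R) : bounded2 (fun _ : R * R => M).
Proof. by split; [exact: measurable_cst | exists `|M|]. Qed.

Lemma box_boundedN f : box_bounded f -> box_bounded (fun p => - f p).
Proof.
move=> fb; rewrite (_ : (fun p => _) = fun p => -1 * f p).
  by apply: box_boundedM fb _; exact: bounded_cst.
by apply/funext => p; rewrite mulN1r.
Qed.

Lemma box_boundedB f g : box_bounded f -> box_bounded g ->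
  box_bounded (fun p => f p - g p).
Proof. by move=> fb gb; apply: box_boundedD => //; exact: box_boundedN. Qed.

Lemma box_bounded_sq f : box_bounded f -> sqsum2 f.
Proof.
move=> fb; split; first by case: fb => -[].
have := box_bounded_summable (box_boundedM fb (proj1 fb)).
by under eq_fun do rewrite -expr2.
Qed.

Lemma summable1_le h (A M : R) : meas1 h -> (forall x, `|h x| <= M) ->
  (forall x, h x != 0 -> - A <= x <= A) -> sum1 h.
Proof.
move=> mh hM hA.
apply: (@summable_le _ _ _ _ (fun x => M * \1_(`[-A, A] : set (RM R)) x)) => //.
  by apply: summableZ; exact: integrable_indic_itv.
move=> x; rewrite indicE; have [xA|xA] := boolP (x \in _); first by rewrite mulr1.
rewrite mulr0; have [->|/hA xA'] := eqVneq (h x) 0; first by rewrite normr0.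
by move: xA; rewrite notin_setE/= in_itv/= xA'.
Qed.

Lemma box_bounded_slicex f x : box_bounded f -> sum1 (fun y => f (x, y)).
Proof.
move=> [[mf [M fM]] [A fA]]; apply: (@summable1_le _ 1 M) => //.
  exact: measurable_fun_pair2.
by move=> y /fA/strip_boxE[_ _ y0 y1]; apply/andP; split; lra.
Qed.

Lemma box_bounded_slicey f y : box_bounded f -> sum1 (fun x => f (x, y)).
Proof.
move=> [[mf [M fM]] [A fA]]; apply: (@summable1_le _ A M) => //.
  exact: measurable_fun_pair1.
by move=> x /fA/strip_boxE[x1 x2 _ _]; apply/andP; split; lra.
Qed.

Lemma fubiniyx f : box_bounded f ->
  int2 f = int1 (fun x => int1 (fun y => f (x, y))).
Proof.
move=> fb; have fi := box_bounded_summable fb.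
rewrite /Rintegral; congr fine.
rewrite -[LHS](@integral12_prod_meas1 _ _ _ _ _ leb1 leb1 _ fi).
apply: eq_integral => x _; rewrite /fubini_F /=.
have h := integrable_fin_num measurableT (box_bounded_slicex x fb).
by rewrite -[LHS]/(\int[line_measure]_y (f (x, y))%:E)%E -[LHS](fineK h).
Qed.

Lemma fubinixy f : box_bounded f ->
  int2 f = int1 (fun y => int1 (fun x => f (x, y))).
Proof.
move=> fb; have fi := box_bounded_summable fb.
rewrite /Rintegral; congr fine.
rewrite -[LHS](@integral21_prod_meas1 _ _ _ _ _ leb1 leb1 _ fi).
apply: eq_integral => y _; rewrite /fubini_G /=.
have h := integrable_fin_num measurableT (box_bounded_slicey y fb).
by rewrite -[LHS]/(\int[line_measure]_x (f (x, y))%:E)%E -[LHS](fineK h).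
Qed.

Lemma meas1_fubinixy f : box_bounded f ->
  meas1 (fun y => int1 (fun x => f (x, y))).
Proof.
move=> fb; have fi := box_bounded_summable fb.
have mG := @measurable_fubini_G _ _ _ _ _ leb1 leb1 _ fi.
exact: (measurableT_comp (@fine_measurable R setT measurableT) mG).
Qed.

End Plane.

(** * Calculus on the line *)

Section Line.
Context {R : realType}.
Implicit Types (h dh : R -> R) (a b x y t : R).

Lemma is_derive_cont h x d : is_derive x 1 h d -> {for x, continuous h}.
Proof. by move=> [hd _]; apply/differentiable_continuous/derivable1_diffP. Qed.

Lemma meas_oo (a b : R) : meas1 (fun x : R => ind (a < x < b) : R).
Proof.
apply: (@meas_indicator R _ (RM R)); apply: measurable_and; exact: measurable_fun_ltr.
Qed.

Lemma sum1_oo (g : R -> R) a b : a <= b ->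
  (forall x, a <= x <= b -> {for x, continuous g}) ->
  sum1 (fun x => ind (a < x < b) * g x).
Proof.
move=> ab hc.
have cW : {within `[a, b], continuous g}.
  apply: continuous_in_subspaceT => x; rewrite inE/= in_itv/= => /hc; exact.
have idh : lebesgue_measure.-integrable `[a, b] (EFin \o g).
  by apply: continuous_compact_integrable => //; exact: segment_compact.
have idho : lebesgue_measure.-integrable `]a, b[ (EFin \o g).
  by apply: integrableS idh => //; exact: subset_itv_oo_cc.
have mI : measurable (`]a, b[ : set (RM R)) by exact: measurable_itv.
have := (integrable_mkcond _ mI).1 idho.
apply: eq_integrable => // x _; rewrite patchE mem_setE in_itv/=.
by case: ifP => _; rewrite ?mul1r ?mul0r.
Qed.

(** The interval is an indicator under the integral sign, so that the integrals
    over lines given by Fubini's theorem have this form. *)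
Lemma ftc_oo h dh a b : a <= b ->
  (forall x, a <= x <= b -> is_derive x 1 h (dh x)) ->
  (forall x, a <= x <= b -> {for x, continuous dh}) ->
  int1 (fun x => ind (a < x < b) * dh x) = h b - h a.
Proof.
rewrite le_eqVlt => /predU1P[<- _ _|ab hd hc].
  rewrite (eq_Rint line_measure (g := fun=> 0)) ?Rintegral_cst ?mul0r ?subrr//.
  move=> x; case: ltgtP; rewrite ?mul0r//=.
have cW : {within `[a, b], continuous dh}.
  apply: continuous_in_subspaceT => x; rewrite inE/= in_itv/= => /hc; exact.
have cH : {within `[a, b], continuous h}.
  apply: continuous_in_subspaceT => x.
  by rewrite inE/= in_itv/= => /hd; exact: is_derive_cont.
have := @continuous_FTC2 R dh h a b ab cW.
have H : derivable_oo_LRcontinuous h a b.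
  have [_ ha hb] := (continuous_within_itvP _ ab).1 cH.
  split=> // x; rewrite in_itv/= => /andP[ax xb].
  by have [] := hd x ltac:(by rewrite (ltW ax) (ltW xb)).
move=> /(_ H) F.
have {}F : (\int[lebesgue_measure]_(x in `[a, b]) (dh x)%:E = (h b)%:E - (h a)%:E)%E.
  apply: F => x; rewrite in_itv/= => /andP[ax xb].
  by rewrite derive1E; have [_ ->] := hd x ltac:(by rewrite (ltW ax) (ltW xb)).
have idh : lebesgue_measure.-integrable `[a, b] (EFin \o dh).
  by apply: continuous_compact_integrable => //; exact: segment_compact.
have idho : lebesgue_measure.-integrable `]a, b[ (EFin \o dh).
  by apply: integrableS idh => //; exact: subset_itv_oo_cc.
have idhc : lebesgue_measure.-integrable `[a, b[ (EFin \o dh).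
  by apply: integrableS idh => //; apply: subset_itvl; rewrite bnd_simp.
rewrite -[RHS]/(fine ((h b)%:E - (h a)%:E)%E) -F.
rewrite -[RHS]/(\int[lebesgue_measure]_(x in `[a, b]) dh x).
rewrite -Rintegral_itv_bndo_bndc// -Rintegral_itv_obnd_cbnd//.
rewrite [RHS]Rintegral_mkcond; apply: eq_Rint => x.
rewrite patchE mem_setE in_itv/=; case: ifP => _; by rewrite ?mul1r ?mul0r.
Qed.

(** The function [cos (l * pi * (y - 1/2))] solves the Euler equation and, as
    [l < 1], has no zero on the closed unit interval. Completing the square with
    its logarithmic derivative [- l * pi * q] leaves the derivative of a function
    [F] that vanishes at both ends. *)
Lemma wirtinger_lt (l : R) h dh : 0 < l < 1 ->
  (forall x, is_derive x 1 h (dh x)) -> continuous dh -> h 0 = 0 -> h 1 = 0 ->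
  (l * pi) ^+ 2 * int1 (fun y => ind (0 < y < 1) * h y ^+ 2)
    <= int1 (fun y => ind (0 < y < 1) * dh y ^+ 2).
Proof.
move=> /andP[l0 l1] hd cdh h0 h1.
have ch : continuous h by move=> x; exact: is_derive_cont (hd x).
have cpos y : 0 <= y <= 1 -> 0 < cos (l * pi * (y - 2^-1)).
  move=> /andP[y0 y1]; apply: cos_gt0_pihalf.
  have p0 := pi_gt0 R.
  have lp : l * pi < pi by rewrite gtr_pMl.
  have lp0 : 0 < l * pi by rewrite mulr_gt0.
  apply/andP; split; nra.
pose q y := tan (l * pi * (y - 2^-1)).
pose F y := - (l * pi) * (q y * h y ^+ 2).
pose dF y := - (l * pi) * ((1 + q y ^+ 2) * (l * pi) * h y ^+ 2 + q y * (2 * h y * dh y)).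
have qd y : 0 <= y <= 1 -> is_derive y 1 q ((1 + q y ^+ 2) * (l * pi)).
  move=> /cpos c0.
  have E : is_derive y 1 (fun y => l * pi * (y - 2^-1)) (l * pi).
    by apply: is_derive_eq; rewrite /GRing.scale/=; ring.
  have := @is_derive1_comp R tan (fun y => l * pi * (y - 2^-1)) y _ _
    (is_derive_tan (lt0r_neq0 c0)) E.
  congr is_derive; congr (_ * _).
  rewrite /q /tan; set c := cos _; set s := sin _.
  have -> : 1 + (s / c) ^+ 2 = (c ^+ 2 + s ^+ 2) / c ^+ 2.
    by field; rewrite lt0r_neq0.
  by rewrite cos2Dsin2 mul1r.
have Fd y : 0 <= y <= 1 -> is_derive y 1 F (dF y).
  move=> /qd qy; have hy := hd y.
  by apply: is_derive_eq; rewrite /dF /GRing.scale/=; ring.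
have cq y : 0 <= y <= 1 -> {for y, continuous q}.
  by move=> /qd; exact: is_derive_cont.
have dFc y : 0 <= y <= 1 -> {for y, continuous dF}.
  move=> /cq cqy; have chy := ch y; have cdhy := cdh y.
  apply: cvgM; first exact: cvg_cst.
  apply: cvgD.
    apply: cvgM; last by apply: cvgM.
    apply: cvgM; last exact: cvg_cst.
    by apply: cvgD; [exact: cvg_cst|apply: cvgM].
  by apply: cvgM => //; apply: cvgM => //; apply: cvgM => //; exact: cvg_cst.
have F0 := ftc_oo ler01 Fd dFc.
have : int1 (fun y => ind (0 < y < 1) * dF y) = 0.
  by rewrite F0 /F h0 h1 expr0n/= !mulr0 subrr.
move=> {}F0.
have hi : sum1 (fun y => ind (0 < y < 1) * h y ^+ 2).
  by apply: sum1_oo => // y _; apply: cvgM; exact: ch.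
have dhi : sum1 (fun y => ind (0 < y < 1) * dh y ^+ 2).
  by apply: sum1_oo => // y _; apply: cvgM; exact: cdh.
have dFi := sum1_oo ler01 dFc.
have -> : (l * pi) ^+ 2 * int1 (fun y => ind (0 < y < 1) * h y ^+ 2) =
    int1 (fun y => ind (0 < y < 1) * dF y + (l * pi) ^+ 2 * (ind (0 < y < 1) * h y ^+ 2)).
  by rewrite RintD// ?RintZ ?F0 ?add0r//; exact: summableZ.
apply: Rint_le => //; first by apply: summableD => //; exact: summableZ.
move=> y; have [y01|] := boolP (0 < y < 1); last by rewrite !mul0r mulr0 addr0.
rewrite /dF !mul1r.
have := sqr_ge0 (dh y + l * pi * q y * h y).
nra.
Qed.

(** The limit [l = 1] of [wirtinger_lt]. *)
Lemma wirtinger h dh :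
  (forall x, is_derive x 1 h (dh x)) -> continuous dh -> h 0 = 0 -> h 1 = 0 ->
  0 <= int1 (fun y => ind (0 < y < 1) * (dh y ^+ 2 - pi ^+ 2 * h y ^+ 2)).
Proof.
move=> hd cdh h0 h1.
have ch : continuous h by move=> x; exact: is_derive_cont (hd x).
have hi : sum1 (fun y => ind (0 < y < 1) * h y ^+ 2).
  by apply: sum1_oo => // y _; apply: cvgM; exact: ch.
have dhi : sum1 (fun y => ind (0 < y < 1) * dh y ^+ 2).
  by apply: sum1_oo => // y _; apply: cvgM; exact: cdh.
rewrite (eq_Rint line_measure (g := fun y => ind (0 < y < 1) * dh y ^+ 2
    - pi ^+ 2 * (ind (0 < y < 1) * h y ^+ 2))); last by move=> y; ring.
rewrite RintB ?RintZ//; last exact: summableZ.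
set A := int1 _; set B := int1 _.
rewrite subr_ge0; apply/ler_addgt0Pr => e e0.
have B0 : 0 <= B by apply: Rintegral_ge0 => y _; rewrite mulr_ge0 ?sqr_ge0// ler0n.
have p0 := pi_gt0 R.
(* With this [l] the loss [(1 - l ^+ 2) * pi ^+ 2 * B] is at most [e]. *)
pose K := 2 * pi ^+ 2 * B.
have K0 : 0 <= K by rewrite mulr_ge0// mulr_ge0// sqr_ge0.
pose l := 1 - e / (2 * (e + K)).
have eK : 0 < 2 * (e + K) by rewrite mulr_gt0// ltr_pwDl.
have l01 : 0 < l < 1.
  rewrite /l subr_gt0 ltr_pdivrMr// ltrBlDr ltrDl divr_gt0// andbT; lra.
have := wirtinger_lt l01 hd cdh h0 h1; rewrite -/A -/B => AB.
apply: (@le_trans _ _ ((l * pi) ^+ 2 * B + e)); last by rewrite lerD2r.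
have lE : (1 - l) * (2 * (e + K)) = e by rewrite /l; field; rewrite lt0r_neq0//; lra.
have -> : pi ^+ 2 * B = (l * pi) ^+ 2 * B + (1 - l) * (1 + l) * (pi ^+ 2 * B) by ring.
rewrite lerD2l.
have : pi ^+ 2 * B = K / 2 by rewrite /K; field.
move: l01 => /andP[l0 l1] ->.
have m0 : 0 <= 1 - l by lra.
have mK : 0 <= (1 - l) * K by rewrite mulr_ge0.
have me : 0 <= (1 - l) * e by rewrite mulr_ge0// ltW.
have : 0 <= (1 - l) * ((1 - l) * K) by rewrite mulr_ge0.
nra.
Qed.

(** The squared positive part satisfies this bound at every point, its kink
    included, which avoids a case distinction. *)
Lemma is_derive_quad h x d (C : R) :
  (forall t, `|h (x + t) - h x - d * t| <= C * t ^+ 2) -> is_derive x 1 h d.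
Proof.
move=> hC.
have lim : (fun t => t^-1 *: (h (t *: 1 + x) - h x)) @ 0^' --> d.
  apply/cvgrPdist_le => /= e e0.
  have C0 : 0 <= C.
    by have := le_trans (normr_ge0 _) (hC 1); rewrite expr1n mulr1.
  near=> t.
  have t0 : t != 0 by near: t; exact: nbhs_dnbhs_neq.
  rewrite /GRing.scale/= mulr1 (addrC t).
  have -> : d - t^-1 * (h (x + t) - h x) = - (t^-1 * (h (x + t) - h x - d * t)).
    by field.
  rewrite normrN normrM normfV mulrC ler_pdivrMr ?normr_gt0//.
  apply: (le_trans (hC t)).
  have -> : t ^+ 2 = `|t| * `|t| by rewrite -normrM ger0_norm ?expr2// sqr_ge0.
  rewrite mulrA ler_wpM2r//.
  apply: (@le_trans _ _ (C * (e / (C + 1)))).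
    rewrite ler_wpM2l//; near: t; apply: dnbhs0_le.
    by rewrite divr_gt0// ltr_wpDl.
  rewrite mulrA ler_pdivrMr ?ltr_wpDl//; nra.
by apply: DeriveDef; [apply/cvg_ex; exists d | exact/cvg_lim].
Unshelve. all: by end_near. Qed.

(** The derivative is an explicit function, so that the closure lemmas below
    compute it. *)
Definition C1_line h dh : Prop :=
  (forall x, is_derive x 1 h (dh x)) /\ continuous dh.

Lemma C1_line_cont h dh : C1_line h dh -> continuous h.
Proof. by move=> [hd _] x; exact: is_derive_cont (hd x). Qed.

Lemma C1_line_comp (g dg h dh : R -> R) : C1_line g dg -> C1_line h dh ->
  C1_line (fun x => g (h x)) (fun x => dg (h x) * dh x).
Proof.
move=> gC hC; have ch := C1_line_cont hC; case: gC hC => gd cdg [hd cdh]; split.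
  by move=> x; exact: (@is_derive1_comp R g h).
move=> x; apply: cvgM; last exact: cdh.
exact: (continuous_comp (ch x) (cdg (h x))).
Qed.

Lemma C1_lineD (g dg h dh : R -> R) : C1_line g dg -> C1_line h dh ->
  C1_line (fun x => g x + h x) (fun x => dg x + dh x).
Proof.
move=> [gd cdg] [hd cdh]; split => x; first exact: is_deriveD.
by apply: cvgD; [exact: cdg|exact: cdh].
Qed.

Lemma C1_lineM (g dg h dh : R -> R) : C1_line g dg -> C1_line h dh ->
  C1_line (fun x => g x * h x) (fun x => dg x * h x + g x * dh x).
Proof.
move=> gC hC; have cg := C1_line_cont gC; have ch := C1_line_cont hC.
case: gC hC => gd cdg [hd cdh]; split => x.
  have gx := gd x; have hx := hd x.
  by apply: is_derive_eq; rewrite /GRing.scale/=; ring.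
apply: cvgD; apply: cvgM; [exact: cdg|exact: ch|exact: cg|exact: cdh].
Qed.

Lemma C1_line_affine a b : C1_line (fun x => a * x + b) (fun=> a).
Proof.
split => x; last exact: cvg_cst.
by apply: is_derive_eq; rewrite /GRing.scale/=; ring.
Qed.

Lemma C1_line_eq (g dg h dh : R -> R) : C1_line g dg -> g =1 h -> dg =1 dh ->
  C1_line h dh.
Proof. by move=> gC /funext <- /funext <-. Qed.

Definition pos t : R := Num.max t 0.
Definition sqpos t : R := pos t ^+ 2.

Lemma posP t : (t <= 0 /\ pos t = 0) \/ (0 <= t /\ pos t = t).
Proof.
by rewrite /pos maxEle; case: leP => t0; [left|right]; split=> //; exact: ltW.
Qed.

Lemma pos0 t : t <= 0 -> pos t = 0.
Proof. by move=> t0; rewrite /pos max_r. Qed.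

Lemma posE t : 0 <= t -> pos t = t.
Proof. by move=> t0; rewrite /pos max_l. Qed.

Lemma pos_ge0 t : 0 <= pos t. Proof. by rewrite le_max lexx orbT. Qed.

Lemma cont_pos : continuous pos.
Proof.
move=> t; apply: (@continuous_max R R id (cst 0)); first exact: cvg_id.
exact: cvg_cst.
Qed.

Lemma C1_sqpos : C1_line sqpos (fun t => 2 * pos t).
Proof.
split=> x; last by apply: cvgM; [exact: cvg_cst|exact: cont_pos].
apply: (@is_derive_quad _ _ _ 1) => t; rewrite /sqpos ler_norml.
have [[? ->]|[? ->]] := posP x; have [[? ->]|[? ->]] := posP (x + t);
  apply/andP; split; nra.
Qed.

(** A continuously differentiable minorant of [pos] with slopes between 0 and 1,
    at distance at most [d / 2]. *)
Definition ramp (d : R) t : R := (sqpos t - sqpos (t - d)) / (2 * d).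
Definition dramp (d : R) t : R := (pos t - pos (t - d)) / d.

Lemma C1_ramp (d : R) : 0 < d -> C1_line (ramp d) (dramp d).
Proof.
move=> d0.
have s1 := C1_sqpos.
have s2 := C1_line_comp C1_sqpos (C1_line_affine 1 (- d)).
have s3 := C1_lineD s1 (C1_lineM (C1_line_affine 0 (-1)) s2).
have := C1_lineM (C1_line_affine 0 (2 * d)^-1) s3.
move=> H; apply: (C1_line_eq H) => t; rewrite /ramp /dramp /=.
  by rewrite mul1r; ring.
rewrite mul1r; field; exact: lt0r_neq0.
Qed.

Lemma ramp_bounds (d t : R) : 0 < d ->
  [/\ 0 <= ramp d t, ramp d t <= pos t & t - d / 2 <= ramp d t].
Proof.
move=> d0; have d2 : 0 < 2 * d by rewrite mulr_gt0.
rewrite /ramp /sqpos; split; rewrite ?ler_pdivlMr ?ler_pdivrMr ?mul0r//;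
have [[? ->]|[? ->]] := posP t; have [[? ->]|[? ->]] := posP (t - d); nra.
Qed.

Lemma dramp_bounds (d t : R) : 0 < d -> 0 <= dramp d t <= 1.
Proof.
move=> d0; rewrite /dramp ler_pdivlMr// ler_pdivrMr//.
have [[? ->]|[? ->]] := posP t; have [[? ->]|[? ->]] := posP (t - d);
 apply/andP; split; nra.
Qed.

Lemma ramp0 (d t : R) : 0 < d -> t <= 0 -> ramp d t = 0.
Proof.
move=> d0 t0; rewrite /ramp /sqpos !pos0 ?subrr ?mul0r//.
by rewrite subr_le0 (le_trans t0) ?ltW.
Qed.

Lemma dramp0 (d t : R) : 0 < d -> t <= 0 -> dramp d t = 0.
Proof.
move=> d0 t0; rewrite /dramp !pos0 ?subrr ?mul0r//.
by rewrite subr_le0 (le_trans t0) ?ltW.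
Qed.

Lemma dramp1 (d t : R) : 0 < d -> d <= t -> dramp d t = 1.
Proof.
move=> d0 t0; rewrite /dramp !posE ?subr_ge0// ?(le_trans _ t0) ?ltW//.
by field; exact: lt0r_neq0.
Qed.

(** A cutoff decreasing from 1 to 0 over the interval from [r] to [r + w]. *)
Definition cutoff (r w : R) x : R := sqpos (1 - sqpos ((x - r) / w)).
Definition dcutoff (r w : R) x : R :=
  - (4 * pos (1 - sqpos ((x - r) / w)) * pos ((x - r) / w) / w).

Lemma C1_cutoff (r w : R) : C1_line (cutoff r w) (dcutoff r w).
Proof.
have s2 := C1_line_comp C1_sqpos (C1_line_affine w^-1 (- r * w^-1)).
have s3 := C1_lineD (C1_line_affine 0 1) (C1_lineM (C1_line_affine 0 (-1)) s2).
have := C1_line_comp C1_sqpos s3.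
have E x : w^-1 * x + - r * w^-1 = (x - r) / w by ring.
have E' x : 0 * x + 1 + (0 * x + -1) * sqpos ((x - r) / w)
  = 1 - sqpos ((x - r) / w) by ring.
by move=> H; apply: (C1_line_eq H) => x; rewrite /cutoff /dcutoff E E' //; ring.
Qed.

Lemma cutoff_near (r w x : R) : 0 < w -> x <= r ->
  cutoff r w x = 1 /\ dcutoff r w x = 0.
Proof.
move=> w0 xr; have xr0 : (x - r) / w <= 0 by rewrite ler_pdivrMr// mul0r subr_le0.
have p0 : pos ((x - r) / w) = 0.
  by have [[_ //]|[h ->]] := posP ((x - r) / w); apply/eqP; rewrite eq_le xr0.
rewrite /cutoff /dcutoff p0 !mulr0 mul0r oppr0; split=> //.
rewrite /sqpos p0 expr0n/= subr0.
by have [[h ->]|[h ->]] := posP 1; rewrite ?expr1n//; lra.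
Qed.

Lemma cutoff_far (r w x : R) : 0 < w -> r + w <= x ->
  cutoff r w x = 0 /\ dcutoff r w x = 0.
Proof.
move=> w0 xr; have xr1 : 1 <= (x - r) / w by rewrite ler_pdivlMr// mul1r; lra.
suff p0 : pos (1 - sqpos ((x - r) / w)) = 0.
  rewrite /cutoff /dcutoff [sqpos (1 - _)]/sqpos p0.
  by rewrite expr0n/= mulr0 !mul0r oppr0.
rewrite /sqpos; have [[h ->]|[h ->]] := posP ((x - r) / w); first lra.
by have [[_ //]|[h' ->]] := posP (1 - ((x - r) / w) ^+ 2); nra.
Qed.

Lemma cutoff_bounds (r w x : R) : 0 < w -> 0 <= cutoff r w x <= 1.
Proof.
move=> w0; rewrite /cutoff; set v := (x - r) / w.
have : 0 <= sqpos v by exact: sqr_ge0.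
rewrite [sqpos (1 - _)]/sqpos; move: (sqpos v) => u u0.
by have [[h ->]|[h ->]] := posP (1 - u); apply/andP; split; nra.
Qed.

Lemma dcutoff_bounds (r w x : R) : 0 < w -> `|dcutoff r w x| <= 4 / w.
Proof.
move=> w0; rewrite /dcutoff normrN normrM (gtr0_norm (x := w^-1)) ?invr_gt0//.
rewrite ler_pM2r ?invr_gt0// ler_norml /sqpos.
have := pos_ge0 ((x - r) / w); set u := pos _ => u0.
by have [[h ->]|[h ->]] := posP (1 - u ^+ 2); apply/andP; split; nra.
Qed.

End Line.

(** * Test functions of two variables *)

Section PlaneCalculus.
Context {R : realType}.
Implicit Types (f fx fy g gx gy : R * R -> R) (h dh : R -> R) (O : set (R * R)).

(** For compactly supported [f] the continuity of [f] itself follows from that of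
    the partial derivatives; see [C1c_test]. *)
Definition C1_plane f fx fy : Prop :=
  [/\ forall x y : R, is_derive x 1 (fun t : R => f (t, y)) (fx (x, y)),
      forall x y : R, is_derive y 1 (fun t : R => f (x, t)) (fy (x, y)),
      continuous f, continuous fx & continuous fy].

Lemma C1_plane_eq f fx fy g gx gy : C1_plane f fx fy ->
  f =1 g -> fx =1 gx -> fy =1 gy -> C1_plane g gx gy.
Proof. by move=> ft /funext <- /funext <- /funext <-. Qed.

Lemma C1_plane_fst h dh : C1_line h dh ->
  C1_plane (fun p => h p.1) (fun p => dh p.1) (fun=> 0).
Proof.
move=> hC; have ch := C1_line_cont hC; case: hC => hd cdh; split => /=.
- by move=> x y; exact: hd.
- by move=> x y; exact: is_derive_cst.
- by move=> p; apply: continuous_comp; [exact: cvg_fst|exact: ch].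
- by move=> p; apply: continuous_comp; [exact: cvg_fst|exact: cdh].
- by move=> p; exact: cvg_cst.
Qed.

Lemma C1_plane_snd h dh : C1_line h dh ->
  C1_plane (fun p => h p.2) (fun=> 0) (fun p => dh p.2).
Proof.
move=> hC; have ch := C1_line_cont hC; case: hC => hd cdh; split => /=.
- by move=> x y; exact: is_derive_cst.
- by move=> x y; exact: hd.
- by move=> p; apply: continuous_comp; [exact: cvg_snd|exact: ch].
- by move=> p; exact: cvg_cst.
- by move=> p; apply: continuous_comp; [exact: cvg_snd|exact: cdh].
Qed.

Lemma C1_planeM f fx fy g gx gy : C1_plane f fx fy -> C1_plane g gx gy ->
  C1_plane (fun p => f p * g p) (fun p => fx p * g p + f p * gx p)
    (fun p => fy p * g p + f p * gy p).
Proof.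
move=> [fxd fyd cf cfx cfy] [gxd gyd cg cgx cgy]; split.
- move=> x y; have h1 := fxd x y; have h2 := gxd x y.
  by apply: is_derive_eq; rewrite /GRing.scale/=; ring.
- move=> x y; have h1 := fyd x y; have h2 := gyd x y.
  by apply: is_derive_eq; rewrite /GRing.scale/=; ring.
- by move=> p; apply: cvgM; [exact: cf|exact: cg].
- by move=> p; apply: cvgD; apply: cvgM; [exact: cfx|exact: cg|exact: cf|exact: cgx].
- by move=> p; apply: cvgD; apply: cvgM; [exact: cfy|exact: cg|exact: cf|exact: cgy].
Qed.

Lemma C1_planeD f fx fy g gx gy : C1_plane f fx fy -> C1_plane g gx gy ->
  C1_plane (fun p => f p + g p) (fun p => fx p + gx p) (fun p => fy p + gy p).
Proof.
move=> [fxd fyd cf cfx cfy] [gxd gyd cg cgx cgy]; split.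
- by move=> x y; exact: is_deriveD.
- by move=> x y; exact: is_deriveD.
- by move=> p; apply: cvgD; [exact: cf|exact: cg].
- by move=> p; apply: cvgD; [exact: cfx|exact: cgx].
- by move=> p; apply: cvgD; [exact: cfy|exact: cgy].
Qed.

Lemma C1_planeN f fx fy : C1_plane f fx fy ->
  C1_plane (fun p => - f p) (fun p => - fx p) (fun p => - fy p).
Proof.
move=> [fxd fyd cf cfx cfy]; split.
- by move=> x y; exact: is_deriveN.
- by move=> x y; exact: is_deriveN.
- by move=> p; apply: cvgN; exact: cf.
- by move=> p; apply: cvgN; exact: cfx.
- by move=> p; apply: cvgN; exact: cfy.
Qed.

Lemma C1_plane_comp h dh f fx fy : C1_line h dh -> C1_plane f fx fy ->
  C1_plane (fun p => h (f p)) (fun p => dh (f p) * fx p)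
    (fun p => dh (f p) * fy p).
Proof.
move=> hC [fxd fyd cf cfx cfy]; have ch := C1_line_cont hC; case: hC => hd cdh; split.
- by move=> x y; exact: (@is_derive1_comp R h (fun t => f (t, y))).
- by move=> x y; exact: (@is_derive1_comp R h (fun t => f (x, t))).
- by move=> p; exact: (continuous_comp (cf p) (ch (f p))).
- move=> p; apply: cvgM; last exact: cfx.
  exact: (continuous_comp (cf p) (cdh (f p))).
- move=> p; apply: cvgM; last exact: cfy.
  exact: (continuous_comp (cf p) (cdh (f p))).
Qed.

(** The elements of [C1c O], with explicit partial derivatives in place of the
    total functions [dx f] and [dy f]. *)
Definition test O f fx fy : Prop :=
  [/\ C1_plane f fx fy, compact (fsupport f) & fsupport f `<=` O].

Lemma test_eq O f fx fy g gx gy : test O f fx fy ->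
  f =1 g -> fx =1 gx -> fy =1 gy -> test O g gx gy.
Proof. by move=> ft /funext <- /funext <- /funext <-. Qed.

Lemma fsupport_closed f : closed (fsupport f).
Proof. exact: closed_closure. Qed.

Lemma fsupport0 f p : ~ fsupport f p -> f p = 0.
Proof.
by move=> pf; apply/eqP; apply: contra_notT pf => fp; apply: subset_closure.
Qed.

Lemma nbhs_slicex (A : set (R * R)) (x y : R) :
  nbhs (x, y) A -> \forall t \near x, A (t, y).
Proof.
move=> [[B C] /= [Bx Cy] BC]; apply: filterS Bx => t Bt.
by apply: BC; split => //=; exact: nbhs_singleton.
Qed.

Lemma nbhs_slicey (A : set (R * R)) (x y : R) :
  nbhs (x, y) A -> \forall t \near y, A (x, t).
Proof.
move=> [[B C] /= [Bx Cy] BC]; apply: filterS Cy => t Ct.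
by apply: BC; split => //=; exact: nbhs_singleton.
Qed.

(** Off its closed support a function vanishes locally. *)
Lemma partial_fsupport0 f fx fy p :
  (forall x y : R, is_derive x 1 (fun t : R => f (t, y)) (fx (x, y))) ->
  (forall x y : R, is_derive y 1 (fun t : R => f (x, t)) (fy (x, y))) ->
  ~ fsupport f p -> fx p = 0 /\ fy p = 0.
Proof.
case: p => x y fxd fyd pf.
have nb : nbhs (x, y) [set p | f p = 0].
  have : nbhs (x, y) (~` fsupport f).
    by apply: open_nbhs_nbhs; split=> //; exact/closed_openC/fsupport_closed.
  by apply: filterS => q; exact: fsupport0.
have uniq (h : R -> R) (t d : R) : is_derive t 1 h d ->
    (\forall s \near t, h s = 0) -> d = 0.
  move=> hd h0; have [_ <-] := hd.
  have : is_derive t 1 h 0.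
    apply: (near_eq_is_derive _ (f := cst 0)) => //.
    by apply: filterS h0 => s ->.
  by case.
split.
- by apply: (uniq _ _ _ (fxd x y)); exact: nbhs_slicex nb.
- by apply: (uniq _ _ _ (fyd x y)); exact: nbhs_slicey nb.
Qed.

Lemma cont_bounded_on f (K : set (R * R)) : continuous f -> compact K ->
  exists M, forall p, K p -> `|f p| <= M.
Proof.
move=> cf cK; have : compact (f @` K).
  by apply: continuous_compact => //; exact: continuous_subspaceT.
move=> /compact_bounded [M [_ hM]]; exists (M + 1) => p Kp.
by apply: (hM (M + 1)); [rewrite ltrDl|exists p].
Qed.

Lemma cont_supp_bounded f (K : set (R * R)) : continuous f -> compact K ->
  (forall p, ~ K p -> f p = 0) -> exists2 M, 0 <= M & forall p, `|f p| <= M.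
Proof.
move=> cf cK f0; have [M fM] := cont_bounded_on cf cK.
exists `|M| => // p; have [/fM/le_trans|/f0 ->] := pselect (K p).
  by apply; exact: ler_norm.
by rewrite normr0.
Qed.

Lemma compact_fst_bounded (K : set (R * R)) : compact K ->
  exists A, forall p, K p -> - A <= p.1 <= A.
Proof.
move=> cK; have cfst : continuous (fun p : R * R => p.1) by move=> p; exact: cvg_fst.
have [A hA] := cont_bounded_on cfst cK; exists A => p /hA.
by rewrite ler_norml.
Qed.

(** A bounded partial derivative makes the function Lipschitz in one variable
    uniformly in the other, so separate continuity is joint continuity. *)
Lemma C1c_test O f : C1c O f -> test O f (dx f) (dy f).
Proof.
move=> [fd cfx cfy cK KO]; split => //.
have fxd (x y : R) : is_derive x 1 (fun t : R => f (t, y)) (dx f (x, y)).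
  by apply: DeriveDef; [exact: (fd (x, y)).1|rewrite /dx derive1E].
have fyd (x y : R) : is_derive y 1 (fun t : R => f (x, t)) (dy f (x, y)).
  by apply: DeriveDef; [exact: (fd (x, y)).2|rewrite /dy derive1E].
have fx0 p : ~ fsupport f p -> dx f p = 0.
  by move=> /(partial_fsupport0 fxd fyd)[].
have [M M0 fxM] := cont_supp_bounded cfx cK fx0.
split=> //; move=> [x y].
apply/cvgrPdist_le => /= e e0.
have cy : {for y, continuous (fun t => f (x, t))} := is_derive_cont (fyd x y).
have e2 : 0 < e / 2 by rewrite divr_gt0.
have eM : 0 < e / 2 / (M + 1) by rewrite divr_gt0// ltr_wpDl.
have nx : \forall t \near x, `|x - t| <= e / 2 / (M + 1).
  by apply/nbhs_ballP; exists (e / 2 / (M + 1)) => //= t; rewrite /ball/= => /ltW.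
have ny : \forall t \near y, `|f (x, y) - f (x, t)| <= e / 2.
  by move/cvgrPdist_le : cy => /(_ _ e2).
exists ([set t | `|x - t| <= e / 2 / (M + 1)],
        [set t | `|f (x, y) - f (x, t)| <= e / 2]) => //=.
move=> [x' y'] /= [x'x y'y].
have lipx : `|f (x, y') - f (x', y')| <= M * `|x - x'|.
  have cW a b : {within `[a, b], continuous (fun t => f (t, y'))}.
    apply: continuous_subspaceT => t; exact: is_derive_cont (fxd t y').
  have MV a b : a < b -> `|f (a, y') - f (b, y')| <= M * `|a - b|.
    move=> ab.
    have [c _ E] := MVT ab (fun t _ => fxd t y') (cW a b).
    by rewrite distrC E normrM (distrC a b) ler_wpM2r.
  have [/MV//|/MV|->] := ltgtP x x'; last by rewrite !subrr normr0 mulr0.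
  by rewrite distrC (distrC x' x).
have -> : f (x, y) - f (x', y')
  = (f (x, y) - f (x, y')) + (f (x, y') - f (x', y')) by ring.
apply: (le_trans (ler_normD _ _)); rewrite [leRHS](splitr e) lerD//.
apply: (le_trans lipx); apply: (le_trans (ler_wpM2l M0 x'x)).
rewrite mulrA ler_pdivrMr ?ltr_wpDl//; nra.
Qed.

Lemma test_C1c O f fx fy : test O f fx fy ->
  [/\ C1c O f, dx f = fx & dy f = fy].
Proof.
move=> [[fxd fyd cf cfx cfy] cK KO].
have dxE : dx f = fx.
  by apply/funext => -[x y]; rewrite /dx derive1E; have [_ <-] := fxd x y.
have dyE : dy f = fy.
  by apply/funext => -[x y]; rewrite /dy derive1E; have [_ <-] := fyd x y.
split=> //; rewrite /C1c dxE dyE; split=> //.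
Qed.

Lemma test_intro O f fx fy (K : set (R * R)) : C1_plane f fx fy ->
  compact K -> K `<=` O -> (forall p, f p != 0 -> K p) -> test O f fx fy.
Proof.
move=> fC cK KO f0.
have sK : fsupport f `<=` K.
  rewrite /fsupport; apply: (@subset_trans _ (closure K)).
    by apply: closureS => p; exact: f0.
  have : closed K by apply: compact_closed cK; exact: norm_hausdorff.
  by rewrite closureE => cK'; apply: smallest_sub.
split=> //; last exact: subset_trans sK KO.
exact: subclosed_compact (@fsupport_closed f) cK sK.
Qed.

Lemma testM O f fx fy g gx gy : test O f fx fy -> C1_plane g gx gy ->
  test O (fun p => g p * f p) (fun p => gx p * f p + g p * fx p)
    (fun p => gy p * f p + g p * fy p).
Proof.
move=> [fC cK KO] gC; apply: (test_intro (K := fsupport f)) => //.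
  exact: C1_planeM.
move=> p; apply: contra_neqP => /fsupport0 ->; exact: mulr0.
Qed.

Lemma testB O f fx fy g gx gy : test O f fx fy -> test O g gx gy ->
  test O (fun p => f p - g p) (fun p => fx p - gx p) (fun p => fy p - gy p).
Proof.
move=> [fC cK KO] [gC cL LO].
apply: (test_intro (K := fsupport f `|` fsupport g)).
- by apply: C1_planeD => //; exact: C1_planeN.
- exact: compactU.
- by move=> p [/KO|/LO].
move=> p; apply: contra_neqP => /not_orP[/fsupport0 -> /fsupport0 ->].
exact: subr0.
Qed.

Lemma test_supp O f fx fy p : test O f fx fy -> ~ fsupport f p ->
  [/\ f p = 0, fx p = 0 & fy p = 0].
Proof.
move=> [[fxd fyd _ _ _] _ _] pf; have [-> ->] := partial_fsupport0 fxd fyd pf.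
by rewrite (fsupport0 pf).
Qed.

Lemma test_out O f fx fy p : test O f fx fy -> ~ O p ->
  [/\ f p = 0, fx p = 0 & fy p = 0].
Proof.
move=> ft pO; apply: (test_supp ft) => pf; apply: pO.
by case: ft => _ _; apply.
Qed.

Lemma box_bounded_supp O f fx fy g : O `<=` [set p | 0 < p.2 < 1] ->
  test O f fx fy -> continuous g -> (forall p, ~ fsupport f p -> g p = 0) ->
  box_bounded g.
Proof.
move=> Ostrip [fC cK KO] cg g0.
have [M M0 gM] := cont_supp_bounded cg cK g0.
have [A hA] := compact_fst_bounded cK.
split; first by split; [exact: meas2_continuous|exists M].
exists A => -[x y]; apply: contra_neqP => xA.
apply: g0 => xy; apply: xA; apply/strip_boxE.
have /Ostrip/= /andP[y0 y1] := KO _ xy; have /andP[/= ? ?] := hA _ xy.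
by split => //; exact: ltW.
Qed.

Lemma test_box O f fx fy : O `<=` [set p | 0 < p.2 < 1] -> test O f fx fy ->
  [/\ box_bounded f, box_bounded fx & box_bounded fy].
Proof.
move=> Os ft; have [[_ _ cf cfx cfy] _ _] := ft.
by split; apply: (box_bounded_supp Os ft) => // p /(test_supp ft)[].
Qed.

Lemma test_line O f fx fy (x y : R) : test O f fx fy ->
  C1_line (fun t => f (t, y)) (fun t => fx (t, y)) /\
  C1_line (fun t => f (x, t)) (fun t => fy (x, t)).
Proof.
move=> [[fxd fyd cf cfx cfy] _ _]; split; split.
- by move=> t; exact: fxd.
- move=> t; apply: (continuous_comp (g := fx) (f := fun t => (t, y))); last exact: cfx.
  by move=> A; exact: nbhs_slicex.
- by move=> t; exact: fyd.
- move=> t; apply: (continuous_comp (g := fy) (f := fun t => (x, t))); last exact: cfy.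
  by move=> A; exact: nbhs_slicey.
Qed.

End PlaneCalculus.

(** * The domain and the approximating functions *)

Section Domain.
Context {R : realType}.
Variables (phi : R -> R) (cphi : continuous phi).
Implicit Types (f fx fy : R * R -> R).

Local Notation O := (Omega_infty phi).

Definition in_below (rho : R) (p : R * R) : bool :=
  (0 < p.2 < 1) && (- phi p.2 < p.1) && (p.1 < rho).

Lemma in_belowP rho p : Omega_below phi rho p <-> in_below rho p.
Proof.
rewrite /in_below /Omega_below /Omega_infty /=; split.
  by move=> [[-> ->] ->].
by move=> /andP[/andP[-> ->] ->].
Qed.

Lemma OmegaP p : O p <-> (0 < p.2 < 1) && (- phi p.2 < p.1).
Proof.
by rewrite /Omega_infty /=; split => [[-> ->]//|/andP[-> ->]].
Qed.

Lemma Omega_strip : O `<=` [set p | 0 < p.2 < 1].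
Proof. by move=> p []. Qed.

Lemma meas_in_below rho :
  @measurable_fun _ _ (RM R * RM R)%type bool setT (in_below rho).
Proof.
have m1 : meas2 (fun p : R * R => p.1) by exact: (@measurable_fst _ _ (RM R) (RM R)).
have m2 : meas2 (fun p : R * R => p.2) by exact: (@measurable_snd _ _ (RM R) (RM R)).
have mphi : meas2 (fun p : R * R => - phi p.2).
  by apply: (@meas2_snd R (fun y => - phi y)); apply: meas1_continuous => y;
     apply: cvgN; exact: cphi.
apply: measurable_and; last by apply: measurable_fun_ltr => //; exact: measurable_cst.
apply: measurable_and; last exact: measurable_fun_ltr.
by apply: measurable_and; apply: measurable_fun_ltr => //; exact: measurable_cst.
Qed.

Lemma bounded_ind_below rho : bounded2 (fun p : R * R => ind (in_below rho p) : R).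
Proof.
split; last by exists 1 => p; case: (in_below _ _); rewrite ?normr1 ?normr0.
by apply: meas_indicator; exact: meas_in_below.
Qed.

Lemma measurable_below rho :
  measurable (Omega_below phi rho : set (RM R * RM R)).
Proof.
rewrite (_ : Omega_below _ _ = setT `&` in_below rho @^-1` [set true]).
  exact: meas_in_below.
by apply/seteqP; split => p; rewrite setTI /=; move/in_belowP.
Qed.

Lemma restrictE rho (f : R * R -> R) :
  (f \_ (Omega_below phi rho)) = (fun p => ind (in_below rho p) * f p).
Proof.
apply/funext => p; rewrite patchE.
have [pD|pD] := boolP (p \in _).
  by rewrite inE in pD; move/in_belowP : pD => ->; rewrite mul1r.
case E : (in_below rho p); rewrite ?mul0r//.
by move: pD; rewrite notin_setE => /in_belowP; rewrite E.
Qed.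

Lemma square_integrable_sqsum rho f : square_integrable (Omega_below phi rho) f ->
  sqsum2 (fun p => ind (in_below rho p) * f p).
Proof.
move=> [mf fi]; rewrite -restrictE; split.
  exact: ((measurable_restrictT _ (measurable_below rho)).1 mf).
have := (integrable_mkcond _ (measurable_below rho)).1 fi.
congr (_.-integrable _ _); apply/funext => p; rewrite /= patchE.
rewrite [(f \_ _) p]patchE; case: ifP => //= _.
by rewrite expr0n.
Qed.

Lemma Rint_below rho f g :
  (forall p, ~ Omega_below phi rho p -> O p -> f p = 0) ->
  g =1 (fun p => ind (in_below rho p) * f p) ->
  \int[leb2]_(p in O) f p = int2 g.
Proof.
move=> f0 gE; rewrite Rintegral_mkcond.
apply: (eq_Rint plane_measure) => p; rewrite gE patchE.
have [pO|pO] := boolP (p \in _).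
  rewrite inE in pO; case E : (in_below rho p); rewrite ?mul1r ?mul0r//.
  by apply: f0 => // /in_belowP; rewrite E.
have -> : in_below rho p = false; last by rewrite mul0r.
by apply/negP => /in_belowP[pO' _]; move: pO; rewrite notin_setE.
Qed.

Section Approximation.
Variables (U Ux Uy : R * R -> R) (rho : R).
Hypothesis sqU : square_integrable (Omega_below phi rho) U.
Hypothesis sqUx : square_integrable (Omega_below phi rho) Ux.
Hypothesis sqUy : square_integrable (Omega_below phi rho) Uy.
Hypothesis wU : weak_helmholtz O U Ux Uy.
Hypothesis aU : forall e : R, 0 < e -> exists2 psi, C1c O psi &
  (H1_dist2 (Omega_below phi rho) U Ux Uy psi < e%:E)%E.

Local Notation cut f := (fun p => ind (in_below rho p) * f p).

(** A test function that vanishes for [x >= rho] only sees the bounded piece of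
    the domain. *)
Lemma weak_cut f fx fy : test O f fx fy ->
  (forall p, rho <= p.1 -> [/\ f p = 0, fx p = 0 & fy p = 0]) ->
  int2 (fun p => cut Ux p * fx p) + int2 (fun p => cut Uy p * fy p)
    = pi ^+ 2 * int2 (fun p => cut U p * f p).
Proof.
move=> ft f0; have [fC dfx dfy] := test_C1c ft.
have [fb fxb fyb] := test_box Omega_strip ft.
have out p : ~ Omega_below phi rho p -> O p -> [/\ f p = 0, fx p = 0 & fy p = 0].
  move=> pD pO; apply: f0; rewrite leNgt; apply/negP => prho.
  by apply: pD.
have := wU fC; rewrite dfx dfy.
rewrite (@Rint_below rho _ (fun p => cut Ux p * fx p + cut Uy p * fy p)).
- rewrite (@Rint_below rho _ (fun p => cut U p * f p)).
  + rewrite RintD//; apply: sq_summableM; try exact: box_bounded_sq;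
      exact: square_integrable_sqsum.
  + by move=> p pD pO; have [-> _ _] := out p pD pO; rewrite mulr0.
  + by move=> p; rewrite mulrA.
- by move=> p pD pO; have [_ -> ->] := out p pD pO; rewrite !mulr0 addr0.
- by move=> p; rewrite mulrDr !mulrA.
Qed.

(** This is how the solution vanishes on the boundary in the sense of traces: one
    function is chosen for each tolerance [1 / (n + 1)]. *)
Lemma approximation : exists f fx fy : nat -> R * R -> R,
  [/\ forall n, test O (f n) (fx n) (fy n),
      sqcvg2 (fun n => cut (f n)) (cut U),
      sqcvg2 (fun n => cut (fx n)) (cut Ux) &
      sqcvg2 (fun n => cut (fy n)) (cut Uy)].
Proof.
have : forall n : nat, exists psi, C1c O psi /\
    (H1_dist2 (Omega_below phi rho) U Ux Uy psi < (n.+1%:R^-1)%:E)%E.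
  move=> n; have [psi h1 h2] := aU (e := n.+1%:R^-1) ltac:(by rewrite invr_gt0).
  by exists psi.
move=> /choice[f fP].
exists f, (fun n => dx (f n)), (fun n => dy (f n)).
have ft n : test O (f n) (dx (f n)) (dy (f n)) := C1c_test (fP n).1.
have [FL FxL FyL] : [/\ forall n, sqsum2 (cut (f n)),
    forall n, sqsum2 (cut (dx (f n))) & forall n, sqsum2 (cut (dy (f n)))].
  by split=> n; apply: sq_summable_bounded; try exact: bounded_ind_below;
    apply: box_bounded_sq; have [] := test_box Omega_strip (ft n).
have UL := square_integrable_sqsum sqU.
have UxL := square_integrable_sqsum sqUx.
have UyL := square_integrable_sqsum sqUy.
pose G n p := (cut (f n) p - cut U p) ^+ 2 + (cut (dx (f n)) p - cut Ux p) ^+ 2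
  + (cut (dy (f n)) p - cut Uy p) ^+ 2.
have Gi n : sum2 (G n).
  have [_ h1] := sq_summableB (FL n) UL; have [_ h2] := sq_summableB (FxL n) UxL.
  have [_ h3] := sq_summableB (FyL n) UyL.
  by apply: summableD => //; exact: summableD.
have Gle n : int2 (G n) <= harmonic n.
  have := ltW (fP n).2; rewrite /H1_dist2 integral_mkcond => h.
  rewrite -lee_fin /Rintegral fineK; last exact: (integrable_fin_num measurableT (Gi n)).
  apply: le_trans h; rewrite le_eqVlt; apply/orP; left; apply/eqP.
  apply: eq_integral => p _; rewrite patchE /G.
  have [pD|pD] := boolP (p \in _).
    by rewrite inE in pD; move/in_belowP : pD => ->; rewrite !mul1r.
  have -> : in_below rho p = false; last by rewrite !mul0r subrr expr0n/= !addr0.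
  by apply/negP => /in_belowP pO'; move: pD; rewrite notin_setE.
have conv (F : nat -> R * R -> R) V : sqsum2 V -> (forall n, sqsum2 (F n)) ->
    (forall n p, (F n p - V p) ^+ 2 <= G n p) -> sqcvg2 F V.
  move=> VL FiL FV; split=> //.
  apply: (@squeeze_cvgr _ _ _ _ (fun=> 0) harmonic); [|exact: cvg_cst|exact: cvg_harmonic].
  apply: nearW => n; rewrite Rintegral_ge0/=; last by move=> *; exact: sqr_ge0.
  have [_ iFV] := sq_summableB (FiL n) VL.
  by apply: le_trans (Gle n); apply: Rint_le => //; exact: (Gi n).
split=> //.
- by apply: conv => // n p; rewrite /G -addrA lerDl addr_ge0 ?sqr_ge0.
- by apply: conv => // n p; rewrite /G addrAC lerDr addr_ge0 ?sqr_ge0.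
- by apply: conv => // n p; rewrite /G lerDr addr_ge0 ?sqr_ge0.
Qed.

End Approximation.
End Domain.

(** * Integrals over horizontal and vertical lines *)

Section Slices.
Context {R : realType}.
Variables (phi : R -> R) (cphi : continuous phi).
Hypothesis phi_ge0 : forall y, 0 <= phi y.
Variable B : R.
Hypothesis phi_le : forall y, phi y <= B.
Variable rho : R.
Hypothesis rho_gt0 : 0 < rho.
Implicit Types (f fx fy g gx gy : R * R -> R).

Local Notation O := (Omega_infty phi).
Local Notation ind_below := (in_below phi rho).

(** The lowest Dirichlet eigenfunction of the unit interval; its eigenvalue is
    [pi ^+ 2]. *)
Definition mode (y : R) : R := sin (pi * y).
Definition mode_below (p : R * R) : R := ind (ind_below p) * mode p.2.

Lemma mode_le1 y : `|mode y| <= 1.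
Proof. by rewrite /mode ler_norml sin_geN1 sin_le1. Qed.

Lemma C1_mode : C1_line mode (fun y => pi * cos (pi * y)).
Proof.
split => y.
  apply: is_derive_eq; rewrite /GRing.scale/=; ring.
apply: cvgM; first exact: cvg_cst.
apply: (continuous_comp (f := fun y => pi * y)); last exact: continuous_cos.
by apply: cvgM; [exact: cvg_cst|exact: cvg_id].
Qed.

Lemma bounded_mode : bounded1 mode.
Proof.
split; last by exists 1 => y; exact: mode_le1.
exact: meas1_continuous (C1_line_cont C1_mode).
Qed.

Lemma bounded_mode_below : bounded2 mode_below.
Proof.
apply: bounded_measM; first exact: bounded_ind_below.
exact: (bounded2_snd bounded_mode).
Qed.

Lemma box_below : box_bounded (fun p : R * R => ind (in_below phi rho p) : R).
Proof.
split; first exact: bounded_ind_below.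
exists (Num.max B rho) => -[x y]; rewrite /in_below /=.
have [yx|] := boolP ((0 < y < 1) && (- phi y < x) && (x < rho)); last by rewrite eqxx.
move: yx => /andP[/andP[/andP[y0 y1] x1] x2] _; apply/strip_boxE.
have := phi_le y; have Bm : B <= Num.max B rho by rewrite le_max lexx.
have rm : rho <= Num.max B rho by rewrite le_max lexx orbT.
by move=> ?; split; lra.
Qed.

Lemma box_mode_below : box_bounded mode_below.
Proof.
rewrite (_ : mode_below = fun p => mode p.2 * ind (ind_below p)).
  exact: (box_boundedM box_below (bounded2_snd bounded_mode)).
by apply/funext => p; rewrite /mode_below mulrC.
Qed.

Lemma Omega_point : O (1, 2^-1).
Proof.
apply/OmegaP => /=; rewrite invr_gt0 ltr0n/=; apply/andP; split; first lra.
by have := phi_ge0 2^-1; lra.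
Qed.

Lemma bounded_ind_gt0 : bounded2 (fun p : R * R => ind (0 < p.1) : R).
Proof.
apply: (@bounded2_fst R (fun x : R => ind (0 < x) : R)); split; last first.
  by exists 1 => x; case: (_ < _); rewrite ?normr1 ?normr0.
by apply: (@meas_indicator R _ (RM R)); exact: measurable_fun_ltr.
Qed.

Lemma bounded_ind_lt0 : bounded2 (fun p : R * R => ind (p.1 < 0) : R).
Proof.
apply: (@bounded2_fst R (fun x : R => ind (x < 0) : R)); split; last first.
  by exists 1 => x; case: (_ < _); rewrite ?normr1 ?normr0.
by apply: (@meas_indicator R _ (RM R)); exact: measurable_fun_ltr.
Qed.

Lemma not_Omega_y (x y : R) : ~~ (0 < y < 1) -> ~ O (x, y).
Proof. by move=> /negP y01 /OmegaP/andP[]. Qed.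

Lemma not_Omega_x (x y : R) : x <= - B -> ~ O (x, y).
Proof. by move=> xB /OmegaP/=/andP[_]; have := phi_le y; lra. Qed.

(** The linear form of the variational principle. *)
Definition trace f : R := int1 (fun y => f (0, y) * mode y).

(** Integrate in [x] along horizontal lines, on either side of [x = 0]. *)
Lemma trace_right f fx fy : test O f fx fy -> (forall p, rho <= p.1 -> f p = 0) ->
  int2 (fun p => ind (0 < p.1) * (mode_below p * fx p)) = - trace f.
Proof.
move=> ft frho; have [fb fxb fyb] := test_box (@Omega_strip _ phi) ft.
have bb : box_bounded (fun p => ind (0 < p.1) * (mode_below p * fx p)).
  apply: box_boundedM; last exact: bounded_ind_gt0.
  by apply: box_boundedM => //; exact: bounded_mode_below.
rewrite (fubinixy bb) /trace -mulN1r.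
have mi : sum1 (fun y => f (0, y) * mode y).
  have := box_bounded_slicex 0 (box_boundedM fb (bounded2_snd bounded_mode)).
  by under eq_fun do rewrite mulrC.
rewrite -RintZ//; apply: eq_Rint => y.
rewrite (@eq_Rint _ _ _ line_measure _ (fun x => mode y * (ind (0 < x < rho) * fx (x, y)))).
  have [fl _] := test_line 0 y ft.
  have s1 : sum1 (fun x => ind (0 < x < rho) * fx (x, y)).
    by apply: sum1_oo => [|x _]; [exact: ltW|exact: fl.2].
  rewrite RintZ// (ftc_oo (ltW rho_gt0) (fun x _ => fl.1 x) (fun x _ => fl.2 x)).
  by rewrite frho//= sub0r; ring.
move=> x /=; have [x0|] := boolP (0 < x); last by rewrite !mul0r mulr0.
have [xr|] := boolP (x < rho); last first.
  move=> xr; rewrite mul0r mulr0 /mode_below /in_below /= (negbTE xr).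
  by rewrite andbF !mul0r mulr0.
have [xO|xO] := pselect (O (x, y)).
  rewrite /mode_below /in_below/= xr andbT; move/OmegaP : xO => ->.
  by rewrite !mul1r.
by have [_ -> _] := test_out ft xO; rewrite !mulr0.
Qed.

Lemma trace_left f fx fy : test O f fx fy ->
  int2 (fun p => ind (p.1 < 0) * (mode_below p * fx p)) = trace f.
Proof.
move=> ft; have [fb fxb fyb] := test_box (@Omega_strip _ phi) ft.
have bb : box_bounded (fun p => ind (p.1 < 0) * (mode_below p * fx p)).
  apply: box_boundedM; last exact: bounded_ind_lt0.
  by apply: box_boundedM => //; exact: bounded_mode_below.
rewrite (fubinixy bb) /trace; apply: eq_Rint => y.
have B0 : 0 <= B by apply: le_trans (phi_le 0).
rewrite (@eq_Rint _ _ _ line_measure _ (fun x => mode y * (ind (- B < x < 0) * fx (x, y)))).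
  have [fl _] := test_line 0 y ft.
  have s1 : sum1 (fun x => ind (- B < x < 0) * fx (x, y)).
    by apply: sum1_oo => [|x _]; [rewrite oppr_le0|exact: fl.2].
  have B0' : - B <= 0 by rewrite oppr_le0.
  rewrite RintZ// (ftc_oo B0' (fun x _ => fl.1 x) (fun x _ => fl.2 x)).
  have [-> _ _] := test_out ft (@not_Omega_x (- B) y (lexx _)).
  by rewrite subr0 mulrC.
move=> x /=; have [x0|] := boolP (x < 0); last by rewrite andbF !mul0r mulr0.
have [xB|] := boolP (- B < x); last first.
  rewrite -leNgt => xB; rewrite mul0r mulr0.
  by have [_ -> _] := test_out ft (@not_Omega_x x y xB); rewrite !mulr0.
have [xO|xO] := pselect (O (x, y)).
  rewrite /mode_below /in_below/= (lt_trans x0 rho_gt0) andbT.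
  by move/OmegaP : xO => ->; rewrite !mul1r.
by have [_ -> _] := test_out ft xO; rewrite !mulr0.
Qed.

(** [wirtinger] on every vertical line; it applies because test functions vanish
    outside the unit interval in [y]. *)
Lemma wirtinger_test f fx fy : test O f fx fy ->
  0 <= int2 (fun p => fy p * fy p) - pi ^+ 2 * int2 (fun p => f p * f p).
Proof.
move=> ft; have [fb fxb fyb] := test_box (@Omega_strip _ phi) ft.
have f2 := box_boundedM fb fb.1; have fy2 := box_boundedM fyb fyb.1.
rewrite -RintZ; last exact: box_bounded_summable.
rewrite -RintB; [|exact: box_bounded_summable|exact/summableZ/box_bounded_summable].
rewrite fubiniyx; last first.
  by apply: box_boundedB => //; apply: box_boundedM => //; exact: bounded_cst.
apply: Rintegral_ge0 => x _.
have [_ [fd cfy]] := test_line x 0 ft.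
have [f0 _ _] := test_out ft (@not_Omega_y x 0 ltac:(by rewrite ltxx)).
have [f1 _ _] := test_out ft (@not_Omega_y x 1 ltac:(by rewrite ltxx andbF)).
have := wirtinger fd cfy f0 f1.
congr (_ <= _); apply: eq_Rint => y.
have [y01|y01] := boolP (0 < y < 1); first by rewrite mul1r; ring.
by have [-> _ ->] := test_out ft (@not_Omega_y x y y01); ring.
Qed.

(** On the line of ordinate [y] the protruding part has length [phi y]. *)
Lemma mode_sq_left : int2 (fun p => ind (p.1 < 0) * (mode_below p * mode_below p))
  = int1 (fun y => ind (0 < y < 1) * (phi y * mode y ^+ 2)).
Proof.
rewrite fubinixy; last first.
  apply: box_boundedM; last exact: bounded_ind_lt0.
  by apply: box_boundedM; [exact: box_mode_below|exact: bounded_mode_below].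
apply: eq_Rint => y.
rewrite (@eq_Rint _ _ _ line_measure _
  (fun x => ind (0 < y < 1) * mode y ^+ 2 * (ind (- phi y < x < 0) * 1))).
  have phi0 : - phi y <= 0 by rewrite oppr_le0.
  rewrite RintZ.
    rewrite (@ftc_oo R id (fun=> 1) _ _ phi0 (fun x _ => is_derive_id x 1)
      (fun x _ => cvg_cst _)).
    by rewrite /= sub0r opprK; ring.
  by apply: sum1_oo => // x _; exact: cvg_cst.
move=> x; rewrite /mode_below /in_below /=.
have [y01|] := boolP (0 < y < 1); last by rewrite !mul0r mulr0.
have [x0|] := boolP (x < 0); last by rewrite andbF !mul0r mulr0.
rewrite (lt_trans x0 rho_gt0) /= !andbT.
by case: (- phi y < x) => /=; ring.
Qed.

Lemma mode_sq_right (k dk : R -> R) : C1_line k dk -> bounded1 dk ->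
  k 0 = 0 -> k rho = 0 ->
  int2 (fun p => ind (0 < p.1) * (dk p.1 * (mode_below p * mode_below p))) = 0.
Proof.
move=> [kd cdk] bdk k0 krho.
rewrite fubinixy; last first.
  apply: box_boundedM; last exact: bounded_ind_gt0.
  apply: box_boundedM; last exact: (bounded2_fst bdk).
  by apply: box_boundedM; [exact: box_mode_below|exact: bounded_mode_below].
rewrite (@eq_Rint _ _ _ line_measure _ (fun=> 0)).
  by rewrite Rintegral_cst// mul0r.
move=> y; rewrite (@eq_Rint _ _ _ line_measure _
  (fun x => ind (0 < y < 1) * mode y ^+ 2 * (ind (0 < x < rho) * dk x))).
  rewrite RintZ.
    rewrite (ftc_oo (ltW rho_gt0) (fun x _ => kd x) (fun x _ => cdk x)).
    by rewrite k0 krho subrr mulr0.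
  by apply: sum1_oo => [|x _]; [exact: ltW|exact: cdk].
move=> x; rewrite /mode_below /in_below /=.
have [y01|] := boolP (0 < y < 1); last by rewrite !mul0r !mulr0.
have [x0|] := boolP (0 < x); last by rewrite !mul0r mulr0.
have -> : - phi y < x by apply: le_lt_trans x0; rewrite oppr_le0.
by case: (_ < _); rewrite /=; ring.
Qed.

Lemma box_ind (a b : R) : box_bounded (fun p : R * R => ind (a < p.1 < b) * ind (0 < p.2 < 1) : R).
Proof.
have bi (c d : R) : bounded1 (fun x : R => ind (c < x < d) : R).
  split; first exact: meas_oo.
  by exists 1 => x; case: (_ && _); rewrite ?normr1 ?normr0.
split.
  apply: bounded_measM; first exact: (bounded2_fst (bi a b)).
  exact: (bounded2_snd (bi 0 1)).
exists (Num.max (- a) b) => -[x y] /=.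
have [/andP[ax xb]|] := boolP (a < x < b); last by rewrite mul0r eqxx.
have [/andP[y0 y1]|] := boolP (0 < y < 1); last by rewrite mulr0 eqxx.
move=> _; apply/strip_boxE.
have am : - a <= Num.max (- a) b by rewrite le_max lexx.
have bm : b <= Num.max (- a) b by rewrite le_max lexx orbT.
by split; lra.
Qed.

Lemma int2_ind (a b : R) : a <= b ->
  int2 (fun p : R * R => ind (a < p.1 < b) * ind (0 < p.2 < 1)) = b - a.
Proof.
move=> ab; rewrite (fubinixy (box_ind a b)).
have s1 (c d : R) : c <= d -> sum1 (fun x : R => ind (c < x < d) * 1).
  by move=> cd; apply: sum1_oo => // x _; exact: cvg_cst.
have i1 (c d : R) : c <= d -> int1 (fun x : R => ind (c < x < d) * 1) = d - c.
  move=> cd; apply: (@ftc_oo R id (fun=> 1)) => // x _; exact: cvg_cst.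
rewrite (@eq_Rint _ _ _ line_measure _ (fun y => (b - a) * (ind (0 < y < 1) * 1))).
  rewrite RintZ; last exact: s1 ler01.
  by apply: etrans (congr1 _ (i1 0 1 ler01)) _; rewrite subr0 mulr1.
move=> y; rewrite (@eq_Rint _ _ _ line_measure _ (fun x => ind (0 < y < 1) * (ind (a < x < b) * 1))).
  rewrite RintZ; last exact: s1 ab.
  by apply: etrans (congr1 _ (i1 a b ab)) _; ring.
by move=> x /=; ring.
Qed.

End Slices.

(** * Test functions close to the eigenfunction *)

Section Mode.
Context {R : realType}.
Implicit Types (d x y : R).

(** A continuously differentiable function that equals [mode] on the unit
    interval and is nonpositive outside it. *)
Definition mode_ext y : R := mode y - sqpos (- y) - sqpos (y - 1).
Definition dmode_ext y : R := pi * cos (pi * y) + 2 * pos (- y) - 2 * pos (y - 1).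

Lemma C1_mode_ext : C1_line mode_ext dmode_ext.
Proof.
have s1 := C1_line_comp C1_sqpos (C1_line_affine (-1) (0 : R)).
have s2 := C1_line_comp C1_sqpos (C1_line_affine 1 (- 1 : R)).
have s3 := C1_lineD s1 s2.
have s4 := C1_lineM (C1_line_affine 0 (-1)) s3.
have H := C1_lineD (C1_mode (R := R)) s4.
apply: (C1_line_eq H) => y; rewrite /mode_ext /dmode_ext /=.
  by rewrite mulN1r addr0 mul1r; ring.
by rewrite mulN1r addr0 mul1r; ring.
Qed.

Lemma mode_ge0 y : 0 <= y <= 1 -> 0 <= mode y.
Proof.
move=> /andP[y0 y1]; apply: sin_ge0_pi; rewrite mulr_ge0 ?pi_ge0//=.
by rewrite ler_piMr ?pi_ge0.
Qed.

Lemma mode_gt0 y : 0 < y < 1 -> 0 < mode y.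
Proof.
move=> /andP[y0 y1]; apply: sin_gt0_pi; rewrite mulr_gt0 ?pi_gt0//=.
by rewrite gtr_pMr ?pi_gt0.
Qed.

Lemma mode0 : mode 0 = 0 :> R. Proof. by rewrite /mode mulr0 sin0. Qed.

Lemma mode1 : mode 1 = 0 :> R. Proof. by rewrite /mode mulr1 sinpi. Qed.

Lemma mode_ext_in y : 0 <= y <= 1 ->
  mode_ext y = mode y /\ dmode_ext y = pi * cos (pi * y).
Proof.
move=> /andP[y0 y1]; rewrite /mode_ext /dmode_ext /sqpos !pos0 ?oppr_le0 ?subr_le0//.
by split; ring.
Qed.

Lemma mode_ext_out y : ~~ (0 < y < 1) -> mode_ext y <= 0.
Proof.
have neg (t : R) : -1 <= t <= 0 -> mode t <= 0.
  move=> /andP[t1 t0]; rewrite -oppr_ge0 /mode -sinN -mulrN.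
  by apply: mode_ge0; apply/andP; split; lra.
have per (t : R) : mode (1 - t) = mode t.
  by rewrite /mode mulrBr mulr1 sinB sinpi cospi mul0r sub0r mulN1r opprK.
have main (t : R) : t <= 0 -> mode t - sqpos (- t) <= 0.
  move=> t0; rewrite /sqpos posE ?oppr_ge0//.
  have [t1|t1] := leP (-1) t; first by have := neg t ltac:(by rewrite t1); nra.
  have := mode_le1 t; rewrite ler_norml => /andP[_]; nra.
rewrite negb_and -!leNgt => /orP[y0|y1]; rewrite /mode_ext.
  have -> : sqpos (y - 1) = 0 by rewrite /sqpos pos0 ?expr0n//; lra.
  by rewrite subr0; exact: main.
have -> : sqpos (- y) = 0 by rewrite /sqpos pos0 ?expr0n//; lra.
have y1' : 1 - y <= 0 by rewrite subr_le0.
by have := main _ y1'; rewrite per opprB subr0.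
Qed.

(** A test function of one variable approximating [mode] from below. *)
Definition mode_in d y : R := ramp d (mode_ext y - d).
Definition dmode_in d y : R := dramp d (mode_ext y - d) * dmode_ext y.

Lemma C1_mode_in d : 0 < d -> C1_line (mode_in d) (dmode_in d).
Proof.
move=> d0; have H := C1_line_comp (C1_ramp d0)
  (C1_lineD C1_mode_ext (C1_line_affine 0 (- d))).
by apply: (C1_line_eq H) => y; rewrite /mode_in /dmode_in /= mul0r add0r// addr0.
Qed.

Lemma mode_in_supp d y : 0 < d -> mode_in d y != 0 ->
  [/\ 0 < y < 1, mode_ext y = mode y & d <= mode y].
Proof.
move=> d0 my.
have dm : d <= mode_ext y.
  rewrite leNgt; apply: contra my => md; apply/eqP; apply: ramp0 => //.
  by rewrite subr_le0 ltW.
have y01 : 0 < y < 1.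
  apply/negPn/negP => /mode_ext_out; lra.
have [E _] := mode_ext_in (y := y) ltac:(by case/andP : y01 => *; rewrite !ltW).
by split=> //; rewrite -E.
Qed.

Lemma mode_in_bounds d y : 0 < d ->
  [/\ 0 <= mode_in d y, 0 <= y <= 1 -> mode_in d y <= mode y,
      0 <= y <= 1 -> mode y - 2 * d <= mode_in d y & mode_in d y <= 1].
Proof.
move=> d0; have [r0 r1 r2] := ramp_bounds (mode_ext y - d) d0.
have [y01|y01] := boolP (0 <= y <= 1).
  have [E _] := mode_ext_in y01; have m0 := mode_ge0 y01.
  have m1 : mode y <= 1 by have := mode_le1 y; rewrite ler_norml => /andP[].
  rewrite /mode_in; rewrite E in r0 r1 r2 *.
  have : ramp d (mode y - d) <= mode y.
    by apply: le_trans r1 _; have [[_ ->]|[_ ->]] := posP (mode y - d); lra.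
  by split=> //; lra.
have -> : mode_in d y = 0; last by split.
apply: ramp0 => //; have := @mode_ext_out y.
suff -> : ~~ (0 < y < 1) by move=> /(_ isT); lra.
by apply: contra y01 => /andP[? ?]; rewrite !ltW.
Qed.

Lemma dmode_in_bounds d y : 0 < d -> `|dmode_in d y| <= pi.
Proof.
move=> d0; rewrite /dmode_in.
have p0 := pi_ge0 R.
have [y01|y01] := boolP (0 <= y <= 1).
  have [_ ->] := mode_ext_in y01.
  have /andP[r0 r1] := dramp_bounds (mode_ext y - d) d0.
  have : -1 <= cos (pi * y) <= 1 by rewrite cos_geN1 cos_le1.
  move=> /andP[c1 c2].
  rewrite normrM (normrM pi) (ger0_norm r0) (ger0_norm p0) mulrCA ler_piMr//.
  by rewrite mulr_ile1// ler_norml c1.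
rewrite dramp0 ?mul0r ?normr0//; have := @mode_ext_out y.
suff -> : ~~ (0 < y < 1) by move=> /(_ isT); lra.
by apply: contra y01 => /andP[? ?]; rewrite !ltW.
Qed.

Lemma bounded_mode_in d : 0 < d -> bounded1 (mode_in d) /\ bounded1 (dmode_in d).
Proof.
move=> d0; have [_ cd] := C1_mode_in d0; have c := C1_line_cont (C1_mode_in d0).
split; split; try exact: meas1_continuous.
  exists 1 => y; have [m0 _ _ m1] := mode_in_bounds y d0.
  by rewrite ger0_norm.
by exists pi => y; exact: dmode_in_bounds.
Qed.

Definition step (n : nat) : R := n.+1%:R^-1.

Lemma step_gt0 n : 0 < step n. Proof. by rewrite invr_gt0. Qed.

Lemma step_lt e : 0 < e -> \forall n \near \oo, step n < e.
Proof. by move=> e0; exact: (near_infty_natSinv_lt (PosNum e0)). Qed.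

Lemma cvg_near_step (u : nat -> R) (l C : R) : 0 <= C ->
  (\forall n \near \oo, `|u n - l| <= C * step n) -> u @ \oo --> l.
Proof.
move=> C0 ul; apply/cvgrPdist_le => /= e e0.
have eC : 0 < e / (C + 1) by rewrite divr_gt0// ltr_wpDl.
near=> n; rewrite distrC.
have h : `|u n - l| <= C * step n by near: n.
apply: le_trans h _.
have h : step n < e / (C + 1) by near: n; exact: step_lt.
rewrite ltr_pdivlMr ?ltr_wpDl// in h.
have := step_gt0 n; nra.
Unshelve. all: by end_near. Qed.

Lemma mode_in_cvg y : (fun n => mode_in (step n) y) @ \oo --> ind (0 < y < 1) * mode y.
Proof.
apply: (@cvg_near_step _ _ 2) => //; apply: nearW => n.
have s0 := step_gt0 n.
have [m0 m1 m2 _] := mode_in_bounds y s0.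
have [y01|y01] := boolP (0 < y < 1).
  have y01' : 0 <= y <= 1 by case/andP : y01 => *; rewrite !ltW.
  have := m1 y01'; have := m2 y01'; rewrite mul1r ler_norml => ? ?.
  by apply/andP; split; lra.
have -> : mode_in (step n) y = 0.
  apply/eqP; apply: contraNT y01 => /(mode_in_supp s0)[]//.
by rewrite mul0r subrr normr0 mulr_ge0// ltW.
Qed.

Lemma dmode_in_cvg y :
  (fun n => dmode_in (step n) y) @ \oo --> ind (0 < y < 1) * (pi * cos (pi * y)).
Proof.
apply: (@cvg_near_step _ _ 0) => //.
have [y01|y01] := boolP (0 < y < 1); last first.
  apply: nearW => n; rewrite mul0r /dmode_in dramp0 ?step_gt0//.
    by rewrite mul0r subrr normr0 mul0r.
  by have := mode_ext_out y01; have := step_gt0 n; lra.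
have y01' : 0 <= y <= 1 by case/andP : y01 => *; rewrite !ltW.
have [E dE] := mode_ext_in y01'.
near=> n.
have h : step n < mode y / 2 by near: n; apply: step_lt; rewrite divr_gt0// mode_gt0.
rewrite /dmode_in dE E dramp1 ?step_gt0//; last lra.
by rewrite !mul1r subrr normr0 mul0r.
Unshelve. all: by end_near. Qed.

End Mode.

(** * Conservation of the flux *)

Section Flux.
Context {R : realType}.
Variables (phi : R -> R) (cphi : continuous phi).
Hypothesis phi_ge0 : forall y, 0 <= phi y.
Variable B : R.
Hypothesis phi_le : forall y, phi y <= B.
Variable rho : R.
Hypothesis rho_gt0 : 0 < rho.
Implicit Types (f fx fy g gx gy : R * R -> R).

Local Notation O := (Omega_infty phi).
Local Notation cut f := (fun p => ind (in_below phi rho p) * f p).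
Local Notation mode_below := (mode_below phi rho).

Variables (U Ux Uy : R * R -> R).
Hypothesis sqU : square_integrable (Omega_below phi rho) U.
Hypothesis sqUx : square_integrable (Omega_below phi rho) Ux.
Hypothesis sqUy : square_integrable (Omega_below phi rho) Uy.
Hypothesis wU : weak_helmholtz O U Ux Uy.
Hypothesis aU : forall e : R, 0 < e -> exists2 psi, C1c O psi &
  (H1_dist2 (Omega_below phi rho) U Ux Uy psi < e%:E)%E.

Lemma cut_idem f p : ind (in_below phi rho p) * cut f p = cut f p.
Proof. by rewrite /=; case: (in_below phi rho p); rewrite ?mul0r ?mul1r. Qed.

(** The bounded piece of the domain has finite measure. *)
Lemma sqsum_cut_sum f : sqsum2 (cut f) -> sum2 (cut f).
Proof.
move=> fL; have <- : (fun p => ind (in_below phi rho p) * cut f p) = cut f.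
  by apply/funext => p; exact: cut_idem.
exact: (sq_summableM (box_bounded_sq (box_below cphi phi_le rho)) fL).
Qed.

Lemma cvg_cut (f : nat -> R * R -> R) V g : bounded2 g ->
  sqcvg2 (fun n => cut (f n)) (cut V) ->
  (fun n => int2 (fun p => g p * cut (f n) p)) @ \oo --> int2 (fun p => g p * cut V p).
Proof.
move=> gb fV; have gL := box_bounded_sq (box_boundedM (box_below cphi phi_le rho) gb).
have E h : int2 (fun p => g p * cut h p)
    = int2 (fun p => (g p * ind (in_below phi rho p)) * cut h p).
  by apply: eq_Rint => p; rewrite -mulrA cut_idem.
rewrite E; apply: cvg_seq_eq (sq_cvg_int (sq_cvg_cst gL) fV) => n.
exact: E.
Qed.

Section Profile.
Variables (k dk : R -> R) (K : R).
Hypothesis kC : C1_line k dk.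
Hypothesis k_far : forall x, rho <= x -> k x = 0 /\ dk x = 0.
Hypothesis k_le : forall x, `|k x| <= K.
Hypothesis dk_le : forall x, `|dk x| <= K.

(** A test function vanishing near [x = 0] that tends to [pos x * k x]. *)
Let shifted (d x : R) : R := ramp d (x - d) * k x.
Let dshifted (d x : R) : R := dramp d (x - d) * k x + ramp d (x - d) * dk x.

Let C1_shifted d : 0 < d -> C1_line (shifted d) (dshifted d).
Proof.
move=> d0; have H := C1_lineM (C1_line_comp (C1_ramp d0) (C1_line_affine 1 (- d))) kC.
by apply: (C1_line_eq H) => x; rewrite /shifted /dshifted !mul1r// mulr1.
Qed.

Let test_shifted d : 0 < d -> test O (fun p => shifted d p.1 * mode_in d p.2)
  (fun p => dshifted d p.1 * mode_in d p.2)
  (fun p => shifted d p.1 * dmode_in d p.2).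
Proof.
move=> d0.
have HC := C1_planeM (C1_plane_fst (C1_shifted d0)) (C1_plane_snd (C1_mode_in d0)).
apply: (test_intro (K := `[d, rho] `*` (`[0, 1] `&` [set y | d <= mode y]))).
- by apply: (C1_plane_eq HC) => p; ring.
- apply: compact_setX; first exact: segment_compact.
  apply: compact_closedI; first exact: segment_compact.
  have cm : continuous (@mode R) := C1_line_cont C1_mode.
  apply: (@closed_comp _ _ mode [set t | d <= t]); last exact: closed_ge.
  by move=> y _; exact: cm.
- move=> [x y] [/= xx [yy my]]; apply/OmegaP => /=.
  move: xx yy; rewrite !in_itv/= => /andP[x1 x2] /andP[y0 y1].
  have -> : - phi y < x by apply: lt_le_trans x1; apply: le_lt_trans d0; rewrite oppr_le0.
  rewrite andbT !lt_neqAle y0 y1 !andbT; apply/andP; split.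
    by apply: contraTneq my => <-; rewrite mode0 -ltNge.
  by apply: contraTneq my => ->; rewrite mode1 -ltNge.
move=> [x y] /=; rewrite mulf_eq0 negb_or => /andP[sx my].
have [/andP[y0 y1] _ dm] := mode_in_supp d0 my.
split; last by split; rewrite /= ?in_itv//= !ltW.
rewrite /= in_itv/=; apply/andP; split.
  rewrite leNgt; apply: contra sx => xd.
  by rewrite /shifted ramp0 ?mul0r// subr_le0 ltW.
by rewrite leNgt; apply: contra sx => /ltW/k_far[h _]; rewrite /shifted h mulr0.
Qed.

Let K_ge0 : 0 <= K. Proof. exact: le_trans (k_le 0). Qed.

Let posk (x : R) : `|pos x * k x| <= rho * K.
Proof.
have [xr|/k_far[-> _]] := ltP x rho; last first.
  by rewrite mulr0 normr0 mulr_ge0// ltW.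
rewrite normrM ler_pM// ger0_norm ?pos_ge0//.
by have [[_ ->]|[_ ->]] := posP x; exact: ltW.
Qed.

Let posdk (x : R) : `|pos x * dk x| <= rho * K.
Proof.
have [xr|/k_far[_ ->]] := ltP x rho; last first.
  by rewrite mulr0 normr0 mulr_ge0// ltW.
rewrite normrM ler_pM// ger0_norm ?pos_ge0//.
by have [[_ ->]|[_ ->]] := posP x; exact: ltW.
Qed.

Let ramp_shift (d x : R) : 0 < d -> 0 <= ramp d (x - d) <= pos x.
Proof.
move=> d0; have [-> h _] := ramp_bounds (x - d) d0; apply: le_trans h _.
by have [[? ->]|[? ->]] := posP x; have [[? ->]|[? ->]] := posP (x - d); lra.
Qed.

Let shifted_le d x : 0 < d -> `|shifted d x| <= rho * K.
Proof.
move=> d0; apply: le_trans (posk x); rewrite /shifted (normrM (ramp d _)) (normrM (pos x)) ler_wpM2r//.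
have /andP[r0 r1] := ramp_shift x d0.
by rewrite !ger0_norm ?pos_ge0.
Qed.

Let dshifted_le d x : 0 < d -> `|dshifted d x| <= K + rho * K.
Proof.
move=> d0; apply: le_trans (ler_normD _ _) _; apply: lerD.
  have /andP[r0 r1] := dramp_bounds (x - d) d0.
  rewrite (normrM (dramp d _)) (ger0_norm r0) -[K]mul1r; exact: ler_pM.
apply: le_trans (posdk x); rewrite (normrM (ramp d _)) (normrM (pos x)) ler_wpM2r//.
have /andP[r0 r1] := ramp_shift x d0.
by rewrite !ger0_norm ?pos_ge0.
Qed.

Let shifted_cvg (x : R) : (fun n => shifted (step n) x) @ \oo --> pos x * k x.
Proof.
apply: (@cvg_near_step _ _ _ (2 * K)); first by rewrite mulr_ge0.
apply: nearW => n; have d0 := @step_gt0 R n; set d := step n in d0 *.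
rewrite /shifted -mulrBl normrM mulrAC ler_pM//.
have [_ _ r2] := ramp_bounds (x - d) d0; have /andP[r0 r1] := ramp_shift x d0.
rewrite ler_norml; apply/andP; split; first by have [[_ ->]|[_ ->]] := posP x; lra.
lra.
Qed.

Let dshifted_cvg (x : R) :
  (fun n => dshifted (step n) x) @ \oo --> ind (0 < x) * (k x + x * dk x).
Proof.
have [x0|x0] := ltP 0 x; last first.
  apply: (@cvg_near_step _ _ _ 0) => //; apply: nearW => n.
  have d0 := @step_gt0 R n; rewrite /dshifted dramp0 ?ramp0//; last 2 first.
  - by rewrite subr_le0 (le_trans x0)// ltW.
  - by rewrite subr_le0 (le_trans x0)// ltW.
  by rewrite !mul0r addr0 subrr normr0.
apply: (@cvg_near_step _ _ _ (2 * K)); first by rewrite mulr_ge0.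
near=> n; have d0 := @step_gt0 R n.
have h : step n < x / 2 by near: n; apply: step_lt; rewrite divr_gt0.
set d := step n in d0 h *.
rewrite /dshifted dramp1//; last lra.
have -> : 1 * k x + ramp d (x - d) * dk x - 1 * (k x + x * dk x)
  = (ramp d (x - d) - x) * dk x by ring.
rewrite normrM mulrAC ler_pM//.
have [_ _ r2] := ramp_bounds (x - d) d0; have /andP[r0 r1] := ramp_shift x d0.
rewrite posE in r1; last exact: ltW.
by rewrite ler_norml; apply/andP; split; lra.
Unshelve. all: by end_near. Qed.

(** As [mode] is an eigenfunction, the terms of the weak equation without [Ux]
    cancel: for the approximating functions, integrate by parts in [y]. *)
Let cut_fluxy : int2 (fun p => (pos p.1 * k p.1) *
    (ind (0 < p.2 < 1) * (pi * cos (pi * p.2))) * cut Uy p)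
  = pi ^+ 2 * int2 (fun p => (pos p.1 * k p.1) * (ind (0 < p.2 < 1) * mode p.2) * cut U p).
Proof.
have [f [fx [fy [ft cf cfx cfy]]]] := approximation cphi sqU sqUx sqUy aU.
have mposk : bounded1 (fun x => pos x * k x).
  split; last by exists (rho * K).
  apply: meas1_continuous => x; apply: cvgM; first exact: cont_pos.
  exact: C1_line_cont kC x.
have bind : bounded1 (fun y : R => ind (0 < y < 1) : R).
  split; first exact: meas_oo.
  by exists 1 => y; case: (_ && _); rewrite ?normr1 ?normr0.
have bm : bounded2 (fun p : R * R => (pos p.1 * k p.1) * (ind (0 < p.2 < 1) * mode p.2)).
  apply: bounded_measM; first exact: (bounded2_fst mposk).
  exact: (bounded2_snd (bounded_measM bind bounded_mode)).
have bc : bounded1 (fun y : R => pi * cos (pi * y)).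
  split.
    by have [_] := @C1_mode R; exact: meas1_continuous.
  exists pi => y; rewrite normrM (ger0_norm (pi_ge0 R)) ler_piMr ?pi_ge0//.
  by rewrite ler_norml cos_geN1 cos_le1.
have bdm : bounded2 (fun p : R * R =>
    (pos p.1 * k p.1) * (ind (0 < p.2 < 1) * (pi * cos (pi * p.2)))).
  apply: bounded_measM; first exact: (bounded2_fst mposk).
  exact: (bounded2_snd (bounded_measM bind bc)).
have c1 := cvg_cut bdm cfy; have c2 := cvg_cut bm cf.
apply: (cvg_seq_unique c1).
have c3 := cvg_seqZ (c := pi ^+ 2) c2; apply: (cvg_seq_eq _ c3) => n.
apply/eqP; rewrite -subr_eq0; apply/eqP.
have [fb fxb fyb] := test_box (@Omega_strip _ phi) (ft n).
have cb h : box_bounded h -> box_bounded (cut h).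
  by move=> hb; apply: box_boundedM => //; exact: bounded_ind_below.
have b1 := box_boundedM (cb _ fyb) bdm.
have b2 := box_boundedM (cb _ fb) bm.
rewrite /= -RintZ; last exact: box_bounded_summable.
rewrite -RintB; [|exact: box_bounded_summable|exact/summableZ/box_bounded_summable].
rewrite fubiniyx; last first.
  by apply: box_boundedB => //; apply: box_boundedM => //; exact: bounded_cst.
rewrite (@eq_Rint _ _ _ line_measure _ (fun=> 0)).
  by rewrite Rintegral_cst// mul0r.
move=> x; set c := pos x * k x.
pose F y := f n (x, y) * (pi * cos (pi * y)).
pose dF y := fy n (x, y) * (pi * cos (pi * y)) - pi ^+ 2 * mode y * f n (x, y).
rewrite (@eq_Rint _ _ _ line_measure _ (fun y => c * (ind (0 < y < 1) * dF y))).
  have FC : C1_line F dF.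
    have [_ fC] := test_line x 0 (ft n).
    have cC : C1_line (fun y : R => pi * cos (pi * y)) (fun y => - (pi ^+ 2 * mode y)).
      split => y.
        by apply: is_derive_eq; rewrite /mode /GRing.scale/=; ring.
      apply: cvgN; apply: cvgM; first exact: cvg_cst.
      exact: C1_line_cont C1_mode y.
    apply: (C1_line_eq (C1_lineM fC cC)) => y //; rewrite /dF; ring.
  rewrite RintZ; last by apply: sum1_oo => // y _; exact: FC.2.
  rewrite (ftc_oo ler01 (fun y _ => FC.1 y) (fun y _ => FC.2 y)) /F.
  have [-> _ _] := test_out (ft n) (@not_Omega_y _ phi x 0 ltac:(by rewrite ltxx)).
  have [-> _ _] := test_out (ft n) (@not_Omega_y _ phi x 1 ltac:(by rewrite ltxx andbF)).
  by rewrite !mul0r subrr mulr0.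
move=> y /=; rewrite /dF.
have [y01|] := boolP (0 < y < 1); last by rewrite !mul0r !mulr0 !mul0r mulr0 subrr.
have [x0|x0] := leP x 0; first by rewrite /c pos0// !mul0r; ring.
have [xr|/k_far[k0 _]] := ltP x rho; last by rewrite /c k0; ring.
have -> : in_below phi rho (x, y).
  by rewrite /in_below /= y01 xr andbT/=; apply: le_lt_trans x0; rewrite oppr_le0.
by rewrite -/c !mul1r; ring.
Qed.

(** The [mode] component of a solution has a constant derivative in [x > 0]; this
    is tested against the derivative of the profile [x * k x], which has mean
    zero. The profile times [mode] is a limit of test functions. *)
Lemma zero_flux : int2 (fun p => ind (0 < p.1) * (k p.1 + p.1 * dk p.1)
    * (ind (0 < p.2 < 1) * mode p.2) * cut Ux p) = 0.
Proof.
have cutsum V : square_integrable (Omega_below phi rho) V -> sum2 (cut V).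
  by move=> /(square_integrable_sqsum cphi); exact: sqsum_cut_sum.
pose kx n (p : R * R) := dshifted (step n) p.1 * mode_in (step n) p.2.
pose ky n (p : R * R) := shifted (step n) p.1 * dmode_in (step n) p.2.
pose k0 n (p : R * R) := shifted (step n) p.1 * mode_in (step n) p.2.
have M1 n (y : R) : `|mode_in (step n) y| <= 1.
  by have [m0 _ _ m1] := mode_in_bounds y (@step_gt0 R n); rewrite ger0_norm.
have M2 n (y : R) : `|dmode_in (step n) y| <= pi := dmode_in_bounds y (@step_gt0 R n).
have mm n : [/\ meas1 (mode_in (@step R n)), meas1 (dmode_in (@step R n)),
    meas1 (shifted (step n)) & meas1 (dshifted (step n))].
  have [[m1 _] [m2 _]] := bounded_mode_in (@step_gt0 R n).
  have sC := C1_shifted (@step_gt0 R n).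
  split=> //; first exact: meas1_continuous (C1_line_cont sC).
  by case: sC => _; exact: meas1_continuous.
have lim (kn : nat -> R * R -> R) (kl V : R * R -> R) (C : R) : square_integrable (Omega_below phi rho) V ->
    (forall n, meas2 (kn n)) -> (forall n p, `|kn n p| <= C) ->
    (forall p, (fun n => kn n p) @ \oo --> kl p) ->
    (fun n => int2 (fun p => kn n p * cut V p)) @ \oo --> int2 (fun p => kl p * cut V p).
  move=> sqV mk kC' kcvg; apply: (cvg_int_bounded (cutsum _ sqV) mk _ kC' kcvg).
  exact: (measurable_fun_cvg mk (fun p _ => kcvg p)).
have cx := lim kx (fun p => ind (0 < p.1) * (k p.1 + p.1 * dk p.1)
    * (ind (0 < p.2 < 1) * mode p.2)) Ux (K + rho * K) sqUx.
have cy := lim ky (fun p => (pos p.1 * k p.1) *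
    (ind (0 < p.2 < 1) * (pi * cos (pi * p.2)))) Uy (rho * K * pi) sqUy.
have c0 := lim k0 (fun p => (pos p.1 * k p.1) * (ind (0 < p.2 < 1) * mode p.2))
    U (rho * K) sqU.
have {}cx := cx _ _ _; have {}cy := cy _ _ _; have {}c0 := c0 _ _ _.
have X : (fun n => int2 (fun p => kx n p * cut Ux p)) @ \oo -->
    int2 (fun p => ind (0 < p.1) * (k p.1 + p.1 * dk p.1)
      * (ind (0 < p.2 < 1) * mode p.2) * cut Ux p).
  apply: cx => [n|n p|p].
  - have [m1 m2 m3 m4] := mm n.
    exact: (measurable_funM (meas2_fst m4) (meas2_snd m1)).
  - rewrite normrM -[leRHS]mulr1 ler_pM//; exact: dshifted_le (@step_gt0 R n).
  - apply: cvg_seqM; [exact: dshifted_cvg|exact: mode_in_cvg].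
have Y : (fun n => int2 (fun p => ky n p * cut Uy p)) @ \oo -->
    int2 (fun p => (pos p.1 * k p.1) *
      (ind (0 < p.2 < 1) * (pi * cos (pi * p.2))) * cut Uy p).
  apply: cy => [n|n p|p].
  - have [m1 m2 m3 m4] := mm n.
    exact: (measurable_funM (meas2_fst m3) (meas2_snd m2)).
  - rewrite normrM ler_pM//; exact: shifted_le (@step_gt0 R n).
  - apply: cvg_seqM; [exact: shifted_cvg|exact: dmode_in_cvg].
have Z : (fun n => int2 (fun p => k0 n p * cut U p)) @ \oo -->
    int2 (fun p => (pos p.1 * k p.1) * (ind (0 < p.2 < 1) * mode p.2) * cut U p).
  apply: c0 => [n|n p|p].
  - have [m1 m2 m3 m4] := mm n.
    exact: (measurable_funM (meas2_fst m3) (meas2_snd m1)).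
  - rewrite normrM -[leRHS]mulr1 ler_pM//; exact: shifted_le (@step_gt0 R n).
  - apply: cvg_seqM; [exact: shifted_cvg|exact: mode_in_cvg].
have := cvg_seq_unique (cvg_seqD X Y) (cvg_seq_eq _ (cvg_seqZ (c := pi ^+ 2) Z)).
rewrite cut_fluxy => XY; apply: (@addIr _ (pi ^+ 2 * int2 (fun p : R * R =>
  (pos p.1 * k p.1) * (ind (0 < p.2 < 1) * mode p.2) * cut U p))).
rewrite add0r; apply: XY => n.
have := weak_cut cphi sqUx sqUy wU (test_shifted (@step_gt0 R n)).
rewrite -/(kx n) -/(ky n) -/(k0 n) => W.
have C (g : R * R -> R) V : int2 (fun p => g p * cut V p) = int2 (fun p => cut V p * g p).
  by apply: eq_Rint => p; rewrite mulrC.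
rewrite !C; apply: W => p /k_far[k0' dk0'].
by rewrite /shifted /dshifted k0' dk0' !mulr0 addr0 !mul0r.
Qed.

End Profile.
End Flux.

(** * The energy inequality *)

Section Energy.
Context {R : realType}.
Variables (phi : R -> R) (cphi : continuous phi).
Hypothesis phi_ge0 : forall y, 0 <= phi y.
Variable B : R.
Hypothesis phi_le : forall y, phi y <= B.
Variable w : R.
Hypothesis w_gt0 : 0 < w.
Implicit Types (f fx fy g gx gy z zx zy : R * R -> R).

Let rho : R := 1 + w.
Let rho_gt0 : 0 < rho. Proof. by rewrite addr_gt0. Qed.

Local Notation O := (Omega_infty phi).
Local Notation cut f := (fun p => ind (in_below phi rho p) * f p).
Local Notation s := (mode_below phi rho).

Variables (U Ux Uy : R * R -> R).
Hypothesis sqU : square_integrable (Omega_below phi rho) U.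
Hypothesis sqUx : square_integrable (Omega_below phi rho) Ux.
Hypothesis sqUy : square_integrable (Omega_below phi rho) Uy.
Hypothesis wU : weak_helmholtz O U Ux Uy.
Hypothesis aU : forall e : R, 0 < e -> exists2 psi, C1c O psi &
  (H1_dist2 (Omega_below phi rho) U Ux Uy psi < e%:E)%E.

Let X (x : R) : R := cutoff 1 w x.
Let dX (x : R) : R := dcutoff 1 w x.
Let XC : C1_line X dX := C1_cutoff 1 w.
Let X_near x : x <= 1 -> X x = 1 /\ dX x = 0 := cutoff_near w_gt0 (r := 1) (x := x).
Let X_far x : rho <= x -> X x = 0 /\ dX x = 0 := cutoff_far w_gt0 (r := 1) (x := x).

Let X2C : C1_line (fun x => X x ^+ 2) (fun x => 2 * X x * dX x).
Proof. by apply: (C1_line_eq (C1_lineM XC XC)) => x; ring. Qed.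

Let X_le1 x : `|X x| <= 1.
Proof. by have /andP[? ?] := cutoff_bounds 1 x w_gt0; rewrite ger0_norm. Qed.

Let dX_le x : `|dX x| <= 4 / w := dcutoff_bounds 1 x w_gt0.

Let bX : bounded2 (fun p : R * R => X p.1).
Proof.
apply: (@bounded2_fst R X); split; last by exists 1.
exact: meas1_continuous (C1_line_cont XC).
Qed.

Let bdX : bounded2 (fun p : R * R => dX p.1).
Proof.
apply: (@bounded2_fst R dX); split; last by exists (4 / w).
by case: XC => _; exact: meas1_continuous.
Qed.

(** Its derivative has mean zero over [x > 0], as [zero_flux] requires. *)
Let profile (x : R) : R := x * X x ^+ 2.
Let dprofile (x : R) : R := X x ^+ 2 + x * (2 * X x * dX x).

Let profileC : C1_line profile dprofile.
Proof.
apply: (C1_line_eq (C1_lineM (C1_line_affine 1 0) X2C)) => x.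
  by rewrite /profile mul1r addr0.
by rewrite /dprofile mul1r addr0 mul1r.
Qed.

Let b_dprofile : bounded1 dprofile.
Proof.
split; first by case: profileC => _; exact: meas1_continuous.
exists (1 + rho * (8 / w)) => x.
have w4 : 0 <= 8 / w by rewrite divr_ge0// ltW.
have [/X_near[X1 dX0]|x1] := leP x 1.
  rewrite /dprofile X1 dX0 expr1n !mulr0 addr0 normr1 lerDl mulr_ge0//; exact: ltW.
have [xr|/X_far[X0 dX0]] := ltP x rho; last first.
  by rewrite /dprofile X0 dX0 expr0n/= !mulr0 addr0 normr0 addr_ge0// mulr_ge0// ltW.
apply: le_trans (ler_normD _ _) _; apply: lerD.
  by rewrite normrX exprn_ile1.
rewrite normrM ler_pM//; first by rewrite ger0_norm ?ltW// (lt_trans _ x1).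
have -> : 8 / w = (2 * 1) * (4 / w) by field; exact: lt0r_neq0.
by rewrite normrM ler_pM// normrM ler_pM// ger0_norm.
Qed.

Let u : R * R -> R := cut U.
Let ux : R * R -> R := cut Ux.
Let uy : R * R -> R := cut Uy.
Let uL : sqsum2 u := square_integrable_sqsum cphi sqU.
Let uxL : sqsum2 ux := square_integrable_sqsum cphi sqUx.
Let uyL : sqsum2 uy := square_integrable_sqsum cphi sqUy.
Let sL : sqsum2 s := box_bounded_sq (box_mode_below cphi phi_le rho).
Let bP := @bounded_ind_gt0 R.
Let bN := @bounded_ind_lt0 R.

(** Half of [a], by [flux_trace]; this expression is continuous in the
    mean-square norm of the gradient. *)
Definition flux : R := int2 (fun p => ind (p.1 < 0) * (s p * ux p)).

Variable (f fx fy : nat -> R * R -> R).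
Hypothesis ft : forall n, test O (f n) (fx n) (fy n).
Hypothesis cf : sqcvg2 (fun n => cut (f n)) u.
Hypothesis cfx : sqcvg2 (fun n => cut (fx n)) ux.
Hypothesis cfy : sqcvg2 (fun n => cut (fy n)) uy.

Let below_or (p : R * R) : [\/ in_below phi rho p, ~ O p | rho <= p.1].
Proof.
have [h|h] := boolP (in_below phi rho p); first by constructor 1.
have [pO|pO] := pselect (O p); last by constructor 2.
constructor 3; rewrite leNgt; apply: contra h => pr.
by rewrite /in_below pr andbT; exact/OmegaP.
Qed.

Let Xcut (k : R -> R) g p : (forall x, rho <= x -> k x = 0) ->
  (~ O p -> g p = 0) -> k p.1 * g p = k p.1 * cut g p.
Proof.
move=> k0 g0; have [->|/g0 ->|/k0 ->] := below_or p; first by rewrite mul1r.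
  by rewrite !mulr0.
by rewrite !mul0r.
Qed.

Let X0 x : rho <= x -> X x = 0. Proof. by case/X_far. Qed.
Let dX0 x : rho <= x -> dX x = 0. Proof. by case/X_far. Qed.
Let X20 x : rho <= x -> X x ^+ 2 = 0. Proof. by case/X_far => ->; rewrite expr0n. Qed.
Let dX20 x : rho <= x -> 2 * X x * dX x = 0.
Proof. by case/X_far => -> ->; rewrite !mulr0. Qed.

Let test2 n : test O (fun p => X p.1 ^+ 2 * f n p)
  (fun p => 2 * X p.1 * dX p.1 * f n p + X p.1 ^+ 2 * fx n p)
  (fun p => X p.1 ^+ 2 * fy n p).
Proof.
apply: (test_eq (testM (ft n) (C1_plane_fst X2C))) => p //.
by rewrite mul0r add0r.
Qed.

Let f_out n p : ~ O p -> [/\ f n p = 0, fx n p = 0 & fy n p = 0] := test_out (ft n).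

Let cX2 : sqcvg2 (fun n p => X p.1 ^+ 2 * f n p) (fun p => X p.1 ^+ 2 * u p).
Proof.
have bX2 := bounded_measM bX bX.
have := sq_cvgM bX2 cf; congr (sq_cvg _ _ _).
  apply/funext => n; apply/funext => p; rewrite -expr2 -(@Xcut (fun x => X x ^+ 2))//.
  by move=> /(f_out n)[].
Qed.

Let cX2x : sqcvg2 (fun n p => 2 * X p.1 * dX p.1 * f n p + X p.1 ^+ 2 * fx n p)
  (fun p => 2 * X p.1 * dX p.1 * u p + X p.1 ^+ 2 * ux p).
Proof.
have bX2 := bounded_measM bX bX.
have bX3 := bounded_measM (bounded_measM (bounded_cst 2) bX) bdX.
have := sq_cvgD (sq_cvgM bX3 cf) (sq_cvgM bX2 cfx); congr (sq_cvg _ _ _).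
  apply/funext => n; apply/funext => p; rewrite -expr2 -(@Xcut (fun x => X x ^+ 2))//.
    rewrite -(@Xcut (fun x => 2 * X x * dX x))//.
    by move=> /(f_out n)[].
  by move=> /(f_out n)[].
Qed.

Let cX2y : sqcvg2 (fun n p => X p.1 ^+ 2 * fy n p) (fun p => X p.1 ^+ 2 * uy p).
Proof.
have bX2 := bounded_measM bX bX.
have := sq_cvgM bX2 cfy; congr (sq_cvg _ _ _).
  apply/funext => n; apply/funext => p; rewrite -expr2 -(@Xcut (fun x => X x ^+ 2))//.
  by move=> /(f_out n)[].
Qed.

(** The weak equation may be tested against [X ^ 2 * U], a limit of test
    functions. *)
Let energy_identity :
  int2 (fun p => ux p * (2 * X p.1 * dX p.1 * u p + X p.1 ^+ 2 * ux p))
  + int2 (fun p => uy p * (X p.1 ^+ 2 * uy p))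
  = pi ^+ 2 * int2 (fun p => u p * (X p.1 ^+ 2 * u p)).
Proof.
have cx := sq_cvg_int (sq_cvg_cst uxL) cX2x.
have cy := sq_cvg_int (sq_cvg_cst uyL) cX2y.
have c0 := sq_cvg_int (sq_cvg_cst uL) cX2.
apply: (cvg_seq_unique (cvg_seqD cx cy)).
apply: (cvg_seq_eq _ (cvg_seqZ (c := pi ^+ 2) c0)) => n.
apply: (weak_cut cphi sqUx sqUy wU (test2 n)) => p pr.
by rewrite X20// dX20// !mul0r addr0.
Qed.

(** For a test function the flux is the trace, by [trace_left]; and the flux is
    continuous in the gradient. *)
Lemma trace_cvg : (fun n => trace (f n)) @ \oo --> flux.
Proof.
have := sq_cvg_int (sq_cvg_cst (sq_summable_bounded bN sL)) cfx.
have -> : flux = int2 (fun p => (ind (p.1 < 0) * s p) * ux p).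
  by apply: eq_Rint => p; rewrite mulrA.
apply: cvg_seq_eq => n; rewrite -(trace_left cphi phi_ge0 phi_le rho_gt0 (ft n)).
apply: eq_Rint => p; rewrite -mulrA; congr (_ * _).
by rewrite /s; case: (in_below phi rho p); rewrite ?mul1r ?mul0r.
Qed.

(** The same limit on the other side of [x = 0], by [trace_right]. *)
Let flux_right :
  int2 (fun p => ind (0 < p.1) * (s p * (2 * X p.1 * dX p.1 * u p + X p.1 ^+ 2 * ux p)))
  = - flux.
Proof.
have c1 := sq_cvg_int (sq_cvg_cst (sq_summable_bounded bP sL)) cX2x.
have c2 := cvg_seqZ (c := -1) trace_cvg.
rewrite -mulN1r; transitivity (int2 (fun p => (ind (0 < p.1) * s p) *
  (2 * X p.1 * dX p.1 * u p + X p.1 ^+ 2 * ux p))).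
  by apply: eq_Rint => p; rewrite mulrA.
apply: (cvg_seq_unique c1); apply: (cvg_seq_eq _ c2) => n; rewrite mulN1r.
have -> : trace (f n) = trace (fun p => X p.1 ^+ 2 * f n p).
  by apply: eq_Rint => y /=; have [-> _] := X_near (@ler01 R); rewrite expr1n mul1r.
rewrite -(trace_right cphi rho_gt0 (test2 n)).
  by apply: eq_Rint => p; rewrite mulrA.
by move=> p pr; rewrite X20// mul0r.
Qed.

Let zero_flux_profile :
  int2 (fun p => ind (0 < p.1) * (dprofile p.1 * (s p * ux p))) = 0.
Proof.
have w4 : 0 <= 8 / w by rewrite divr_ge0// ltW.
have b1 x : `|X x ^+ 2| <= 1 + 8 / w.
  by rewrite normrX (le_trans (y := 1)) ?exprn_ile1 ?lerDl.
have b2 x : `|2 * X x * dX x| <= 1 + 8 / w.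
  have -> : 1 + 8 / w = 1 + 2 * 1 * (4 / w) by field; exact: lt0r_neq0.
  apply: (@le_trans _ _ (2 * 1 * (4 / w))); last by rewrite lerDr.
  by rewrite normrM ler_pM// normrM ler_pM// ger0_norm.
have far x : rho <= x -> X x ^+ 2 = 0 /\ 2 * X x * dX x = 0.
  by move=> xr; rewrite X20// dX20.
rewrite -[RHS](zero_flux cphi phi_ge0 phi_le rho_gt0 sqU sqUx sqUy wU aU X2C far b1 b2).
apply: eq_Rint => p; rewrite /ux /s /dprofile /mode_below.
case E : (in_below phi rho p); rewrite ?mul0r ?mulr0// !mul1r.
by have /andP[/andP[-> _] _] := E; rewrite mul1r; ring.
Qed.

Variables (z zx zy : R * R -> R).
Hypothesis zt : test O z zx zy.
Hypothesis z_near : forall p, 1 < p.1 -> [/\ z p = 0, zx p = 0 & zy p = 0].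
Variable h : R.

(** To the right of [x = 0] this is the [x]-derivative of [x * X x], the factor of
    [mode] in the unbounded part of the cut off solution; to the left it is a trial
    slope that completes the square. *)
Let H (p : R * R) : R := ind (0 < p.1) * (X p.1 + p.1 * dX p.1) + h * ind (p.1 < 0).
Let Hs (p : R * R) : R := H p * s p.

Let Hs_box : box_bounded Hs.
Proof.
pose G (x : R) := X x + x * dX x.
have GC : C1_line (fun x => x * X x) G.
  apply: (C1_line_eq (C1_lineM (C1_line_affine 1 0) XC)) => x.
    by rewrite mul1r addr0.
  by rewrite /G mul1r addr0 mul1r.
have bG : bounded1 G.
  split; first by case: GC => _; exact: meas1_continuous.
  exists (1 + rho * (4 / w)) => x.
  have w4 : 0 <= 4 / w by rewrite divr_ge0// ltW.
  have [/X_near[X1 dX1]|x1] := leP x 1.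
    by rewrite /G X1 dX1 mulr0 addr0 normr1 lerDl mulr_ge0// ltW.
  have [xr|/X_far[X1 dX1]] := ltP x rho; last first.
    by rewrite /G X1 dX1 mulr0 addr0 normr0 addr_ge0// mulr_ge0// ltW.
  apply: le_trans (ler_normD _ _) _; apply: lerD => //.
  by rewrite normrM ler_pM// ger0_norm ?ltW// (lt_trans _ x1).
apply: box_boundedM; first exact: box_mode_below.
apply: bounded_measD; last by apply: bounded_measM bN; exact: bounded_cst.
by apply: bounded_measM bP _; exact: (bounded2_fst bG).
Qed.

Let zb := test_box (@Omega_strip _ phi) zt.
Let zL : sqsum2 z. Proof. by case: zb => b _ _; exact: box_bounded_sq. Qed.
Let zxL : sqsum2 zx. Proof. by case: zb => _ b _; exact: box_bounded_sq. Qed.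
Let zyL : sqsum2 zy. Proof. by case: zb => _ _ b; exact: box_bounded_sq. Qed.
Let HsL : sqsum2 Hs := box_bounded_sq Hs_box.

Let sq_cvg_eq (g_ g'_ : nat -> R * R -> R) (g g' : R * R -> R) :
  sqcvg2 g_ g -> (forall n, g_ n =1 g'_ n) -> g =1 g' -> sqcvg2 g'_ g'.
Proof.
by move=> gc E /funext <-; rewrite (_ : g'_ = g_)//; apply/funext => n; apply/funext => p; rewrite E.
Qed.

(** [wirtinger_test] for the cut off solution minus [z], plus the integral of a
    square. Only the [x]-derivative is corrected by [Hs]: adding a multiple of
    [mode] on a vertical line leaves the expression in [wirtinger] unchanged,
    [mode] being the extremal. *)
Let wirtinger_solution :
  0 <= int2 (fun p => (dX p.1 * u p + X p.1 * ux p - zx p - Hs p)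
                    * (dX p.1 * u p + X p.1 * ux p - zx p - Hs p))
     + (int2 (fun p => (X p.1 * uy p - zy p) * (X p.1 * uy p - zy p))
     + - pi ^+ 2 * int2 (fun p => (X p.1 * u p - z p) * (X p.1 * u p - z p))).
Proof.
have XE p g : (~ O p -> g p = 0) -> X p.1 * cut g p = X p.1 * g p.
  by move=> g0; rewrite -(@Xcut X).
have dXE p g : (~ O p -> g p = 0) -> dX p.1 * cut g p = dX p.1 * g p.
  by move=> g0; rewrite -(@Xcut dX).
have f0 n p : ~ O p -> f n p = 0 by move=> /(f_out n)[].
have fx0 n p : ~ O p -> fx n p = 0 by move=> /(f_out n)[].
have fy0 n p : ~ O p -> fy n p = 0 by move=> /(f_out n)[].
have tn n := testB (testM (ft n) (C1_plane_fst XC)) zt.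
have cw : sqcvg2 (fun n p => X p.1 * f n p - z p) (fun p => X p.1 * u p - z p).
  apply: (sq_cvg_eq (sq_cvgB (sq_cvgM bX cf) (sq_cvg_cst zL))) => [n p|p] //.
  by rewrite XE//; exact: f0.
have cwx : sqcvg2 (fun n p => dX p.1 * f n p + X p.1 * fx n p - zx p - Hs p)
    (fun p => dX p.1 * u p + X p.1 * ux p - zx p - Hs p).
  apply: (sq_cvg_eq (sq_cvgB (sq_cvgB (sq_cvgD (sq_cvgM bdX cf) (sq_cvgM bX cfx))
    (sq_cvg_cst zxL)) (sq_cvg_cst HsL))) => [n p|p] //.
  by rewrite dXE ?XE//; [exact: fx0|exact: f0].
have cwy : sqcvg2 (fun n p => X p.1 * fy n p - zy p) (fun p => X p.1 * uy p - zy p).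
  apply: (sq_cvg_eq (sq_cvgB (sq_cvgM bX cfy) (sq_cvg_cst zyL))) => [n p|p] //.
  by rewrite XE//; exact: fy0.
have c := cvg_seqD (sq_cvg_int cwx cwx)
  (cvg_seqD (sq_cvg_int cwy cwy) (cvg_seqZ (c := - pi ^+ 2) (sq_cvg_int cw cw))).
apply: (cvg_seq_ge0 c) => n; apply: addr_ge0.
  by apply: Rintegral_ge0 => p _; rewrite -expr2 sqr_ge0.
rewrite mulNr; have := wirtinger_test (tn n).
congr (_ <= _ - _); apply: eq_Rint => p; by rewrite mul0r add0r.
Qed.

Variable M : R.
Hypothesis U_le : forall p, O p -> `|U p - p.1 * mode p.2| <= M.

Let xsL : sqsum2 (fun p => p.1 * s p).
Proof.
have [[ms [K sK]] [A sA]] := box_mode_below cphi phi_le rho.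
apply: box_bounded_sq; split; last first.
  by exists A => p; rewrite mulf_eq0 negb_or => /andP[_ /sA].
split; first exact: (measurable_funM (@measurable_fst _ _ (RM R) (RM R)) ms).
exists (`|A| * K) => p; have [s0|/sA] := eqVneq (s p) 0.
  by rewrite s0 mulr0 normr0 mulr_ge0// (le_trans (normr_ge0 _) (sK p)).
case: p => x y /strip_boxE[x1 x2 _ _]; rewrite normrM ler_pM//=.
have := ler_norm A; rewrite ler_norml => ?; apply/andP; split; lra.
Qed.

(** The slope of the cutoff is at most [4 / w], over a strip of width [w]. *)
Let remainder : int2 (fun p => ind (0 < p.1)
    * ((dX p.1 * (u p - p.1 * s p)) * (dX p.1 * (u p - p.1 * s p)))) <= 16 * M ^+ 2 / w.
Proof.
have M0 : 0 <= M by exact: le_trans (normr_ge0 _) (U_le (Omega_point phi_ge0)).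
have w1 : (1 : R) <= 1 + w by rewrite lerDl ltW.
have -> : 16 * M ^+ 2 / w = (4 / w * M) ^+ 2 * (1 + w - 1) by field; exact: lt0r_neq0.
rewrite -(int2_ind w1) -RintZ; last exact: (box_bounded_summable (box_ind 1 (1 + w))).
apply: Rint_le.
- apply: summableM_bounded => //.
  have L := sq_summable_bounded bdX (sq_summableB uL xsL).
  exact: (sq_summableM L L).
- by apply: summableZ; exact: (box_bounded_summable (box_ind 1 (1 + w))).
move=> p.
have rhs_ge0 : 0 <= (4 / w * M) ^+ 2 * (ind (1 < p.1 < 1 + w) * ind (0 < p.2 < 1)).
  by rewrite mulr_ge0 ?sqr_ge0// mulr_ge0 ?ler0n.
have [p1|] := boolP (p.1 <= 1); first by have [_ ->] := X_near p1; rewrite !mul0r mulr0.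
rewrite -ltNge => p1.
have [pr|] := boolP (p.1 < rho); last first.
  by rewrite -leNgt => /X_far[_ ->]; rewrite !mul0r mulr0 andbF mul0r mulr0.
have p0 : 0 < p.1 by apply: lt_trans p1.
rewrite p0 p1 /= mul1r -expr2 mul1r.
rewrite /u /s /mode_below /in_below pr andbT.
have -> : - phi p.2 < p.1 by apply: le_lt_trans p0; rewrite oppr_le0.
rewrite andbT; have [p2|] := boolP (0 < p.2 < 1); last first.
  by rewrite !mul0r mulr0 subrr mulr0 expr0n/= mulr0.
rewrite !mul1r mulr1.
have pO : O p by apply/OmegaP; rewrite p2/=; apply: le_lt_trans p0; rewrite oppr_le0.
have : `|dX p.1 * (U p - p.1 * mode p.2)| <= 4 / w * M.
  by rewrite normrM ler_pM//; exact: U_le.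
by rewrite ler_norml => /andP[]; nra.
Qed.

(** This is [wirtinger_solution] with the square expanded. The trial slope [h]
    acts on the protruding part and the trial function [z] everywhere; both are
    free. The choice [h = 1], [z = 0] bounds the flux from above, and [h = 0]
    bounds it from below. *)
Lemma energy_inequality :
  0 <= (1 - 2 * h) * flux
     + h ^+ 2 * int1 (fun y => ind (0 < y < 1) * (phi y * mode y ^+ 2))
     + (int2 (fun p => zx p * zx p) + int2 (fun p => zy p * zy p)
        - pi ^+ 2 * int2 (fun p => z p * z p))
     - 2 * (1 - h) * trace z + 16 * M ^+ 2 / w.
Proof.
have sq (a b : R * R -> R) : sqsum2 a -> sqsum2 b -> sum2 (fun p => a p * b p).
  exact: sq_summableM.
have bX2 := bounded_measM bX bX.
have bX3 := bounded_measM (bounded_measM (bounded_cst 2) bX) bdX.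
have gL : sqsum2 (fun p => 2 * X p.1 * dX p.1 * u p + X p.1 ^+ 2 * ux p).
  by case: cX2x.
have g2L : sqsum2 (fun p => X p.1 ^+ 2 * uy p) by case: cX2y.
have g0L : sqsum2 (fun p => X p.1 ^+ 2 * u p) by case: cX2.
have remL := sq_summable_bounded bdX (sq_summableB uL xsL).
(* On [x > 0] the squares of [U], of [x * mode] and their product gather in the
   second term, the remainder; what is left there is a combination of
   [zero_flux_profile] and [flux_right]. *)
pose l1 : seq (R * (R * R -> R)) := [::
  (1, fun p => ux p * (2 * X p.1 * dX p.1 * u p + X p.1 ^+ 2 * ux p));
  (1, fun p => ind (0 < p.1)
    * ((dX p.1 * (u p - p.1 * s p)) * (dX p.1 * (u p - p.1 * s p))));
  (- 1, fun p => ind (0 < p.1) * (dprofile p.1 * (s p * ux p)));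
  (- 1, fun p => ind (0 < p.1)
    * (s p * (2 * X p.1 * dX p.1 * u p + X p.1 ^+ 2 * ux p)));
  (1, fun p => ind (0 < p.1) * (dprofile p.1 * (s p * s p)));
  (1, fun p => zx p * zx p);
  (- 2, fun p => ux p * zx p);
  (2, fun p => ind (0 < p.1) * (s p * zx p));
  (- 2 * h, fun p => ind (p.1 < 0) * (s p * ux p));
  (2 * h, fun p => ind (p.1 < 0) * (s p * zx p));
  (h ^+ 2, fun p => ind (p.1 < 0) * (s p * s p))].
have l1S : all_summable plane_measure l1.
  { rewrite /l1 /all_summable /=; repeat apply: conj; last by [].
  all: try exact: sq.
  all: apply: summableM_bounded => //; try exact: sq.
  all: try (apply: summableM_bounded; [exact: (bounded2_fst b_dprofile)|exact: sq]). }
pose l2 : seq (R * (R * R -> R)) := [::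
  (1, fun p => uy p * (X p.1 ^+ 2 * uy p));
  (- 2, fun p => uy p * zy p);
  (1, fun p => zy p * zy p)].
have l2S : all_summable plane_measure l2 by do 3!(apply: conj; first exact: sq).
pose l3 : seq (R * (R * R -> R)) := [::
  (1, fun p => u p * (X p.1 ^+ 2 * u p));
  (- 2, fun p => u p * z p);
  (1, fun p => z p * z p)].
have l3S : all_summable plane_measure l3 by do 3!(apply: conj; first exact: sq).
have := wirtinger_solution.
have -> : int2 (fun p => (dX p.1 * u p + X p.1 * ux p - zx p - Hs p)
      * (dX p.1 * u p + X p.1 * ux p - zx p - Hs p))
    = int2 (fun p => \sum_(cf <- l1) cf.1 * cf.2 p).
  apply: eq_Rint => p; rewrite /l1 !big_cons big_nil /= /Hs /H.
  have [/X_near[X1 dX1]|p1] := leP p.1 1.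
    rewrite /dprofile X1 dX1; have [p0|p0] := ltP 0 p.1.
      by rewrite (le_gtF (ltW p0)) /= !mulr1n !mulr0n; ring.
    by case: (p.1 < 0); rewrite /= ?mulr1n ?mulr0n; ring.
  have p0 : 0 < p.1 by apply: lt_trans p1.
  have [_ -> _] := z_near p1.
  by rewrite p0 (le_gtF (ltW p0)) /dprofile /= !mulr1n !mulr0n; ring.
have -> : int2 (fun p => (X p.1 * uy p - zy p) * (X p.1 * uy p - zy p))
    = int2 (fun p => \sum_(cf <- l2) cf.1 * cf.2 p).
  apply: eq_Rint => p; rewrite /l2 !big_cons big_nil /=.
  have [/X_near[X1 dX1]|/z_near[_ _ ->]] := leP p.1 1; last by ring.
  by rewrite X1; ring.
have -> : int2 (fun p => (X p.1 * u p - z p) * (X p.1 * u p - z p))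
    = int2 (fun p => \sum_(cf <- l3) cf.1 * cf.2 p).
  apply: eq_Rint => p; rewrite /l3 !big_cons big_nil /=.
  have [/X_near[X1 dX1]|/z_near[-> _ _]] := leP p.1 1; last by ring.
  by rewrite X1; ring.
rewrite !Rint_lin// /l1 /l2 /l3 !big_cons !big_nil /=.
rewrite flux_right zero_flux_profile -[int2 (fun p => ind (p.1 < 0) * (s p * ux p))]/flux.
rewrite (trace_left cphi phi_ge0 phi_le rho_gt0 zt).
rewrite (mode_sq_left cphi phi_ge0 phi_le rho_gt0).
have zr p : rho <= p.1 -> [/\ z p = 0, zx p = 0 & zy p = 0].
  by move=> pr; apply: z_near; apply: lt_le_trans pr; rewrite ltrDl.
rewrite (trace_right cphi rho_gt0 zt); last by move=> p /zr[].
have p0 : profile 0 = 0 by rewrite /profile mul0r.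
have pr : profile rho = 0 by rewrite /profile X20// mulr0.
rewrite (mode_sq_right cphi phi_ge0 phi_le rho_gt0 profileC b_dprofile p0 pr).
have := weak_cut cphi sqUx sqUy wU zt zr.
have := energy_identity; have := remainder.
rewrite -/u -/ux -/uy.
set T4 := int2 (fun p => ind (0 < p.1) * _).
set T1 := int2 (fun p => ux p * (_ + _)); set T2 := int2 (fun p => uy p * (_ * uy p)).
set T3 := int2 (fun p => u p * (_ * u p)).
move: T4 T1 T2 T3 => T4 T1 T2 T3.
set T11 := int2 (fun p => ux p * zx p); set T12 := int2 (fun p => uy p * zy p).
set T13 := int2 (fun p => u p * z p); move: T11 T12 T13 => T11 T12 T13.
move: (int2 (fun p => zx p * zx p)) (int2 (fun p => zy p * zy p)) (int2 (fun p => z p * z p)) => T8 T9 T10.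
move: (int1 _) (trace z) flux (16 * M ^+ 2 / w) => V l c E.
move=> h1 h2 h3 h4.
have {}h2 : T1 = pi ^+ 2 * T3 - T2 by rewrite -h2; ring.
have {}h3 : T11 = pi ^+ 2 * T13 - T12 by rewrite -h3; ring.
apply: (le_trans h4); rewrite h2 h3 -subr_ge0.
rewrite [X in 0 <= X](_ : _ = E - T4); first by rewrite subr_ge0.
by ring.
Qed.

End Energy.

(** * The flux is the trace on x = 0 *)

Section Trace.
Context {R : realType}.
Variables (phi : R -> R) (cphi : continuous phi).
Hypothesis phi_ge0 : forall y, 0 <= phi y.
Variable B : R.
Hypothesis phi_le : forall y, phi y <= B.
Variable w : R.
Hypothesis w_gt0 : 0 < w.
Implicit Types (f fx fy g gx gy z zx zy : R * R -> R).

Let rho : R := 1 + w.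
Let rho_gt0 : 0 < rho. Proof. by rewrite addr_gt0. Qed.

Local Notation O := (Omega_infty phi).
Local Notation cut f := (fun p => ind (in_below phi rho p) * f p).

Variables (U Ux Uy : R * R -> R).
Hypothesis sqU : square_integrable (Omega_below phi rho) U.
Hypothesis sqUx : square_integrable (Omega_below phi rho) Ux.
Hypothesis sqUy : square_integrable (Omega_below phi rho) Uy.
Hypothesis aU : forall e : R, 0 < e -> exists2 psi, C1c O psi &
  (H1_dist2 (Omega_below phi rho) U Ux Uy psi < e%:E)%E.
Hypothesis cU : {in O, continuous U}.
Hypothesis U0 : {in boundary O, forall p, U p = 0}.
Variable M : R.
Hypothesis U_le : forall p, O p -> `|U p - p.1 * mode p.2| <= M.

(** The lines along which [(0, y)] is an interior point of the domain. *)
Let inner (y : R) : bool := (0 < y < 1) && (0 < phi y).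

Let innerP y : inner y <-> O (0, y).
Proof.
rewrite /inner; split=> [yO|/OmegaP]; last by rewrite /= oppr_lt0.
by apply/OmegaP; rewrite /= oppr_lt0.
Qed.

Let b_inner : bounded1 (fun y : R => ind (inner y) : R).
Proof.
split; last by exists 1 => y; case: (inner y); rewrite ?normr1 ?normr0.
apply: (@meas_indicator R _ (RM R)); apply: measurable_and.
  by apply: measurable_and; exact: measurable_fun_ltr.
by apply: measurable_fun_ltr => //; exact: meas1_continuous.
Qed.

Let b_lt (d : R) : bounded1 (fun x : R => ind (0 < x < d) : R).
Proof.
split; first exact: meas_oo.
by exists 1 => x; case: (_ && _); rewrite ?normr1 ?normr0.
Qed.

Let b_lin (d : R) : 0 < d -> bounded1 (fun x : R => ind (0 < x < d) * (d - x)).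
Proof.
move=> d0; split; last first.
  exists d => x; have [/andP[x0 xd]|_] := boolP (0 < x < d).
    by rewrite mul1r ler_norml; apply/andP; split; lra.
  by rewrite mul0r normr0 ltW.
apply: measurable_funM; first exact: meas_oo.
by apply: measurable_funB => //; exact: measurable_cst.
Qed.

Let U_bound p : O p -> 0 < p.1 < 1 -> `|U p| <= M + 1.
Proof.
move=> pO /andP[p0 p1]; have := U_le pO; have := mode_le1 p.2.
rewrite !ler_norml => /andP[? ?] /andP[? ?]; apply/andP; split; nra.
Qed.

Let M_ge0 : 0 <= M.
Proof. exact: le_trans (normr_ge0 _) (U_le (Omega_point phi_ge0)). Qed.

Let Ux_sum : sum2 (cut Ux).
Proof. exact: (sqsum_cut_sum cphi phi_le (square_integrable_sqsum cphi sqUx)). Qed.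

(** Integration by parts in [x] against the weight [d - x]. The other lines carry
    no trace: there the test function vanishes at [x = 0]. *)
Let parts_test d f fx fy : 0 < d <= 1 -> test O f fx fy ->
  int2 (fun p => ind (inner p.2) * mode p.2 * (ind (0 < p.1 < d) * (d - p.1)) * fx p)
  - int2 (fun p => ind (inner p.2) * mode p.2 * ind (0 < p.1 < d) * f p)
  = - (d * trace f).
Proof.
move=> /andP[d0 d1] ft; have [fb fxb fyb] := test_box (@Omega_strip _ phi) ft.
have bm := bounded2_snd (bounded_measM b_inner (@bounded_mode R)).
have i1 := box_boundedM fxb (bounded_measM bm (bounded2_fst (b_lin d0))).
have i2 := box_boundedM fb (bounded_measM bm (bounded2_fst (b_lt d))).
rewrite -RintB; [|exact: box_bounded_summable..].
rewrite (fubinixy (box_boundedB i1 i2)).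
have ts : sum1 (fun y => f (0, y) * mode y).
  have := box_bounded_slicex 0 (box_boundedM fb (bounded2_snd (@bounded_mode R))).
  by under eq_fun do rewrite mulrC.
rewrite -mulNr /trace -RintZ//; apply: eq_Rint => y.
transitivity (int1 (fun x => ind (inner y) * mode y *
    (ind (0 < x < d) * ((d - x) * fx (x, y) - f (x, y))))).
  by apply: eq_Rint => x /=; ring.
have [fl _] := test_line 0 y ft.
have gC : C1_line (fun x => (d - x) * f (x, y)) (fun x => (d - x) * fx (x, y) - f (x, y)).
  apply: (C1_line_eq (C1_lineM (C1_line_affine (-1) d) fl)) => x; ring.
rewrite RintZ; last by apply: sum1_oo => [|x _]; [exact: ltW|exact: gC.2].
rewrite (ftc_oo (ltW d0) (fun x _ => gC.1 x) (fun x _ => gC.2 x)) subrr mul0r sub0r subr0.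
have [/innerP yO|/negP yO] := boolP (inner y); first by rewrite mul1r; ring.
have [-> _ _] := test_out ft (fun h => yO ((innerP y).2 h)); ring.
Qed.

Let parts_solution d : 0 < d <= 1 ->
  int2 (fun p => ind (inner p.2) * mode p.2 * (ind (0 < p.1 < d) * (d - p.1)) * cut Ux p)
  - int2 (fun p => ind (inner p.2) * mode p.2 * ind (0 < p.1 < d) * cut U p)
  = - (d * flux phi w Ux).
Proof.
move=> d01; have /andP[d0 d1] := d01.
have [f [fx [fy [ft cf cfx cfy]]]] := approximation cphi sqU sqUx sqUy aU.
have tc := trace_cvg cphi phi_ge0 phi_le w_gt0 ft cfx.
have bm := bounded2_snd (bounded_measM b_inner (@bounded_mode R)).
have c1 := cvg_cut cphi phi_le (bounded_measM bm (bounded2_fst (b_lin d0))) cfx.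
have c2 := cvg_cut cphi phi_le (bounded_measM bm (bounded2_fst (b_lt d))) cf.
rewrite -mulNr; apply: (cvg_seq_unique (cvg_seqB c1 c2)); apply: (cvg_seq_eq _ (cvg_seqZ (c := - d) tc)) => n.
rewrite mulNr -(parts_test d01 (ft n)); congr (_ - _); apply: eq_Rint => p.
  have [x01|] := boolP (0 < p.1 < d); last by rewrite !mul0r !mulr0 !mul0r.
  have [pO|pO] := pselect (O p).
    have -> : in_below phi rho p; last by rewrite !mul1r.
    rewrite /in_below; apply/andP; split; first by move/OmegaP : pO.
    by case/andP : x01 => _ /lt_le_trans; apply; rewrite (le_trans d1)// lerDl ltW.
  by have [_ -> _] := test_out (ft n) pO; rewrite !mulr0.
have [x01|] := boolP (0 < p.1 < d); last by rewrite !mulr0 !mul0r.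
have [pO|pO] := pselect (O p).
  have -> : in_below phi rho p; last by rewrite !mul1r.
  rewrite /in_below; apply/andP; split; first by move/OmegaP : pO.
  by case/andP : x01 => _ /lt_le_trans; apply; rewrite (le_trans d1)// lerDl ltW.
by have [-> _ _] := test_out (ft n) pO; rewrite !mulr0.
Qed.

Let average (n : nat) (y : R) : R :=
  (step n)^-1 * int1 (fun x => ind (inner y) * ind (0 < x < step n) * cut U (x, y)).

Let average_box n : box_bounded (fun p => ind (inner p.2) * ind (0 < p.1 < step n) * cut U p).
Proof.
have [mU _] := square_integrable_sqsum cphi sqU.
have mi := bounded_measM (bounded2_snd b_inner) (bounded2_fst (b_lt (step n))).
have s1 : step n <= (1 : R) by rewrite /step invf_le1// ler1n.
split; [split|].
- by apply: measurable_funM => //; case: mi.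
- exists (M + 1) => p; have M1 : 0 <= M + 1 by rewrite addr_ge0.
  have [|_] := boolP (inner p.2); last by rewrite !mul0r normr0.
  have [/andP[p0 p1] _|_ _] := boolP (0 < p.1 < step n); last by rewrite mulr0 mul0r normr0.
  case E : (in_below phi rho p); last by rewrite mul0r mulr0 normr0.
  rewrite !mul1r; apply: U_bound; last by rewrite p0 (lt_le_trans p1).
  by apply/OmegaP; move: E; rewrite /in_below => /andP[].
exists 1 => -[x y] /=.
have [/andP[/andP[y0 y1] _]|_] := boolP (inner y); last by rewrite !mul0r eqxx.
have [/andP[x0 x1] _|_] := boolP (0 < x < step n); last by rewrite mulr0 mul0r eqxx.
by apply/strip_boxE; split; lra.
Qed.

Let int1_cst (d c : R) : 0 < d -> int1 (fun x => ind (0 < x < d) * c) = c * d.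
Proof.
move=> d0; have [hd cd] := C1_line_affine c 0.
by rewrite (ftc_oo (ltW d0) (fun x _ => hd x) (fun x _ => cd x)); ring.
Qed.

Let sum1_cst (d c : R) : 0 < d -> sum1 (fun x => ind (0 < x < d) * c).
Proof. by move=> d0; apply: sum1_oo => [|x _]; [exact: ltW|exact: cvg_cst]. Qed.

Let step_le1 n : step n <= (1 : R).
Proof. by rewrite /step invf_le1// ler1n. Qed.

Let average_le n y : `|average n y| <= M + 1.
Proof.
have d0 := @step_gt0 R n; rewrite /average normrM normfV (gtr0_norm d0).
rewrite ler_pdivrMl// mulrC -int1_cst//.
apply: Rint_norm_le; first exact: sum1_cst.
  exact: summable_meas (box_bounded_slicey y (average_box n)).
move=> x; have M1 : 0 <= M + 1 by rewrite addr_ge0.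
have [/andP[x0 x1]|] := boolP (0 < x < step n); last by rewrite mulr0 !mul0r normr0.
rewrite !mul1r mulr1; case: (inner y); last by rewrite mul0r normr0.
case E : (in_below phi rho (x, y)); last by rewrite mul0r mulr0 normr0.
rewrite !mul1r; apply: U_bound; last by rewrite x0 (lt_le_trans x1).
by apply/OmegaP; move: E; rewrite /in_below => /andP[].
Qed.

Let average_cvg y : (fun n => average n y) @ \oo --> ind (inner y) * U (0, y).
Proof.
have [yi|yi] := boolP (inner y); last first.
  rewrite mul0r; apply: (@cvg_near_step _ _ _ 0) => //; apply: nearW => n.
  rewrite /average (negbTE yi) (@eq_Rint _ _ _ line_measure _ (fun=> 0)).
    by rewrite Rintegral_cst// !mul0r mulr0 subrr normr0.
  by move=> x; rewrite !mul0r.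
rewrite mul1r; apply/cvgrPdist_le => /= e e0.
have yO : (0, y) \in O by rewrite inE; apply/innerP.
have /cvgrPdist_le/(_ _ e0)/nbhs_slicex/nbhs_ballP[r /= r0 rU] := cU yO.
near=> n.
have nr : step n < r by near: n; exact: step_lt.
have d0 := @step_gt0 R n.
have -> : U (0, y) - average n y =
    (step n)^-1 * (int1 (fun x => ind (0 < x < step n) * U (0, y))
      - int1 (fun x => ind (inner y) * ind (0 < x < step n) * cut U (x, y))).
  by rewrite int1_cst// mulrBr -/(average n y) mulrCA mulVf ?mulr1// gt_eqF.
rewrite -RintB; [|exact: sum1_cst|exact: (box_bounded_slicey y (average_box n))].
rewrite normrM normfV (gtr0_norm d0) ler_pdivrMl// mulrC -int1_cst//.
apply: Rint_norm_le; first exact: sum1_cst.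
  apply: summable_meas; apply: summableB; first exact: sum1_cst.
  exact: (box_bounded_slicey y (average_box n)).
move=> x; rewrite yi.
have [/andP[x0 x1]|] := boolP (0 < x < step n).
  have -> : in_below phi rho (x, y).
    rewrite /in_below /=; move: yi => /andP[-> _] /=; apply/andP; split.
      by apply: le_lt_trans x0; rewrite oppr_le0.
    by apply: lt_trans (lt_le_trans x1 (step_le1 n)) _; rewrite ltrDl.
  rewrite !mul1r; apply: rU; rewrite /ball/= sub0r normrN gtr0_norm//.
  exact: lt_trans nr.
by rewrite mulr0 !mul0r subrr normr0.
Unshelve. all: by end_near. Qed.

(** The point [(0, y)] is then on the boundary. *)
Let U_origin y : 0 < y < 1 -> ~~ inner y -> U (0, y) = 0.
Proof.
move=> y01 yi; apply: U0; rewrite inE; split; last first.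
  by move=> /interior_subset /innerP yi'; rewrite yi' in yi.
move=> A /nbhs_slicex /nbhs_ballP[r /= r0 rA].
have r2 : 0 < r / 2 by rewrite divr_gt0.
exists (r / 2, y); split; last first.
  by apply: rA; rewrite /ball/= sub0r normrN gtr0_norm// ltr_pdivrMr// mulr2n mulrDr; lra.
apply/OmegaP; rewrite /= y01 /=.
by apply: le_lt_trans r2; rewrite oppr_le0.
Qed.

(** By [parts_solution], the flux differs from the average of [U * mode] over
    [0 < x < d] by at most the integral of [`|Ux|] there, which tends to 0 with
    [d]; the average tends to the value on the segment by continuity. *)
Lemma flux_trace :
  flux phi w Ux = int1 (fun y => ind (0 < y < 1) * (U (0, y) * mode y)).
Proof.
pose I n := int2 (fun p => ind (0 < p.1 < step n) * `|cut Ux p|).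
pose A n := int1 (fun y => average n y * (ind (0 < y < 1) * mode y)).
have Ic : I @ \oo --> 0.
  have := @cvg_int_bounded _ _ _ plane_measure
    (fun n (p : R * R) => ind (0 < p.1 < step n)) (fun=> 0) (fun p => `|cut Ux p|) 1
    (summable_norm Ux_sum).
  have -> : int2 (fun p => 0 * `|cut Ux p|) = 0.
    rewrite (@eq_Rint _ _ _ plane_measure _ (fun=> 0)) ?Rintegral_cst ?mul0r//.
    by move=> p; rewrite mul0r.
  apply=> [n||n p|p].
  - by have [] := bounded2_fst (b_lt (step n)).
  - exact: measurable_cst.
  - by case: (_ && _); rewrite ?normr1 ?normr0.
  - have [p0|p0] := ltP 0 p.1.
      apply: (@cvg_near_step _ _ _ 0) => //; near=> n.
      have : step n < p.1 by near: n; exact: step_lt.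
      by move=> /ltW; rewrite leNgt => /negbTE ->; rewrite subrr normr0 mul0r.
    by apply: (@cvg_near_step _ _ _ 0) => //; apply: nearW => n; rewrite subrr normr0 mul0r.
have Ac : A @ \oo --> int1 (fun y => ind (inner y) * U (0, y) * (ind (0 < y < 1) * mode y)).
  have ms n : meas1 (average n).
    apply: measurable_funM; first exact: measurable_cst.
    exact: (meas1_fubinixy (average_box n)).
  have ws : sum1 (fun y : R => ind (0 < y < 1) * mode y).
    have cm : continuous (@mode R) := C1_line_cont C1_mode.
    by apply: sum1_oo => // y _; exact: cm.
  apply: (cvg_int_bounded ws ms _ average_le average_cvg).
  exact: (@measurable_fun_cvg _ (RM R) R setT average _ ms (fun y _ => @average_cvg y)).
have -> : int1 (fun y => ind (0 < y < 1) * (U (0, y) * mode y)) =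
    int1 (fun y => ind (inner y) * U (0, y) * (ind (0 < y < 1) * mode y)).
  apply: eq_Rint => y; have [y01|_] := boolP (0 < y < 1); last by rewrite !mul0r mulr0.
  have [yi|yi] := boolP (inner y); first by rewrite !mul1r.
  by rewrite (U_origin y01 yi) mulr0 !mul0r mulr0.
have fluxE n : `|flux phi w Ux - A n| <= I n.
  have d0 := @step_gt0 R n; have d01 : 0 < @step R n <= 1 by rewrite step_gt0 step_le1.
  have P := parts_solution d01.
  set G1 := int2 (fun p => _ * cut Ux p) in P.
  set G2 := int2 (fun p => _ * cut U p) in P.
  have AE : G2 = step n * A n.
    have As : sum1 (fun y => average n y * (ind (0 < y < 1) * mode y)).
      apply: (@summable1_le _ _ 1 (M + 1)).
      - apply: measurable_funM.
          apply: measurable_funM; first exact: measurable_cst.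
          exact: (meas1_fubinixy (average_box n)).
        by case: (bounded_measM (b_lt 1) (@bounded_mode R)).
      - move=> y; rewrite -[leRHS]mulr1 normrM ler_pM// -[leRHS]mul1r normrM ler_pM//.
          by case: (_ && _); rewrite ?normr1 ?normr0.
        exact: mode_le1.
      - move=> y; have [/andP[y0 y1] _|_] := boolP (0 < y < 1); last by rewrite mul0r mulr0 eqxx.
        by apply/andP; split; lra.
    rewrite /G2 (@eq_Rint _ _ _ plane_measure _ (fun p : R * R =>
      mode p.2 * (ind (inner p.2) * ind (0 < p.1 < step n) * cut U p))); last first.
      by move=> p; ring.
    have mb := box_boundedM (average_box n) (bounded2_snd (@bounded_mode R)).
    rewrite (fubinixy mb) -RintZ//; apply: eq_Rint => y /=.
    rewrite RintZ; last exact: (box_bounded_slicey y (average_box n)).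
    rewrite /average; have [_|y01] := boolP (0 < y < 1).
      by rewrite mul1r; field; exact: lt0r_neq0.
    have -> : inner y = false by rewrite /inner (negbTE y01).
    rewrite (@eq_Rint _ _ _ line_measure _ (fun=> 0)) ?Rintegral_cst ?mul0r ?mulr0 ?mul0r ?mulr0//.
    by move=> x; rewrite !mul0r.
  have -> : flux phi w Ux - A n = - ((step n)^-1 * G1).
    have -> : G1 = step n * A n - step n * flux phi w Ux by rewrite -AE; lra.
    by field; exact: lt0r_neq0.
  rewrite normrN normrM normfV (gtr0_norm d0) ler_pdivrMl// /I -RintZ; last first.
    apply: summableM_bounded; [exact: (bounded2_fst (b_lt _))|exact: summable_norm].
  apply: Rint_norm_le.
  - apply/summableZ/summableM_bounded; [exact: (bounded2_fst (b_lt _))|exact: summable_norm].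
  - apply: measurable_funM; last exact: summable_meas Ux_sum.
    have [] := bounded_measM (bounded2_snd (bounded_measM b_inner (@bounded_mode R)))
      (bounded2_fst (b_lin d0)); by [].
  - move=> p; have [/andP[x0 x1]|_] := boolP (0 < p.1 < step n); last first.
      by rewrite !mul0r !mulr0 !mul0r normr0.
    rewrite !mul1r !normrM ler_wpM2r// -[leRHS]mul1r ler_pM//.
      rewrite -[leRHS]mulr1 ler_pM//; last exact: mode_le1.
      by case: (inner _); rewrite ?normr1 ?normr0.
    by rewrite ler_norml; apply/andP; split; lra.
apply: cvg_seq_unique Ac; apply/cvgrPdist_le => /= e e0.
move/cvgrPdist_le : Ic => /(_ _ e0); apply: filterS => n.
rewrite sub0r normrN => /(le_trans (ler_norm _)); exact: le_trans.
Unshelve. all: by end_near. Qed.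

End Trace.

(** * Two-sided bounds for half of a *)

Section Bounds.
Context {R : realType}.
Variables (phi : R -> R) (cphi : continuous phi).
Hypothesis phi_ge0 : forall y, 0 <= phi y.
Variable B : R.
Hypothesis phi_le : forall y, phi y <= B.
Implicit Types (z zx zy : R * R -> R).
Local Notation O := (Omega_infty phi).

Lemma le_of_vanishing (a K : R) : (forall w, 0 < w -> 0 <= a + K / w) -> 0 <= a.
Proof.
move=> h; rewrite leNgt; apply/negP => a0.
have w0 : 0 < (`|K| + 1) / - a by rewrite divr_gt0// ?oppr_gt0// ltr_wpDl.
have := h _ w0; rewrite leNgt => /negP; apply.
have K1 : 0 < `|K| + 1 by rewrite ltr_wpDl.
have -> : a + K / ((`|K| + 1) / - a) = a * (1 - K / (`|K| + 1)).
  by field; rewrite (lt0r_neq0 K1) (lt_eqF a0).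
rewrite nmulr_rlt0// subr_gt0 ltr_pdivrMr// mul1r.
by have := ler_norm K; lra.
Qed.

Definition half_a (U : R * R -> R) : R :=
  int1 (fun y => ind (0 < y < 1) * (U (0, y) * mode y)).
Definition first_order : R := int1 (fun y => ind (0 < y < 1) * (phi y * mode y ^+ 2)).
Definition dirichlet z zx zy : R :=
  int2 (fun p => zx p * zx p) + int2 (fun p => zy p * zy p)
  - pi ^+ 2 * int2 (fun p => z p * z p).

(** The width [w] of the cutoff is arbitrary, so the remainder disappears. *)
Lemma half_a_energy U z zx zy (h : R) : is_U phi U -> test O z zx zy ->
  (forall p, 1 < p.1 -> [/\ z p = 0, zx p = 0 & zy p = 0]) ->
  0 <= (1 - 2 * h) * half_a U + h ^+ 2 * first_order + dirichlet z zx zy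
       - 2 * (1 - h) * trace z.
Proof.
move=> [cU U0 [Ux [Uy [_ sq wU aU]]] [M U_le]] zt zn.
apply: (@le_of_vanishing _ (16 * M ^+ 2)) => w w0.
have [sqU sqUx sqUy] := sq (1 + w).
have aUw e : 0 < e -> exists2 psi, C1c O psi &
  (H1_dist2 (Omega_below phi (1 + w)) U Ux Uy psi < e%:E)%E := aU (1 + w) e.
have [f [fx [fy [ft cf cfx cfy]]]] := approximation cphi sqU sqUx sqUy aUw.
have := energy_inequality cphi phi_ge0 phi_le w0 sqU sqUx sqUy wU aUw ft cf cfx cfy
  zt zn h U_le.
by rewrite (flux_trace cphi phi_ge0 phi_le w0 sqU sqUx sqUy aUw cU U0 U_le).
Qed.

Lemma test0 : test O (fun=> 0) (fun=> 0) (fun=> 0).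
Proof.
have c0 : C1_plane (fun _ : R * R => 0 : R) (fun=> 0) (fun=> 0).
  split=> [x y|x y|p|p|p]; try exact: is_derive_cst; exact: cvg_cst.
apply: (test_intro (K := set0)) c0 _ _ _; [exact: compact0|by []|].
by move=> p; rewrite eqxx.
Qed.

Lemma half_a_le U : is_U phi U -> half_a U <= first_order.
Proof.
move=> UU; have := half_a_energy 1 UU test0 (fun p _ => And3 erefl erefl erefl).
have z0 : int2 (fun p : R * R => 0 * 0 : R) = 0.
  by rewrite mul0r Rintegral_cst// mul0r.
by rewrite /dirichlet z0; nra.
Qed.

Lemma half_a_ge U z zx zy : is_U phi U -> test O z zx zy ->
  (forall p, 1 < p.1 -> [/\ z p = 0, zx p = 0 & zy p = 0]) ->
  2 * trace z - dirichlet z zx zy <= half_a U.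
Proof. by move=> UU zt zn; have := half_a_energy 0 UU zt zn; nra. Qed.

End Bounds.

(** * Extension and smoothing of the profile *)

Section Extension.
Context {R : realType}.

Definition lipschitz_const (L : R) (phi : R -> R) : Prop :=
  forall x y, `|phi x - phi y| <= L * `|x - y|.

Lemma lipschitz_const_cont L phi : lipschitz_const L phi -> continuous phi.
Proof.
move=> pL x; apply/cvgrPdist_le => /= e e0.
have L0 : 0 <= L by have := le_trans (normr_ge0 _) (pL 0 1); rewrite sub0r normrN1 mulr1.
apply/nbhs_ballP; exists (e / (L + 1)) => /=; first by rewrite divr_gt0// ltr_wpDl.
move=> t; rewrite /ball/= => /ltW xt; apply: (le_trans (pL x t)).
apply: (le_trans (ler_wpM2l L0 xt)).
by rewrite mulrA ler_pdivrMr ?ltr_wpDl//; nra.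
Qed.

(** Outside the unit interval the profile continues as its value at the nearest
    end minus [K] times the distance, cut at 0. As [K] exceeds the maximum of the
    profile, the support lies within distance 1. *)
Lemma lipschitz_extension (phi : R -> R) :
  [lipschitz phi y | y in `[0, 1]] -> (forall y, 0 <= y <= 1 -> 0 <= phi y) ->
  exists psi L B, [/\ forall y, 0 <= y <= 1 -> psi y = phi y,
    lipschitz_const L psi, 0 < L, forall y, 0 <= psi y <= B &
    forall y, psi y != 0 -> -1 <= y <= 2].
Proof.
move=> [L0 [_ hL]] phi0.
pose L : R := `|L0 : R| + 1.
have L1 : 0 < L by rewrite ltr_wpDl.
have pL x y : 0 <= x <= 1 -> 0 <= y <= 1 -> `|phi x - phi y| <= L * `|x - y|.
  move=> x01 y01; have L0L : L0 < L.
    by apply: le_lt_trans (ler_norm (L0 : R)) _; rewrite ltrDl.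
  by apply: (hL L L0L (x, y)); split; rewrite /= in_itv/=.
pose B := phi 0 + L; pose K := B + 1.
have B0 : 0 <= B by apply: addr_ge0; [apply: phi0; rewrite lexx ler01|exact: ltW].
have K0 : 0 < K by rewrite ltr_wpDl.
have phiB y : 0 <= y <= 1 -> phi y <= B.
  move=> y01; have := pL y 0 y01 ltac:(by rewrite lexx ler01).
  rewrite subr0 ler_norml => /andP[_]; rewrite /B.
  move: y01 => /andP[y0 y1]; rewrite (ger0_norm y0) => h.
  have : L * y <= L by rewrite ler_piMr// ltW.
  lra.
pose dist (y : R) := pos (- y) + pos (y - 1).
pose clamp (y : R) := y + pos (- y) - pos (y - 1).
have clamp01 y : 0 <= clamp y <= 1.
  rewrite /clamp; have [[? ->]|[? ->]] := posP (- y);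
  have [[? ->]|[? ->]] := posP (y - 1); apply/andP; split; lra.
have clampL x y : `|clamp x - clamp y| <= `|x - y|.
  have := ler_norm (x - y); have := ler_norm (- (x - y)); rewrite normrN => h1 h2.
  rewrite ler_norml /clamp; have [[? ->]|[? ->]] := posP (- y);
  have [[? ->]|[? ->]] := posP (y - 1); have [[? ->]|[? ->]] := posP (- x);
  have [[? ->]|[? ->]] := posP (x - 1); apply/andP; split; lra.
have distL x y : `|dist x - dist y| <= `|x - y|.
  have := ler_norm (x - y); have := ler_norm (- (x - y)); rewrite normrN => h1 h2.
  rewrite ler_norml /dist; have [[? ->]|[? ->]] := posP (- y);
  have [[? ->]|[? ->]] := posP (y - 1); have [[? ->]|[? ->]] := posP (- x);
  have [[? ->]|[? ->]] := posP (x - 1); apply/andP; split; lra.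
have dist0 y : 0 <= dist y by rewrite addr_ge0 ?pos_ge0.
exists (fun y => pos (phi (clamp y) - K * dist y)), (L + K), B; split.
- move=> y /[dup] /phi0 py /andP[y0 y1]; rewrite /clamp /dist.
  have -> : pos (- y) = 0 by rewrite pos0// oppr_le0.
  have -> : pos (y - 1) = 0 by rewrite pos0// subr_le0.
  by rewrite !addr0 subr0 mulr0 subr0 posE.
- move=> x y; apply: (@le_trans _ _ (`|phi (clamp x) - phi (clamp y)| + K * `|dist x - dist y|)).
    set a := phi (clamp x); set b := phi (clamp y).
    have := ler_norm (a - b); have := ler_norm (- (a - b)); rewrite normrN => h1 h2.
    have h3 : K * (dist x - dist y) <= K * `|dist x - dist y|.
      by rewrite ler_wpM2l ?ler_norm// ltW.
    have h4 : K * (dist y - dist x) <= K * `|dist x - dist y|.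
      by rewrite distrC ler_wpM2l ?ler_norm// ltW.
    rewrite ler_norml; have [[? ->]|[? ->]] := posP (a - K * dist x);
    have [[? ->]|[? ->]] := posP (b - K * dist y); apply/andP; split; lra.
  rewrite [(L + K) * _]mulrDl; apply: lerD.
    by apply: (le_trans (pL _ _ (clamp01 x) (clamp01 y))); rewrite ler_pM2l.
  by rewrite ler_pM2l.
- by rewrite addr_gt0.
- move=> y; rewrite pos_ge0 /=; have := phiB _ (clamp01 y).
  have : 0 <= K * dist y by rewrite mulr_ge0// ltW.
  by have [[? ->]|[? ->]] := posP (phi (clamp y) - K * dist y); lra.
move=> y; have := phiB _ (clamp01 y) => h; have d0 := dist0 y.
have [[? ->]|[h2 _ _]] := posP (phi (clamp y) - K * dist y); first by rewrite eqxx.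
have : dist y <= 1.
  rewrite leNgt; apply/negP => d1.
  have : K < K * dist y by rewrite ltr_pMr.
  by rewrite {1}/K; lra.
rewrite /dist; have [[? ->]|[? ->]] := posP (- y);
  have [[? ->]|[? ->]] := posP (y - 1) => ?; apply/andP; split; lra.
Qed.

(** The Steklov average of [phi] over the interval from [y] to [y + e], lowered by
    [L * e] to stay below [phi]; its derivative is a difference quotient of
    [phi]. *)
Lemma smooth_minorant (phi : R -> R) (L e A : R) : 0 < e -> lipschitz_const L phi ->
  (forall y, phi y != 0 -> - A <= y <= A) ->
  exists g dg, [/\ C1_line g dg, forall y, `|dg y| <= L &
    forall y, phi y - 2 * L * e <= g y <= phi y].
Proof.
move=> e0 pL pA; have cphi := lipschitz_const_cont pL.
have L0 : 0 <= L by have := le_trans (normr_ge0 _) (pL 0 1); rewrite sub0r normrN1 mulr1.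
have phis : sum1 phi.
  have [M _ hM] : exists2 M, 0 <= M & forall y, `|phi y| <= M.
    have M0 y : `|phi y| <= `|phi A| + L * (2 * `|A|).
      have [->|/pA yA] := eqVneq (phi y) 0; first by rewrite normr0 addr_ge0// mulr_ge0// mulr_ge0.
      have -> : phi y = phi A + (phi y - phi A) by ring.
      apply: (le_trans (ler_normD _ _)); rewrite lerD2l.
      apply: (le_trans (pL _ _)); rewrite ler_wpM2l//.
      by have := ler_norm A; move: yA => /andP[? ?] ?; rewrite ler_norml; apply/andP; split; lra.
    by exists (`|phi A| + L * (2 * `|A|)) => //; exact: le_trans (M0 0).
  by apply: (summable1_le _ hM pA); exact: meas1_continuous.
pose F x := \int[lebesgue_measure]_(t in `]-oo, x]) phi t.
have Fd (x : R) : is_derive x 1 F (phi x).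
  have x1 : x < x + 1 by rewrite ltrDl.
  have int1 : lebesgue_measure.-integrable `]-oo, (x + 1)] (EFin \o phi).
    by apply: integrableS phis.
  have [] := @continuous_FTC1 R phi -oo%O x (x + 1) x1 int1 (ltNyr _) (cphi x).
  by move=> Fd Fe; apply: DeriveDef => //; rewrite -derive1E.
have FC : C1_line F phi by split.
pose g y := (F (y + e) - F y) / e - L * e.
pose dg y := (phi (y + e) - phi y) / e.
exists g, dg; split.
- have FeC := C1_line_comp FC (C1_line_affine 1 e).
  have H := C1_lineD (C1_lineM (C1_line_affine 0 e^-1) (C1_lineD FeC
    (C1_lineM (C1_line_affine 0 (-1)) FC))) (C1_line_affine 0 (- (L * e))).
  by apply: (C1_line_eq H) => y; rewrite /g /dg !mul1r; ring.
- move=> y; rewrite /dg normrM normfV (gtr0_norm e0) ler_pdivrMr//.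
  by apply: (le_trans (pL _ _)); rewrite addrAC subrr add0r gtr0_norm.
move=> y; rewrite /g.
have ye : y < y + e by rewrite ltrDl.
have cF : {within `[y, y + e], continuous F}.
  by apply: continuous_subspaceT; exact: C1_line_cont FC.
have [c] := MVT ye (fun x _ => Fd x) cF.
rewrite in_itv/= => /andP[c1 c2] ->.
have -> : phi c * (y + e - y) / e = phi c by field; exact: lt0r_neq0.
have := pL c y; rewrite (gtr0_norm (x := c - y)) ?subr_gt0// ler_norml => /andP[h1 h2].
have : L * (c - y) <= L * e by rewrite ler_wpM2l//; lra.
by move=> h3; apply/andP; split; lra.
Qed.

End Extension.

(** * The trial function and the expansion *)

Lemma sq_le_of_norm (R : realType) (a b : R) : 0 <= b -> `|a| <= b -> a * a <= b ^+ 2.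
Proof. by move=> b0; rewrite ler_norml => /andP[]; nra. Qed.

Section Trial.
Context {R : realType}.
Variables (phi : R -> R) (L B e : R).
Hypothesis phi_lip : lipschitz_const L phi.
Hypothesis L_gt0 : 0 < L.
Hypothesis phi_ge0 : forall y, 0 <= phi y.
Hypothesis phi_le : forall y, phi y <= B.
Hypothesis e_gt0 : 0 < e.
Hypothesis e_le1 : e <= 1.
Hypothesis eB_le1 : e * B <= 1.
Variables (g dg : R -> R).
Hypothesis gC : C1_line g dg.
Hypothesis dg_le : forall y, `|dg y| <= L.
Hypothesis g_bounds : forall y, phi y - 2 * L * e <= g y <= phi y.

Let phie (y : R) : R := e * phi y.
Local Notation O := (Omega_infty phie).

(** The smoothing scale: its effect on the energy must be of second order. *)
Let d : R := e ^+ 2.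
Let d_gt0 : 0 < d. Proof. by rewrite exprn_gt0. Qed.

Let cphie : continuous phie.
Proof.
move=> y; apply: cvgM; first exact: cvg_cst.
exact: lipschitz_const_cont phi_lip y.
Qed.

Let phie_ge0 y : 0 <= phie y. Proof. by rewrite mulr_ge0// ltW. Qed.
Let phie_le y : phie y <= e * B. Proof. by rewrite ler_wpM2l// ltW. Qed.
Let B_ge0 : 0 <= B. Proof. exact: le_trans (phi_ge0 0) (phi_le 0). Qed.

(** A smoothing of the minimum of [x] and 0. *)
Let bend (x : R) : R := - ramp d (- x).
Let dbend (x : R) : R := dramp d (- x).
Let bendC : C1_line bend dbend.
Proof.
have H := C1_lineM (C1_line_affine 0 (-1)) (C1_line_comp (C1_ramp d_gt0) (C1_line_affine (-1) 0)).
by apply: (C1_line_eq H) => x; rewrite /bend /dbend mulN1r addr0; ring.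
Qed.

Let arg (p : R * R) : R := bend p.1 + e * g p.2 - d.
Let argC : C1_plane arg (fun p => dbend p.1) (fun p => e * dg p.2).
Proof.
have gC' := C1_lineM (C1_line_affine 0 e) gC.
have H := C1_planeD (C1_planeD (C1_plane_fst bendC) (C1_plane_snd gC'))
  (C1_plane_fst (C1_line_affine 0 (- d))).
by apply: (C1_plane_eq H) => p; rewrite /arg; ring.
Qed.

Let fade (x : R) : R := cutoff 0 1 x.
Let dfade (x : R) : R := dcutoff 0 1 x.
Let fade_near x : x <= 0 -> fade x = 1 /\ dfade x = 0.
Proof. exact: cutoff_near ltr01. Qed.
Let fade_far x : 1 <= x -> fade x = 0 /\ dfade x = 0.
Proof. by move=> x1; apply: cutoff_far => //; rewrite add0r. Qed.

(** A smoothing, at scale [e ^ 2], of the function that equals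
    [(x + phie y) * sin (pi y)] for [x <= 0] and [phie y * sin (pi y)] for [x]
    positive, cut off for large [x]. *)
Let trial (p : R * R) : R := mode_in d p.2 * (ramp d (arg p) * fade p.1).
Let trialx (p : R * R) : R := mode_in d p.2 *
  (dramp d (arg p) * dbend p.1 * fade p.1 + ramp d (arg p) * dfade p.1).
Let trialy (p : R * R) : R := dmode_in d p.2 * (ramp d (arg p) * fade p.1)
  + mode_in d p.2 * (dramp d (arg p) * (e * dg p.2) * fade p.1).

Let trialC : C1_plane trial trialx trialy.
Proof.
have H := C1_planeM (C1_plane_snd (C1_mode_in d_gt0))
  (C1_planeM (C1_plane_comp (C1_ramp d_gt0) argC) (C1_plane_fst (C1_cutoff 0 1))).
by apply: (C1_plane_eq H) => p; rewrite /trial /trialx /trialy /fade /dfade; ring.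
Qed.

Let bend_le0 x : bend x <= 0.
Proof. by rewrite oppr_le0; have [] := ramp_bounds (- x) d_gt0. Qed.

Let bend_lex x : bend x <= x + d / 2.
Proof. by rewrite /bend; have [_ _] := ramp_bounds (- x) d_gt0; lra. Qed.

Let compact_support : compact (`[-1, 1] `*` (`[0, 1] `&` [set y | d <= mode y])
  `&` [set p | 0 <= arg p]).
Proof.
have cm : continuous (@mode R) := C1_line_cont C1_mode.
apply: compact_closedI.
  apply: compact_setX; first exact: segment_compact.
  apply: compact_closedI; first exact: segment_compact.
  apply: (@closed_comp _ _ mode [set t | d <= t]); last exact: closed_ge.
  by move=> y _; exact: cm.
apply: (@closed_comp _ _ arg [set t | 0 <= t]); last exact: closed_ge.
by move=> p _; case: argC => _ _ ca _ _; exact: ca.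
Qed.

Let arg_ge0 p : 0 <= arg p -> - phie p.2 < p.1.
Proof.
rewrite /arg /phie => a0; have := bend_lex p.1; have /andP[_ h] := g_bounds p.2.
have : e * g p.2 <= e * phi p.2 by rewrite ler_wpM2l// ltW.
by have := d_gt0; lra.
Qed.

Let trial_test : test O trial trialx trialy.
Proof.
apply: (test_intro trialC compact_support).
  move=> [x y] [/= [xx [yy my]] ap]; apply/OmegaP => /=.
  rewrite (arg_ge0 ap) andbT; move: yy; rewrite in_itv/= => /andP[y0 y1].
  rewrite !lt_neqAle y0 y1 !andbT; apply/andP; split.
    by apply: contraTneq my => <-; rewrite mode0 -ltNge.
  by apply: contraTneq my => ->; rewrite mode1 -ltNge.
move=> [x y] tz.
have my : mode_in d y != 0 by apply: contraNneq tz => m0; rewrite /trial /= m0 mul0r.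
have ra : ramp d (arg (x, y)) != 0.
  by apply: contraNneq tz => r0; rewrite /trial r0 mul0r mulr0.
have fx : fade x != 0 by apply: contraNneq tz => f0; rewrite /trial /= f0 !mulr0.
have [/andP[y0 y1] _ dm] := mode_in_supp d_gt0 my.
have a0 : 0 < arg (x, y).
  by rewrite ltNge; apply: contra ra => a0; rewrite (ramp0 d_gt0 a0).
have h1 : - phie y < x := arg_ge0 (ltW a0); have h2 := phie_le y.
split; last exact: ltW a0.
split; last by split; rewrite /= ?in_itv/= ?(ltW y0) ?(ltW y1).
rewrite /= in_itv/=; apply/andP; split.
  by have h3 := le_trans h2 eB_le1; move: (phie y) h1 h3 => t ? ?; lra.
rewrite leNgt; apply: contra fx => /ltW x1.
by have [-> _] := fade_far x1; rewrite eqxx.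
Qed.

Let trial_far p : 1 < p.1 -> [/\ trial p = 0, trialx p = 0 & trialy p = 0].
Proof.
move=> /ltW/fade_far[f0 df0]; rewrite /trial /trialx /trialy f0 df0.
by split; rewrite ?mulr0 ?addr0 ?mulr0.
Qed.

Let inside p : trialx p != 0 \/ trialy p != 0 ->
  [/\ 0 < p.2 < 1, - phie p.2 < p.1 & p.1 < 1].
Proof.
move=> h; have pO : O p.
  apply: contrapT => pO; have [_ tx ty] := test_out trial_test pO.
  by case: h; rewrite ?tx ?ty eqxx.
move/OmegaP : pO => /andP[-> ->]; split=> //.
rewrite ltNge; apply/negP => p1; have [f0 df0] := fade_far p1.
by case: h; rewrite /trialx /trialy f0 ?df0 !mulr0 ?addr0 ?mulr0 eqxx.
Qed.

Let ramp_arg_le p : 0 <= ramp d (arg p) <= e * B.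
Proof.
have [-> h _] := ramp_bounds (arg p) d_gt0; apply: le_trans h _.
have eB : 0 <= e * B by rewrite mulr_ge0// ltW.
have [[_ ->]//|[_ ->]] := posP (arg p).
have := bend_le0 p.1; have /andP[_ h] := g_bounds p.2.
have : e * g p.2 <= e * B by apply: ler_wpM2l; [exact: ltW|exact: (le_trans h (phi_le p.2))].
by rewrite /arg; have := d_gt0; lra.
Qed.

Let s := mode_below phie 2.
Let K : R := 4 * B + pi * B + L.
Let K_ge0 : 0 <= K.
Proof. by rewrite !addr_ge0 ?(ltW L_gt0)// mulr_ge0 ?pi_ge0. Qed.
Let box : R * R -> R := fun p => ind (-1 < p.1 < 1) * ind (0 < p.2 < 1).

(** The slope in [x] is at most [mode] on the protruding part; everything else is
    of order [e]. *)
Let trialx_sq p : trialx p * trialx p <= ind (p.1 < 0) * (s p * s p) + (e * K) ^+ 2 * box p.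
Proof.
have rhs1 : 0 <= ind (p.1 < 0) * (s p * s p) by rewrite mulr_ge0// -expr2 sqr_ge0.
have rhs2 : 0 <= (e * K) ^+ 2 * box p by rewrite mulr_ge0 ?sqr_ge0// mulr_ge0.
have [->|tx] := eqVneq (trialx p) 0; first by rewrite mulr0 addr_ge0.
have [y01 x0 x1] := inside (or_introl tx).
have y01' : 0 <= p.2 <= 1 by case/andP : y01 => *; rewrite !ltW.
have [m0 m1 _ m2] := mode_in_bounds p.2 d_gt0.
have {}m1 := m1 y01'.
have xm : -1 < p.1 by have := le_trans (phie_le p.2) eB_le1; lra.
have /andP[dr0 dr1] := dramp_bounds (arg p) d_gt0.
have /andP[r0 r1] := ramp_arg_le p.
have [xneg|xpos] := ltP p.1 0.
  have [f1 df0] := fade_near (ltW xneg).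
  have sE : s p = mode p.2.
    by rewrite /s /mode_below /in_below y01 x0 (lt_trans x1) ?mul1r// ltr1n.
  have /andP[db0 db1] := dramp_bounds (- p.1) d_gt0.
  rewrite /trialx f1 df0 mulr0 addr0 mulr1 mul1r sE.
  have : 0 <= dramp d (arg p) * dbend p.1 <= 1 by rewrite mulr_ge0//= mulr_ile1.
  move: (dramp d _ * _) => c /andP[c0 c1].
  have : 0 <= mode_in d p.2 * c by rewrite mulr_ge0.
  have : mode_in d p.2 * c <= mode p.2 by rewrite -[leRHS]mulr1 ler_pM.
  by move: (mode_in d p.2 * c) rhs2 => a ? ? ?; nra.
have b0 : dbend p.1 = 0 by rewrite /dbend dramp0// oppr_le0.
have bx : box p = 1 by rewrite /box xm x1 y01 mulr1.
rewrite mul0r add0r bx mulr1 /trialx b0 mulr0 mul0r add0r.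
apply: sq_le_of_norm; first by rewrite mulr_ge0 ?K_ge0// ltW.
apply: (@le_trans _ _ (1 * (e * B * 4))).
  rewrite normrM; apply: ler_pM => //; first by rewrite ger0_norm.
  rewrite normrM (ger0_norm r0); apply: ler_pM => //.
  by have := dcutoff_bounds 0 p.1 (@ltr01 R); rewrite divr1.
have eB : 0 <= e * B by rewrite mulr_ge0// ltW.
have -> : e * K = e * B * 4 + e * (pi * B + L) by rewrite /K; ring.
by rewrite mul1r lerDl mulr_ge0 ?(ltW e_gt0)// addr_ge0 ?(ltW L_gt0)// mulr_ge0 ?pi_ge0.
Qed.

Let trialy_sq p : trialy p * trialy p <= (e * K) ^+ 2 * box p.
Proof.
have [->|ty] := eqVneq (trialy p) 0; first by rewrite mulr0 mulr_ge0 ?sqr_ge0// mulr_ge0.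
have [y01 x0 x1] := inside (or_intror ty).
have [m0 m1 _ m2] := mode_in_bounds p.2 d_gt0.
have xm : -1 < p.1 by have := le_trans (phie_le p.2) eB_le1; lra.
have /andP[dr0 dr1] := dramp_bounds (arg p) d_gt0.
have /andP[r0 r1] := ramp_arg_le p.
have /andP[f0 f1] : 0 <= fade p.1 <= 1 by exact: cutoff_bounds ltr01.
have -> : box p = 1 by rewrite /box xm x1 y01 mulr1.
rewrite mulr1; apply: sq_le_of_norm; first by rewrite mulr_ge0 ?K_ge0// ltW.
have -> : e * K = pi * (e * B * 1) + 1 * (1 * (e * L) * 1) + 4 * (e * B) by rewrite /K; ring.
apply: (le_trans (ler_normD _ _)); rewrite -[leLHS]addr0; apply: lerD; last first.
  by rewrite mulr_ge0// mulr_ge0// ltW.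
apply: lerD.
  rewrite (normrM (dmode_in _ _)); apply: ler_pM => //; first exact: dmode_in_bounds.
  rewrite (normrM (ramp _ _)) (ger0_norm r0) (ger0_norm f0); exact: ler_pM.
rewrite (normrM (mode_in _ _)) (ger0_norm m0); apply: ler_pM => //.
rewrite (normrM (_ * _) (fade _)) (ger0_norm f0); apply: ler_pM => //.
rewrite (normrM (dramp _ _)) (ger0_norm dr0); apply: ler_pM => //.
by rewrite normrM (gtr0_norm e_gt0) ler_pM2l.
Qed.

Let V : R := first_order phie.

Let energy_le : dirichlet trial trialx trialy <= V + 4 * (e * K) ^+ 2.
Proof.
have [tb txb tyb] := test_box (@Omega_strip _ phie) trial_test.
have sqs (f : R * R -> R) : box_bounded f -> sum2 (fun p => f p * f p).
  by move=> fb; exact: box_bounded_summable (box_boundedM fb fb.1).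
have bs : sum2 box by exact: (box_bounded_summable (box_ind (-1) 1)).
have eB0 : 0 <= e * B by rewrite mulr_ge0// ltW.
have ss : sum2 (fun p => ind (p.1 < 0) * (s p * s p)).
  apply: summableM_bounded; first exact: bounded_ind_lt0.
  exact: sqs (box_mode_below cphie phie_le 2).
have bi : int2 box = 2.
  by rewrite /box int2_ind; [ring|lra].
have two_gt0 : 0 < (2 : R) by [].
have hx : int2 (fun p => trialx p * trialx p) <= V + 2 * (e * K) ^+ 2.
  have -> : V + 2 * (e * K) ^+ 2 = int2 (fun p => ind (p.1 < 0) * (s p * s p) + (e * K) ^+ 2 * box p).
    rewrite RintD//; last exact: summableZ.
    rewrite RintZ// bi (mode_sq_left cphie phie_ge0 phie_le two_gt0) /V /first_order.
    by congr (_ + _); ring.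
  apply: Rint_le; [exact: sqs|by apply: summableD => //; exact: summableZ|exact: trialx_sq].
have hy : int2 (fun p => trialy p * trialy p) <= 2 * (e * K) ^+ 2.
  have -> : 2 * (e * K) ^+ 2 = int2 (fun p => (e * K) ^+ 2 * box p) by rewrite RintZ// bi; ring.
  apply: Rint_le; [exact: sqs|exact: summableZ|exact: trialy_sq].
have h0 : 0 <= pi ^+ 2 * int2 (fun p => trial p * trial p).
  by rewrite mulr_ge0 ?sqr_ge0//; apply: Rintegral_ge0 => p _; rewrite -expr2 sqr_ge0.
rewrite /dirichlet; lra.
Qed.

Let C1 : R := 2 * B + 2 * L + 2.

Let trace_ge : V - C1 * e ^+ 2 <= trace trial.
Proof.
have [tb txb tyb] := test_box (@Omega_strip _ phie) trial_test.
have cm := @C1_line_cont R _ _ C1_mode.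
have s1 : sum1 (fun y => ind (0 < y < 1) * (phie y * mode y ^+ 2)).
  apply: sum1_oo => // y _; apply: cvgM; first exact: cphie.
  by apply: cvgM; exact: cm.
have s2 : sum1 (fun y : R => ind (0 < y < 1) * (C1 * e ^+ 2)).
  by apply: sum1_oo => // y _; exact: cvg_cst.
have -> : V - C1 * e ^+ 2 = int1 (fun y => ind (0 < y < 1) * (phie y * mode y ^+ 2)
    - ind (0 < y < 1) * (C1 * e ^+ 2)).
  rewrite RintB// /V /first_order; congr (_ - _).
  have [hd cd] := C1_line_affine (C1 * e ^+ 2) 0.
  by rewrite (ftc_oo ler01 (fun x _ => hd x) (fun x _ => cd x)); ring.
apply: Rint_le; first exact: summableB.
  have := box_bounded_slicex 0 (box_boundedM tb (bounded2_snd (@bounded_mode R))).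
  by under eq_fun do rewrite mulrC.
move=> y.
have [y01|y01] := boolP (0 < y < 1); last first.
  have [-> _ _] := test_out trial_test (@not_Omega_y _ phie 0 y y01).
  by rewrite !mul0r subrr.
rewrite !mul1r /trial /=.
have [-> _] := fade_near (@lexx _ R 0).
have y01' : 0 <= y <= 1 by case/andP : y01 => *; rewrite !ltW.
have [m0 m1 m2 m3] := mode_in_bounds y d_gt0.
have {}m1 := m1 y01'; have {}m2 := m2 y01'.
have n0 := mode_ge0 y01'.
have n1 : mode y <= 1 by have := mode_le1 y; rewrite ler_norml => /andP[].
have [r0 _ r2] := ramp_bounds (arg (0, y)) d_gt0.
have bend0 : bend 0 = 0 by rewrite /bend oppr0 ramp0 ?oppr0.
have argE : arg (0, y) = e * g y - d by rewrite /arg /= bend0 add0r.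
rewrite argE in r0 r2 *.
have /andP[g1 _] := g_bounds y.
have eg : e * (phi y - 2 * L * e) <= e * g y by rewrite ler_pM2l.
rewrite mulr1; set A := mode_in d y in m0 m1 m2 m3 *; set r := ramp d _ in r0 r2 *.
have d0 : 0 <= d := ltW d_gt0.
have C0 : 0 <= C1 by rewrite !addr_ge0// mulr_ge0// ltW.
have h1 : e * phi y - (2 * L + 2) * d <= r by move: eg r2 d0; rewrite /d; lra.
have h2 : A * (e * phi y) - (2 * L + 2) * d <= A * r.
  have : A * (e * phi y - (2 * L + 2) * d) <= A * r by rewrite ler_wpM2l.
  have : A * ((2 * L + 2) * d) <= (2 * L + 2) * d.
    by rewrite ler_piMl// mulr_ge0// addr_ge0// mulr_ge0// ltW.
  lra.
have h3 : mode y * (e * phi y) - 2 * B * d <= A * (e * phi y).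
  have : (mode y - 2 * d) * (e * phi y) <= A * (e * phi y) by rewrite ler_wpM2r// phie_ge0.
  have : d * (e * phi y) <= d * B.
    rewrite ler_wpM2l//; apply: (le_trans (phie_le y)).
    by rewrite -[leRHS]mul1r ler_wpM2r.
  lra.
have h4 : mode y * (e * phi y) - C1 * d <= A * r by rewrite /C1; lra.
have h5 : (mode y * (e * phi y) - C1 * d) * mode y <= A * r * mode y by rewrite ler_wpM2r.
have h6 : C1 * d * mode y <= C1 * d by rewrite ler_piMr// mulr_ge0.
by rewrite -/d /phie; lra.
Qed.

Lemma half_a_approx U : is_U phie U ->
  `|half_a U - first_order phie| <= (2 * C1 + 4 * K ^+ 2) * e ^+ 2.
Proof.
move=> UU.
have up := half_a_le cphie phie_ge0 phie_le UU.
have lo := half_a_ge cphie phie_ge0 phie_le UU trial_test trial_far.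
have C0 : 0 <= (2 * C1 + 4 * K ^+ 2) * e ^+ 2.
  rewrite mulr_ge0 ?sqr_ge0// addr_ge0 ?mulr_ge0 ?sqr_ge0//.
  by rewrite !addr_ge0// mulr_ge0// ltW.
have := energy_le; have := trace_ge; rewrite /V exprMn => t1 t2.
rewrite ler_norml; apply/andP; split; last lra.
by move: lo t1 t2; set F := first_order _; lra.
Qed.

End Trial.

Theorem theorem1p2 (R : realType) (phi : R -> R)
    (phi_lip : [lipschitz phi y | y in `[0, 1]])
    (phi_ge0 : forall y : R, 0 <= y <= 1 -> 0 <= phi y) :
  exists C : R, \forall eps \near (0 : R)^'+,
    forall a : R, is_a (fun y => eps * phi y) a ->
      `|a - 2 * eps * \int[lebesgue_measure]_(y in `[0, 1])
                        (phi y * sin (pi * y) ^+ 2)| <= C * eps ^+ 2.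
Proof.
have [psi [L [B [psiE psi_lip L0 psi_bounds psi_supp]]]] := lipschitz_extension phi_lip phi_ge0.
have psi0 y : 0 <= psi y by have /andP[] := psi_bounds y.
have psiB y : psi y <= B by have /andP[] := psi_bounds y.
have B0 : 0 <= B by exact: le_trans (psi0 0) (psiB 0).
have psiA y : psi y != 0 -> - 2 <= y <= 2.
  by move=> /psi_supp /andP[? ?]; apply/andP; split; lra.
exists (2 * (2 * (2 * B + 2 * L + 2) + 4 * (4 * B + pi * B + L) ^+ 2)).
near=> e => a [U UU ->].
have e0 : 0 < e by near: e; exact: nbhs_right_gt.
have e1 : e <= 1 by near: e; apply: nbhs_right_le.
have eB : e * B <= 1.
  have h : e <= (B + 1)^-1 by near: e; apply: nbhs_right_le; rewrite invr_gt0 ltr_wpDl.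
  have B1 : 0 < B + 1 by rewrite ltr_wpDl.
  apply: (@le_trans _ _ ((B + 1)^-1 * B)); first by rewrite ler_wpM2r.
  by rewrite mulrC ler_pdivrMr// mul1r lerDl.
have [g [dg [gC dg_le g_bounds]]] := smooth_minorant e0 psi_lip psiA.
have OE : Omega_infty (fun y => e * phi y) = Omega_infty (fun y => e * psi y).
  apply/seteqP; split => p [p2 p1]; split=> //.
    by rewrite psiE//; case/andP : p2 => *; rewrite !ltW.
  by rewrite -psiE//; case/andP : p2 => *; rewrite !ltW.
have UU' : is_U (fun y => e * psi y) U.
  move: UU; rewrite /is_U /Omega_below OE; exact.
have := half_a_approx psi_lip L0 psi0 psiB e0 e1 eB gC dg_le g_bounds UU'.
have unit_int (f h : R -> R) : (forall y, 0 < y < 1 -> f y = h y) -> f 0 = 0 -> f 1 = 0 ->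
    \int[leb1]_(y in `[0, 1]) f y = int1 (fun y => ind (0 < y < 1) * h y).
  move=> fh f0 f1; rewrite Rintegral_mkcond; apply: (eq_Rint line_measure) => y.
  rewrite patchE mem_setE in_itv/=.
  have [y01|y01] := boolP (0 < y < 1).
    by rewrite mul1r -fh//; case/andP : y01 => *; rewrite !ltW.
  rewrite mul0r; case: ifPn => // /andP[y0 y1].
  have [->//|y0'] := eqVneq y 0; have [->//|y1'] := eqVneq y 1.
  by move: y01; rewrite !lt_neqAle y0 y1 y1' eq_sym y0'.
have m0 : sin (pi * 0) = 0 :> R by exact: mode0.
have m1 : sin (pi * 1) = 0 :> R by exact: mode1.
have -> : \int[leb1]_(y in `[0, 1]) (U (0, y) * sin (pi * y)) = half_a U.
  by apply: unit_int => //; rewrite ?m0 ?m1 mulr0.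
have -> : first_order (fun y => e * psi y) =
    e * \int[lebesgue_measure]_(y in `[0, 1]) (phi y * sin (pi * y) ^+ 2).
  have -> : \int[lebesgue_measure]_(y in `[0, 1]) (phi y * sin (pi * y) ^+ 2)
      = int1 (fun y => ind (0 < y < 1) * (psi y * mode y ^+ 2)).
    apply: unit_int; rewrite ?m0 ?m1 ?expr0n ?mulr0// => y y01.
    by rewrite psiE//; case/andP : y01 => *; rewrite !ltW.
  have cm := @C1_line_cont R _ _ C1_mode.
  have cpsi := lipschitz_const_cont psi_lip.
  rewrite -RintZ; last first.
    apply: sum1_oo => // y _; apply: cvgM; first exact: cpsi.
    by apply: cvgM; exact: cm.
  by apply: eq_Rint => y; ring.
set I := Rintegral _ _ _; set h := half_a U => H.
have -> : 2 * h - 2 * e * I = 2 * (h - e * I) by ring.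
by rewrite normrM ger0_norm// -mulrA ler_pM2l.
Unshelve. all: by end_near. Qed.
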